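(* For any given $t\neq 0$, the flow map at time $t$ of the Schrödinger map equation $\partial_t u=\partial_s(u\times\partial_s u)$ is not continuous as a map from $\mathcal{C}^\infty(T^1,S^2)$, equipped with the weak topology of $H^{1/2}$, to the space of distributions $(\mathcal{C}^\infty(T^1,\mathbb{R}^3))^*$. Indeed, for any $\sigma_0\in\mathbb{R}$ there exists a sequence of smooth initial data $(u_{m,\sigma_0}(0,\cdot))_{m\in\mathbb{N}}$ in $\mathcal{C}^\infty(T^1,S^2)$ such that $$u_{m,\sigma_0}(0,\cdot)\rightharpoonup u^*(0,\cdot)\qquad\text{weakly in }H^{1/2}(T^1,\mathbb{R}^3)\text{ as }m\to\infty,$$ where $u^*(t,s):=(\cos s,\sin s,0)$ is a stationary solution of the Schrödinger map equation, and such that, for any $t\in\mathbb{R}$, the corresponding solutions $u_{m,\sigma_0}$ satisfy $$u_{m,\sigma_0}(t,\cdot)\rightharpoonup u^*(t,\cdot+\sigma_0t)\qquad\text{weakly in }H^{1/2}(T^1,\mathbb{R}^3)\text{ as }m\to\infty.$$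
   Context: $T^1=\mathbb{R}/2\pi\mathbb{Z}$, $S^2$ is the unit sphere of $\mathbb{R}^3$, and $\times$ is the vector product in $\mathbb{R}^3$. The Schrödinger map equation is $\partial_t u=\partial_s(u\times\partial_s u)$ for $u:\mathbb{R}\times T^1\to S^2$. For every initial datum in $H^k(T^1,S^2)$ with $k\ge2$ it has a unique global solution in $\mathcal{C}(\mathbb{R},H^k(T^1,S^2))$; the flow map at time $t$ sends a smooth initial datum $u(0,\cdot)\in\mathcal{C}^\infty(T^1,S^2)$ to $u(t,\cdot)$, where $u$ is that solution. ''Equipped with the weak topology of $H^{1/2}$'' means with the topology induced by the weak topology of $H^{1/2}(T^1,\mathbb{R}^3)$. *)

(* Defs.v *)
From HB Require Import structures.
From mathcomp Require Import all_boot all_order all_algebra.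
From mathcomp Require Import all_classical all_reals all_analysis.

Set Implicit Arguments.
Unset Strict Implicit.
Unset Printing Implicit Defensive.

Import Order.TTheory GRing.Theory Num.Theory.
Import numFieldNormedType.Exports.

Local Open Scope classical_set_scope.
Local Open Scope ring_scope.

(* Maps on T^1 = R/2piZ are represented by 2pi-periodic maps on R. *)

Section vectors.
Context {R : realType}.
Implicit Types v w : 'rV[R]_3.

Definition dot v w : R := \sum_i v 0 i * w 0 i.

(* Indices are computed in 'I_3 = Z/3Z. *)
Definition cross v w : 'rV[R]_3 :=
  \row_(i < 3) (v 0 (i + 1) * w 0 (i + 2%:R) - v 0 (i + 2%:R) * w 0 (i + 1)).

End vectors.

Section circle.
Context {R : realType}.
Implicit Types f g : R -> 'rV[R]_3.

Definition circle : set R := `[0, 2 * pi].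

Definition periodic f := forall x, f (x + 2 * pi) = f x.

Definition smooth f := forall (n : nat) (x : R), derivable (derive1n n f) x 1.

Definition sphere_valued f := forall x, dot (f x) (f x) = 1.

Definition smooth_sphere_map f := [/\ periodic f, smooth f & sphere_valued f].

Definition l2prod f g : R :=
  \int[lebesgue_measure]_(x in circle) dot (f x) (g x).

(* The square of the H^k norm, on smooth maps. *)
Definition sobolev_sq (k : nat) f : R :=
  \sum_(j < k.+1) l2prod (derive1n j f) (derive1n j f).

Definition fourier_cos f (n : nat) : 'rV[R]_3 :=
  \row_i (pi^-1 * \int[lebesgue_measure]_(x in circle) (f x 0 i * cos (n%:R * x))).

Definition fourier_sin f (n : nat) : 'rV[R]_3 :=
  \row_i (pi^-1 * \int[lebesgue_measure]_(x in circle) (f x 0 i * sin (n%:R * x))).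

(* The square of the norm of H^{1/2}. Since f is real, the complex coefficients
   of indices n and -n have the same modulus; the sum over n in Z of
   (1 + n^2)^{1/2} |f^(n)|^2 is equivalent to the one below. *)
Definition Hhalf_sq f : \bar R :=
  (\sum_(0 <= n <oo)
     (Num.sqrt (1 + n%:R ^+ 2) *
      (dot (fourier_cos f n) (fourier_cos f n) +
       dot (fourier_sin f n) (fourier_sin f n)))%:E)%E.

Definition Hhalf : set (R -> 'rV[R]_3) := [set f |
  [/\ periodic f,
      forall i, measurable_fun setT (fun x => f x 0 i),
      (\int[lebesgue_measure]_(x in circle) (dot (f x) (f x))%:E < +oo)%E &
      (Hhalf_sq f < +oo)%E]].

Definition Hhalf_norm f : R := Num.sqrt (fine (Hhalf_sq f)).

(* Continuous linear forms on H^{1/2}; their values outside H^{1/2} are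
   irrelevant, every element of the dual being represented by its extension
   by 0. *)
Definition is_Hhalf_dual (l : (R -> 'rV[R]_3) -> R) :=
  (forall (a : R) f g, Hhalf f -> Hhalf g ->
     l (fun x => a *: f x + g x) = a * l f + l g) /\
  (exists C : R, forall f, Hhalf f -> `|l f| <= C * Hhalf_norm f).

Definition weak_Hhalf_cvg (f_ : nat -> R -> 'rV[R]_3) f :=
  [/\ forall m, Hhalf (f_ m), Hhalf f &
      forall l, is_Hhalf_dual l -> l (f_ m) @[m --> \oo] --> l f].

End circle.

Section spaces.
Variable R : realType.

(* C^oo(T^1, S^2) *)
Definition sphere_map := {f : R -> 'rV[R]_3 | smooth_sphere_map f}.
HB.instance Definition _ := gen_eqMixin sphere_map.
HB.instance Definition _ := gen_choiceMixin sphere_map.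

Definition Hhalf_dual := {l : (R -> 'rV[R]_3) -> R | is_Hhalf_dual l}.

Definition Hhalf_eval (u : sphere_map) : {ptws Hhalf_dual -> R} :=
  fun l => sval l (sval u).

(* C^oo(T^1, S^2) with the topology induced by the weak topology of H^{1/2},
   i.e. the coarsest one making all continuous linear forms continuous. *)
Definition weak_sphere_map := initial_topology Hhalf_eval.
HB.instance Definition _ := Topological.on weak_sphere_map.

(* C^oo(T^1, R^3) *)
Definition test_map := {f : R -> 'rV[R]_3 | periodic f /\ smooth f}.

(* Linearity is stated on representatives, so that no algebraic structure on
   test_map is needed; continuity is with respect to the seminorms
   sup |phi^(j)|. *)
Definition is_distribution (T : test_map -> R) :=
  (forall (a : R) (phi psi chi : test_map),
     (forall x, sval chi x = a *: sval phi x + sval psi x) ->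
     T chi = a * T phi + T psi) /\
  (exists (N : nat) (C : R), forall (phi : test_map) (M : R),
     (forall (j : nat) x, (j <= N)%N -> `|derive1n j (sval phi) x| <= M) ->
     `|T phi| <= C * M).

Definition distribution := {T : test_map -> R | is_distribution T}.
HB.instance Definition _ := gen_eqMixin distribution.
HB.instance Definition _ := gen_choiceMixin distribution.

Definition distribution_eval (T : distribution) : {ptws test_map -> R} := sval T.

(* The space of distributions with its weak-* topology. The strong topology
   being finer, discontinuity for the weak-* topology is the stronger claim. *)
Definition weak_distribution := initial_topology distribution_eval.
HB.instance Definition _ := Topological.on weak_distribution.

End spaces.

Section distribution_of.
Context {R : realType}.
Implicit Types f g : R -> 'rV[R]_3.
Local Notation mu := (@lebesgue_measure R).

Lemma smooth_continuous f : smooth f -> continuous f.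
Proof.
move=> sf x; apply: differentiable_continuous; apply/derivable1_diffP.
exact: (sf 0%N).
Qed.

Lemma continuous_entry f i : continuous f -> continuous (fun x => f x 0 i).
Proof.
move=> cf x; apply: (@continuous_comp _ _ _ f (fun v : 'rV[R]_3 => v 0 i)).
  exact: cf.
exact: coord_continuous.
Qed.

Lemma continuous_dot f g : continuous f -> continuous g ->
  continuous (fun x => dot (f x) (g x)).
Proof.
move=> cf cg x; apply: cvg_big => [|i _]; first exact: add_continuous.
by apply: cvgM; apply: continuous_entry.
Qed.

Lemma integrable_circle (h : R -> R) : continuous h ->
  mu.-integrable circle (EFin \o h).
Proof.
move=> ch; apply: continuous_compact_integrable; first exact: segment_compact.
exact: continuous_subspaceT.
Qed.

Lemma entry_le (v : 'rV[R]_3) i : `|v 0 i| <= `|v|.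
Proof. by rewrite [leRHS]/Num.Def.normr/= mx_normrE (le_bigmax _ _ (0, i)). Qed.

Lemma pairing_distribution f : continuous f ->
  is_distribution (fun phi : test_map R => l2prod f (sval phi)).
Proof.
move=> cf.
have mc : measurable (circle : set R) by exact: measurable_itv.
have ci (h : R -> 'rV[R]_3) : continuous h ->
    mu.-integrable circle (EFin \o (fun x => dot (f x) (h x))).
  by move=> ch; apply: integrable_circle; exact: continuous_dot.
split=> [a phi psi chi e|].
  have cphi := smooth_continuous (svalP phi).2.
  have cpsi := smooth_continuous (svalP psi).2.
  rewrite /l2prod -RintegralZl//; last exact: ci.
  rewrite -RintegralD//; [|apply: integrable_circle|exact: ci]; last first.
    by move=> x; apply: cvgMr; exact: continuous_dot.
  apply: eq_Rintegral => x _; rewrite e /dot mulr_sumr -big_split/=.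
  by apply: eq_bigr => i _; rewrite !mxE mulrDr mulrCA.
exists 0%N, (\int[mu]_(x in circle) (\sum_i `|f x 0 i|)) => phi M phiM.
have cphi := smooth_continuous (svalP phi).2.
have cn : continuous (fun x => \sum_i `|f x 0 i|).
  move=> x; apply: cvg_big => [|i _]; first exact: add_continuous.
  by apply: cvg_norm; exact: continuous_entry.
rewrite /l2prod (le_trans (le_normr_Rintegral _ _))//; first exact: ci.
rewrite -RintegralZr//; last exact: integrable_circle.
apply: le_Rintegral => //.
- apply: integrable_circle => x; apply: cvg_norm.
  exact: continuous_dot.
- by apply: integrable_circle => x; apply: cvgMl; exact: cn.
move=> x _; rewrite (le_trans (ler_norm_sum _ _ _))// mulr_suml.
apply: ler_sum => i _; rewrite normrM ler_wpM2l// (le_trans (entry_le _ _))//.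
exact: (phiM 0%N).
Qed.

Definition distribution_of (u : sphere_map R) : weak_distribution R :=
  exist _ (fun phi : test_map R => l2prod (sval u) (sval phi))
    (pairing_distribution
      (smooth_continuous (let: And3 _ su _ := svalP u in su))).

End distribution_of.

Section schrodinger_map.
Context {R : realType}.
Implicit Types u : R -> R -> 'rV[R]_3.

(* Time comes first. A smooth datum lies in H^k for all k, so that its solution
   is in C(R, H^k) for all k >= 2; hence it is smooth in space at each time and
   the equation holds pointwise. *)
Definition is_solution u :=
  [/\ forall t, smooth_sphere_map (u t),
      forall (k : nat) (t : R), (2 <= k)%N ->
        sobolev_sq k (fun s => u tau s - u t s) @[tau --> t] --> 0 &
      forall t s : R,
        is_derive t 1 (fun tau => u tau s)
          (derive1 (fun x => cross (u t x) (derive1 (u t) x)) s)].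

Definition is_solution_from (u0 : sphere_map R) u :=
  is_solution u /\ u 0 = sval u0.

Definition solution_value (u0 : sphere_map R)
    (h : exists u, is_solution_from u0 u) (t : R) : sphere_map R :=
  let: exist u (conj (And3 smooth_u _ _) _) := cid h in exist _ (u t) (smooth_u t).

(* The value at time t of the solution with initial datum u0. By global
   well-posedness such a solution exists and is unique: the second branch is
   never taken and the choice made in the first one is immaterial. *)
Definition flow (t : R) (u0 : sphere_map R) : sphere_map R :=
  match pselect (exists u, is_solution_from u0 u) with
  | left h => solution_value h t
  | right _ => u0
  end.

Definition ustar (t s : R) : 'rV[R]_3 :=
  \row_(i < 3) [:: cos s; sin s; 0]`_i.

End schrodinger_map.

(* Main.v *)
Require Import Defs.
From mathcomp Require Import all_boot all_order all_algebra.
From mathcomp Require Import all_classical all_reals all_analysis.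
From mathcomp Require Import measurable_realfun ring lra.

(* A profile V solving V x V'' = om * (e3 x V) - c * V' on the sphere gives the
   solution t, s |-> (rotation of angle om t about e3) V (s - c t).  Writing
   V3 = eps * B * sin psi, the profile equation integrates explicitly:
   psi' = n * slope psi with slope^2 = 1 + k^2 - 2 k B sin psi, om = eps k n^2,
   c = eps sqrt(1 - B^2) n.  For B = sqrt(|sigma| / N) these are thin helices
   winding N times around the equator while V makes one turn, provided k is
   chosen, by the intermediate value theorem, such that the azimuth increases by
   2 pi / N over one period of psi.  They stay within O(N^(-1/2)) of the
   equator, their first derivatives are O(N^(1/2)), and om - c tends to sigma:
   uniformly, the wave at time t approaches the equator shifted by sigma t.

   Solutions with bounded first and third derivatives are unique, by a Gronwall
   estimate of the H^1 distance, so that these waves are given by the flow.  The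
   two bounds above keep them bounded in H^{1/2}, and a Riesz type bound on the
   values of a continuous form on the Fourier modes upgrades uniform
   convergence to weak convergence.  For sigma = pi / t, the limit at time t is
   the antipodal equator, whose pairing with the equator is -2 pi instead of
   2 pi: the flow at time t is not continuous. *)

Set Implicit Arguments.
Unset Strict Implicit.
Unset Printing Implicit Defensive.

Import Order.TTheory GRing.Theory Num.Theory.
Import numFieldNormedType.Exports.

Local Open Scope classical_set_scope.
Local Open Scope ring_scope.

(** * Calculus on the line *)

(** The height [z] of a profile obeys [z'^2 = P(z)] with [P] cubic, by two first integrals:
    [J + c z], where [J] is the third component of [V x V'], and [|V'|^2 + 2 om z]. The
    parametrisation of [om] and [c] makes [B] and [-B] roots of [P], hence the substitution
    [z = eps B sin psi]; closing up the curve then fixes [k]. The curves with tangent [V] are Kida's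
    vortex filaments, which move without change of form. Both [om] and [c] grow like [N], but on the
    equator a rotation is a change of parameter, so that only their difference is visible in the
    limit. To leading order closing up means [beta k N = 1] with [beta^2 = 1 - B^2], and [om - c] is
    then close to [eps N (1 / beta - beta)], that is to [eps N B^2]: the prescribed speed dictates
    [N B^2 = |sigma|]. An amplitude of order [N^(-1/2)] at frequency [N] is also critical for
    H^{1/2}: such an oscillation stays bounded there without tending to zero in norm. The map [flow]
    picks a solution of which only [is_solution] is known. The uniqueness argument therefore asks
    for bounds on the explicit wave alone. *)

Section real_functions.
Context {R : realType}.
Implicit Types f g h F : R -> R.
Local Notation mu := (@lebesgue_measure R).

(* A copy of is_derive hidden from the resolution of type classes. *)
Definition has_deriv f (x a : R) : Prop := is_derive x 1 f a.

Lemma has_deriv_derivable f (x a : R) : has_deriv f x a -> derivable f x 1.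
Proof. by case. Qed.

Lemma has_deriv_cst (c x : R) : has_deriv (fun=> c) x 0.
Proof. rewrite /has_deriv; exact: is_derive_cst. Qed.

Lemma has_deriv_id (x : R) : has_deriv (fun y : R => y) x 1.
Proof. rewrite /has_deriv; exact: is_derive_id. Qed.

Lemma has_derivD f g (x a b : R) : has_deriv f x a -> has_deriv g x b ->
  has_deriv (fun y => f y + g y) x (a + b).
Proof. rewrite /has_deriv; exact: is_deriveD. Qed.

Lemma has_derivN f (x a : R) : has_deriv f x a ->
  has_deriv (fun y => - f y) x (- a).
Proof. rewrite /has_deriv; exact: is_deriveN. Qed.

Lemma has_derivM f g (x a b : R) : has_deriv f x a -> has_deriv g x b ->
  has_deriv (fun y => f y * g y) x (f x * b + g x * a).
Proof. rewrite /has_deriv; exact: is_deriveM. Qed.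

Lemma has_derivX f n (x a : R) : has_deriv f x a ->
  has_deriv (fun y => f y ^+ n.+1) x (n.+1%:R * f x ^+ n * a).
Proof.
move=> df; have := is_deriveX n.+1 df.
by congr is_derive; apply/funext => y; rewrite exprfctE.
Qed.

Lemma has_derivV f (x a : R) : f x != 0 -> has_deriv f x a ->
  has_deriv (fun y => (f y)^-1) x (- (f x) ^- 2 * a).
Proof. rewrite /has_deriv; exact: is_deriveV. Qed.

Lemma has_deriv_comp f g (x a b : R) : has_deriv f (g x) a -> has_deriv g x b ->
  has_deriv (fun y => f (g y)) x (a * b).
Proof. rewrite /has_deriv; exact: is_derive1_comp. Qed.

Lemma has_deriv_sin f (x a : R) : has_deriv f x a ->
  has_deriv (fun y => sin (f y)) x (cos (f x) * a).
Proof. by move=> df; apply: (@has_deriv_comp sin) => //; exact: is_derive_sin. Qed.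

Lemma has_deriv_cos f (x a : R) : has_deriv f x a ->
  has_deriv (fun y => cos (f y)) x (- sin (f x) * a).
Proof. by move=> df; apply: (@has_deriv_comp cos) => //; exact: is_derive_cos. Qed.

Lemma has_deriv_sqrt f (x a : R) : 0 < f x -> has_deriv f x a ->
  has_deriv (fun y => Num.sqrt (f y)) x ((2 * Num.sqrt (f x))^-1 * a).
Proof. by move=> f0 df; apply: has_deriv_comp df; exact: is_derive1_sqrt. Qed.

Lemma has_deriv_eq f (x a b : R) : has_deriv f x a -> a = b -> has_deriv f x b.
Proof. by move=> df <-. Qed.

Lemma derive_continuous f f' : (forall x : R, has_deriv f x (f' x)) -> continuous f.
Proof.
move=> df x; apply: differentiable_continuous; apply/derivable1_diffP.
exact: has_deriv_derivable (df x).
Qed.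

Lemma contD f g : continuous f -> continuous g -> continuous (fun y => f y + g y).
Proof. by move=> cf cg x; exact: (cvgD (cf x) (cg x)). Qed.

Lemma contN f : continuous f -> continuous (fun y => - f y).
Proof. by move=> cf x; exact: (cvgN (cf x)). Qed.

Lemma contM f g : continuous f -> continuous g -> continuous (fun y => f y * g y).
Proof. by move=> cf cg x; exact: (cvgM (cf x) (cg x)). Qed.

Lemma cont_cst (c : R) : continuous ((fun=> c) : R -> R).
Proof. by move=> x; exact: cvg_cst. Qed.

Lemma cont_id : continuous (fun y : R => y).
Proof. by move=> x; exact: cvg_id. Qed.

Lemma contX f n : continuous f -> continuous (fun y => f y ^+ n).
Proof.
move=> cf; elim: n => [|n ih]; first by under eq_fun do rewrite expr0; exact: cont_cst.
by under eq_fun do rewrite exprS; exact: contM.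
Qed.

Lemma cont_comp f g : continuous f -> continuous g -> continuous (fun y => f (g y)).
Proof. by move=> cf cg x; apply: continuous_comp; [exact: cg | exact: cf]. Qed.

Lemma cont_norm f : continuous f -> continuous (fun y => `|f y|).
Proof. by move=> cf x; apply: cvg_norm; exact: cf. Qed.

Lemma contV f : continuous f -> (forall x, f x != 0) ->
  continuous (fun y => (f y)^-1).
Proof. by move=> cf f0 x; apply: cvgV => //; exact: cf. Qed.

End real_functions.
Arguments cont_cst {R} c.

Ltac dhyp := match goal with
  | H : has_deriv _ _ _ |- _ => exact: H
  | H : forall _, has_deriv _ _ _ |- _ => exact: H
  | H : forall _ _, has_deriv _ _ _ |- _ => exact: H
  | H : forall _ _ _, has_deriv _ _ _ |- _ => exact: H
  end.

Ltac dstep := lazymatch goal with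
  | |- has_deriv (fun y => y) _ _ => exact: has_deriv_id
  | |- has_deriv (fun _ => ?c) _ _ => exact: has_deriv_cst
  | |- has_deriv (fun y => @GRing.add _ (@?f y) (@?g y)) _ _ =>
      refine (@has_derivD _ f g _ _ _ _ _)
  | |- has_deriv (fun y => @GRing.mul _ (@?f y) (@?g y)) _ _ =>
      refine (@has_derivM _ f g _ _ _ _ _)
  | |- has_deriv (fun y => @GRing.opp _ (@?f y)) _ _ =>
      refine (@has_derivN _ f _ _ _)
  | |- has_deriv (fun y => @GRing.exp _ (@?f y) (S ?n)) _ _ =>
      refine (@has_derivX _ f n _ _ _)
  | |- has_deriv (fun y => sin (@?f y)) _ _ => refine (@has_deriv_sin _ f _ _ _)
  | |- has_deriv (fun y => cos (@?f y)) _ _ => refine (@has_deriv_cos _ f _ _ _)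
  | |- has_deriv (@GRing.mul _ ?c) _ _ =>
      refine (@has_derivM _ (fun=> c) (fun y => y) _ _ _ _ _)
  | |- has_deriv (@GRing.add _ ?c) _ _ =>
      refine (@has_derivD _ (fun=> c) (fun y => y) _ _ _ _ _)
  | |- has_deriv _ _ _ => dhyp
  end.

Ltac chyp := match goal with
  | H : forall _, continuous_at _ _ |- _ => exact: H
  | H : forall _ _, continuous_at _ _ |- _ => exact: H
  | H : forall _ _ _, continuous_at _ _ |- _ => exact: H
  end.

Ltac cstep := lazymatch goal with
  | |- forall x, continuous_at x (fun y => y) => exact: cont_id
  | |- forall x, continuous_at x (fun _ => ?c) => exact: cont_cst
  | |- forall x, continuous_at x (fun y => @GRing.add _ (@?f y) (@?g y)) =>
      refine (@contD _ f g _ _)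
  | |- forall x, continuous_at x (fun y => @GRing.mul _ (@?f y) (@?g y)) =>
      refine (@contM _ f g _ _)
  | |- forall x, continuous_at x (fun y => @GRing.opp _ (@?f y)) =>
      refine (@contN _ f _)
  | |- forall x, continuous_at x (fun y => @GRing.exp _ (@?f y) ?n) =>
      refine (@contX _ f n _)
  | |- forall x, continuous_at x (@GRing.mul _ ?c) =>
      refine (@contM _ (fun=> c) (fun y => y) _ _)
  | |- forall x, continuous_at x (@GRing.add _ ?c) =>
      refine (@contD _ (fun=> c) (fun y => y) _ _)
  | |- _ => chyp
  end.

(** * Mean value theorem and primitives *)

Section integration.
Context {R : realType}.
Implicit Types f g h F : R -> R.
Local Notation mu := (@lebesgue_measure R).

Lemma mvt f f' (a b : R) : (forall x : R, has_deriv f x (f' x)) ->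
  exists2 c, Order.min a b <= c <= Order.max a b & f b - f a = f' c * (b - a).
Proof.
move=> df.
have cf (u v : R) : {within `[u, v], continuous f}.
  by apply: continuous_subspaceT; apply: derive_continuous df.
have [ab|ba] := leP a b.
  have [//|c] := @MVT_segment _ f f' a b ab (fun x _ => df x).
  by rewrite in_itv/= => cab e; exists c.
have [//|c] := @MVT_segment _ f f' b a (ltW ba) (fun x _ => df x).
rewrite in_itv/= => cab e; exists c => //.
by rewrite -opprB e; ring.
Qed.

Lemma lipschitz_of_derive f f' (K : R) : (forall x : R, has_deriv f x (f' x)) ->
  (forall x, `|f' x| <= K) -> forall a b, `|f b - f a| <= K * `|b - a|.
Proof.
move=> df bf a b; have [c _ ->] := mvt a b df.
by rewrite normrM ler_wpM2r.
Qed.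

Lemma derive_ge0_homo f f' : (forall x : R, has_deriv f x (f' x)) ->
  (forall x : R, 0 <= f' x) -> {homo f : x y / x <= y}.
Proof.
move=> df f0 x y xy; rewrite -subr_ge0; have [c _ ->] := mvt x y df.
by rewrite mulr_ge0// subr_ge0.
Qed.

Lemma derive_gt0_homo f f' : (forall x : R, has_deriv f x (f' x)) ->
  (forall x, 0 < f' x) -> {homo f : x y / x < y}.
Proof.
move=> df f0 x y xy; rewrite -subr_gt0; have [c _ ->] := mvt x y df.
by rewrite mulr_gt0// subr_gt0.
Qed.

Lemma integrable_segment h (a b : R) : continuous h ->
  mu.-integrable `[a, b] (EFin \o h).
Proof.
move=> ch; apply: continuous_compact_integrable; first exact: segment_compact.
exact: continuous_subspaceT.
Qed.

(** The integral from [- A] is a primitive on the half-line to the right of [- A] only. Changing [A]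
    alters it by a constant, which subtracting the value at 0 removes; the base point may then
    depend on [x], and near [x] a single one serves. *)
Lemma has_primitive h : continuous h ->
  exists F, forall x : R, has_deriv F x (h x).
Proof.
move=> ch.
pose P (A x : R) := \int[mu]_(t in `[- A, x]) h t.
have dP (A x : R) : - A < x -> has_deriv (P A) x (h x).
  move=> Ax; have x1 : x < x + 1 by rewrite ltrDl.
  have [d e] := continuous_FTC1_closed x1 (integrable_segment _ _ ch) Ax (ch x).
  by split; [exact: d | rewrite -derive1E].
have PB (A B x : R) : A <= B -> - A <= x -> P B x = P B (- A) + P A x.
  move=> AB Ax.
  rewrite /P; apply/eqP; rewrite addrC -subr_eq; apply/eqP.
  have i : mu.-integrable [set` Interval (BLeft (- B)) (BRight x)] (EFin \o h).
    exact: integrable_segment.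
  rewrite (Rintegral_itvB i) ?bnd_simp ?lerN2//.
  rewrite Rintegral_itv_obnd_cbnd//.
  apply: integrableS (integrable_segment (- A) x ch) => //.
  by move=> z /=; rewrite !in_itv/= => /andP[/ltW -> ->].
pose F (x : R) := P (`|x| + 1) x - P (`|x| + 1) 0.
exists F => x; pose B := `|x| + 2.
have FB (y : R) : `|y| < `|x| + 1 -> F y = P B y - P B 0.
  move=> yx; have y0 := normr_ge0 y.
  have yB : `|y| + 1 <= B by rewrite /B; lra.
  rewrite /F (PB _ _ y yB) ?(PB _ _ 0 yB); [lra|lra|].
  by have := ler_norm (- y); rewrite normrN; lra.
have : has_deriv (fun y => P B y + (- P B 0)) x (h x).
  apply: has_deriv_eq (addr0 _); apply: has_derivD; last exact: has_deriv_cst.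
  apply: dP.
  by have := ler_norm (- x); have := normr_ge0 x; rewrite normrN /B; lra.
apply: near_eq_is_derive; near=> y; rewrite FB//.
have : `|y - x| < 1.
  by near: y; apply: cvgr_distC_lt => //; exact: cvg_id.
have := ler_normD (y - x) x; rewrite subrK; lra.
Unshelve. all: by end_near. Qed.

End integration.

(** * Integrals over the circle *)

Section circle_integral.
Context {R : realType}.
Implicit Types f g h F : R -> R.
Local Notation mu := (@lebesgue_measure R).

Lemma periodic_int (U : Type) (f : R -> U) (T : R) :
  (forall x, f (x + T) = f x) -> forall (k : int) x, f (x + k%:~R * T) = f x.
Proof.
move=> fT; have fn n x : f (x + n%:R * T) = f x.
  elim: n => [|n ih]; first by rewrite mul0r addr0.
  by rewrite -natr1 mulrDl mul1r addrA fT.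
case=> n x; first by rewrite -pmulrn fn.
by rewrite NegzE mulrNz mulNr -(fn n.+1 (x - _)) pmulrn subrK.
Qed.

Lemma periodic_reduce (U : Type) (f : R -> U) (T : R) : 0 < T ->
  (forall x, f (x + T) = f x) -> forall x, exists2 y, 0 <= y <= T & f x = f y.
Proof.
move=> T0 fT x; exists (x - (Num.floor (x / T))%:~R * T).
  have := floor_le (x / T); have := floorD1_gt (x / T).
  rewrite ler_pdivlMr// ltr_pdivrMr// intrD mulrDl; lra.
by rewrite -[in LHS](subrK ((Num.floor (x / T))%:~R * T) x) periodic_int.
Qed.

Lemma twopi_gt0 : 0 < 2 * pi :> R.
Proof. by rewrite mulr_gt0// pi_gt0. Qed.

Lemma periodic_bounded f : continuous f -> (forall x, f (x + 2 * pi) = f x) ->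
  exists K, forall x, `|f x| <= K.
Proof.
move=> cf pf; have [c _ fc] := EVT_max (ltW twopi_gt0)
  (continuous_subspaceT (A := `[0, 2 * pi]) (cont_norm cf)).
exists `|f c| => x; have [y yI ->] := periodic_reduce twopi_gt0 pf x.
by apply: fc; rewrite in_itv.
Qed.

Definition cint f : R := \int[mu]_(x in circle) f x.

(** With [has_primitive], this turns integrals of continuous functions into differences of
    primitives: linearity, monotonicity and integration by parts below are calculus on the line,
    without integrability conditions. *)
Lemma cint_FTC f F : continuous f -> (forall x : R, has_deriv F x (f x)) ->
  cint f = F (2 * pi) - F 0.
Proof.
move=> cf dF; have cF := derive_continuous dF.
rewrite /cint /Rintegral (@continuous_FTC2 _ f F 0 (2 * pi) twopi_gt0)//.
- exact: continuous_subspaceT.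
- split.
  + by move=> x _; exact: has_deriv_derivable (dF x).
  + by apply: cvg_at_right_filter; exact: cF.
  + by apply: cvg_at_left_filter; exact: cF.
- by move=> x _; rewrite derive1E; have [] := dF x.
Qed.

Lemma cint_periodic f F : continuous f -> (forall x : R, has_deriv F x (f x)) ->
  (forall x, F (x + 2 * pi) = F x) -> cint f = 0.
Proof. by move=> cf dF pF; rewrite (cint_FTC cf dF) -[2 * pi]add0r pF subrr. Qed.

Lemma cintD f g : continuous f -> continuous g ->
  cint (fun x => f x + g x) = cint f + cint g.
Proof.
move=> cf cg; have [F dF] := has_primitive cf; have [G dG] := has_primitive cg.
rewrite (cint_FTC cf dF) (cint_FTC cg dG).
rewrite (@cint_FTC _ (fun x => F x + G x) (contD cf cg)); first by ring.
by move=> x; apply: has_derivD.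
Qed.

Lemma cintZ (c : R) f : continuous f -> cint (fun x => c * f x) = c * cint f.
Proof.
move=> cf; have [F dF] := has_primitive cf.
rewrite (cint_FTC cf dF).
rewrite (@cint_FTC _ (fun x => c * F x) (contM (cont_cst c) cf)); first by ring.
move=> x; apply: has_deriv_eq; first by repeat dstep.
by rewrite mulr0 addr0.
Qed.

Lemma cint_le f g : continuous f -> continuous g -> (forall x, f x <= g x) ->
  cint f <= cint g.
Proof.
move=> cf cg fg; have [F dF] := has_primitive cf.
have [G dG] := has_primitive cg.
rewrite (cint_FTC cf dF) (cint_FTC cg dG).
have : forall x : R, has_deriv (fun y => G y - F y) x (g x - f x).
  by move=> x; repeat dstep.
move=> /derive_ge0_homo /(_ _ 0 (2 * pi) (ltW twopi_gt0)); rewrite lerBDr.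
have fg0 x : 0 <= g x - f x by rewrite subr_ge0.
by move=> /(_ fg0); lra.
Qed.

Lemma cint_cst (c : R) : cint (fun=> c) = 2 * pi * c.
Proof.
have d (x : R) : has_deriv (fun y => c * y) x c.
  by apply: has_deriv_eq; [repeat dstep | rewrite mulr0 addr0 mulr1].
by rewrite (cint_FTC (cont_cst c) d); ring.
Qed.

Lemma cintN f : continuous f -> cint (fun x => - f x) = - cint f.
Proof.
move=> cf; rewrite -mulN1r -cintZ//; congr cint; apply/funext => x.
by rewrite mulN1r.
Qed.

Lemma cintB f g : continuous f -> continuous g ->
  cint (fun x => f x - g x) = cint f - cint g.
Proof. by move=> cf cg; rewrite (cintD cf (contN cg)) cintN. Qed.

Lemma cint_bound f (K : R) : continuous f -> (forall x, `|f x| <= K) ->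
  `|cint f| <= 2 * pi * K.
Proof.
move=> cf fK; rewrite ler_norml -mulrN -!cint_cst; apply/andP; split.
  by apply: cint_le => //; [exact: cont_cst | move=> x; have := fK x; rewrite ler_norml => /andP[]].
by apply: cint_le => //; [exact: cont_cst | move=> x; have := fK x; rewrite ler_norml => /andP[]].
Qed.

Lemma cint_ge0 f : continuous f -> (forall x, 0 <= f x) -> 0 <= cint f.
Proof.
move=> cf f0; have := cint_le (cont_cst 0) cf f0; by rewrite cint_cst mulr0.
Qed.

Lemma eq_cint f g : f =1 g -> cint f = cint g.
Proof. by move=> fg; congr cint; apply/funext. Qed.

(** A primitive of [f] is nondecreasing and does not increase over a period, so it is constant
    there; it is then periodic, hence constant on the line, and its derivative vanishes. *)
Lemma cint_eq0 f : continuous f -> (forall x, f (x + 2 * pi) = f x) ->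
  (forall x, 0 <= f x) -> cint f <= 0 -> forall x, f x = 0.
Proof.
move=> cf pf f0 fle0 x; have [F dF] := has_primitive cf.
have Fh := derive_ge0_homo dF f0.
have F02 : F (2 * pi) <= F 0 by move: fle0; rewrite (cint_FTC cf dF) subr_le0.
have Fc y : 0 <= y <= 2 * pi -> F y = F 0.
  move=> /andP[y0 y1]; apply/eqP; rewrite eq_le (Fh _ _ y0) andbT.
  exact: le_trans (Fh _ _ y1) F02.
have FT y : F (y + 2 * pi) = F y.
  apply/eqP; rewrite -subr_eq0; apply/eqP.
  have : forall z : R, has_deriv (fun y => F (y + 2 * pi) - F y) z 0.
    move=> z; apply: has_deriv_eq; first apply: has_derivD.
    - apply: (@has_deriv_comp _ F); first exact: dF.
      by repeat dstep.
    - by repeat dstep.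
    - by rewrite pf; ring.
  move=> d0; have /(is_derive_0_is_cst y 0) := d0; rewrite add0r => ->.
  by rewrite (Fc (2 * pi)) ?lexx ?ltW ?twopi_gt0// subrr.
have FE y : F y = F 0.
  have [z zI ->] := periodic_reduce twopi_gt0 FT y; exact: Fc.
have [_ <-] := dF x.
by rewrite (_ : F = fun=> F 0) ?derive_cst//; apply/funext.
Qed.

(** Since [2 |f f'| <= f^2 + f'^2], a primitive [H] of the right-hand side makes [H - f^2] and
    [H + f^2] nondecreasing. So [f(z)^2] exceeds any other value of [f^2] by at most the integral
    [A]; averaging over a period bounds it by [(1 + 1 / (2 pi)) A]. *)
Lemma sobolev_sup f f' : (forall x : R, has_deriv f x (f' x)) ->
  continuous f' -> (forall x, f (x + 2 * pi) = f x) ->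
  forall x, f x ^+ 2 <= 2 * cint (fun y => f y ^+ 2 + f' y ^+ 2).
Proof.
move=> df cf' pf x; have cf := derive_continuous df.
have cA : continuous (fun y => f y ^+ 2 + f' y ^+ 2).
  by apply: contD; apply: contX.
set A := cint _.
have [H dH] := has_primitive cA.
have d2 (y : R) : has_deriv (fun y => f y ^+ 2) y (2 * f y * f' y).
  by apply: has_deriv_eq; [apply: has_derivX | rewrite expr1].
have h1 : {homo (fun y => H y - f y ^+ 2) : u v / u <= v}.
  apply: (@derive_ge0_homo _ _ (fun y => f y ^+ 2 + f' y ^+ 2 - 2 * f y * f' y)).
    by move=> y; repeat dstep.
  by move=> y; have := sqr_ge0 (f y - f' y); nra.
have h2 : {homo (fun y => H y + f y ^+ 2) : u v / u <= v}.
  apply: (@derive_ge0_homo _ _ (fun y => f y ^+ 2 + f' y ^+ 2 + 2 * f y * f' y)).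
    by move=> y; repeat dstep.
  by move=> y; have := sqr_ge0 (f y + f' y); nra.
have hH : {homo H : u v / u <= v}.
  by apply: derive_ge0_homo dH _ => y; rewrite addr_ge0// sqr_ge0.
have AE : A = H (2 * pi) - H 0 by rewrite /A (cint_FTC cA dH).
have [z /andP[z0 z1] ->] := periodic_reduce twopi_gt0 pf x.
have key y : 0 <= y <= 2 * pi -> f z ^+ 2 <= A + f y ^+ 2.
  move=> /andP[y0 y1].
  have := hH _ _ y0; have := hH _ _ y1; have := hH _ _ z0; have := hH _ _ z1.
  have [yz|/ltW zy] := leP y z.
    by have := h1 _ _ yz; lra.
  by have := h2 _ _ zy; lra.
have key' y : f z ^+ 2 - A <= f y ^+ 2.
  have [t tI ->] := periodic_reduce twopi_gt0 pf y.
  by have := key _ tI; lra.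
have c2 := contX (n := 2) cf.
have := cint_le (cont_cst _) c2 key'; rewrite cint_cst => le1.
have le2 : cint (fun y => f y ^+ 2) <= A.
  by apply: cint_le => // y; rewrite lerDl sqr_ge0.
have A0 : 0 <= A by apply: cint_ge0 => // y; rewrite addr_ge0// sqr_ge0.
have := pi_gt0 R; have := pi_ge2 R.
nra.
Qed.

End circle_integral.

(** * Vector fields on the circle *)

Section vector_fields.
Context {R : realType}.
Implicit Types (v w : 'rV[R]_3) (f g : R -> 'rV[R]_3).

(* The indices 0, 1, 2 of 'I_3, made opaque because comparing them by
   conversion is expensive. *)
Fact ax0_subproof : {i : 'I_3 | i = 0}. Proof. by exists 0. Qed.
Fact ax1_subproof : {i : 'I_3 | i = 1}. Proof. by exists 1. Qed.
Fact ax2_subproof : {i : 'I_3 | i = 2%:R}. Proof. by exists 2%:R. Qed.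
Definition ax0 := sval ax0_subproof.
Definition ax1 := sval ax1_subproof.
Definition ax2 := sval ax2_subproof.
Definition axE : (ax0 = 0) * (ax1 = 1) * (ax2 = 2%:R) :=
  (svalP ax0_subproof, svalP ax1_subproof, svalP ax2_subproof).

Lemma ord3_ind (P : 'I_3 -> Prop) : P ax0 -> P ax1 -> P ax2 -> forall i, P i.
Proof.
rewrite !axE => p0 p1 p2 [[|[|[|//]]] lti].
- by rewrite (_ : Ordinal lti = 0)//; apply: val_inj.
- by rewrite (_ : Ordinal lti = 1)//; apply: val_inj.
- by rewrite (_ : Ordinal lti = 2%:R)//; apply: val_inj.
Qed.

Lemma sum3 (F : 'I_3 -> R) : \sum_i F i = F ax0 + F ax1 + F ax2.
Proof.
rewrite !axE !big_ord_recl big_ord0 addr0 addrA; congr (_ + F _ + F _);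
  exact: val_inj.
Qed.

Lemma dotE v w :
  dot v w = v 0 ax0 * w 0 ax0 + v 0 ax1 * w 0 ax1 + v 0 ax2 * w 0 ax2.
Proof. exact: sum3. Qed.

Lemma cross0 v w : cross v w 0 ax0 = v 0 ax1 * w 0 ax2 - v 0 ax2 * w 0 ax1.
Proof. by rewrite !axE mxE !add0r. Qed.

Lemma cross1 v w : cross v w 0 ax1 = v 0 ax2 * w 0 ax0 - v 0 ax0 * w 0 ax2.
Proof.
rewrite !axE mxE (_ : 1 + 1 = 2%:R)//.
by rewrite (_ : 1 + 2%:R = 0 :> 'I_3)//; apply: val_inj.
Qed.

Lemma cross2 v w : cross v w 0 ax2 = v 0 ax0 * w 0 ax1 - v 0 ax1 * w 0 ax0.
Proof.
rewrite !axE mxE (_ : 2%:R + 1 = 0 :> 'I_3); last exact: val_inj.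
by rewrite (_ : 2%:R + 2%:R = 1 :> 'I_3)//; apply: val_inj.
Qed.

Lemma has_deriv_unique (h : R -> R) (x a b : R) :
  has_deriv h x a -> has_deriv h x b -> a = b.
Proof. by move=> [_ <-] [_ <-]. Qed.

Lemma row_derivP f (x : R) v :
  is_derive x 1 f v <-> forall i, has_deriv (fun y => f y 0 i) x (v 0 i).
Proof.
split=> [[df <-] i|df].
  have /derivable_mxP/(_ 0 i) dfi := df.
  by rewrite /has_deriv derive_mx// mxE; apply: DeriveDef.
have ddf : derivable f x 1.
  by apply/derivable_mxP => i j; rewrite ord1; exact: has_deriv_derivable (df j).
apply: DeriveDef => //; rewrite derive_mx//; apply/rowP => i.
by rewrite mxE; have [_ ->] := df i.
Qed.

(* Opaque, so that unification does not look into iterated derivatives. *)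
Fact dcoord_subproof : {c : (R -> 'rV[R]_3) -> nat -> 'I_3 -> R -> R |
  forall f j i x, c f j i x = derive1n j f x 0 i}.
Proof. by exists (fun f j i x => derive1n j f x 0 i). Qed.

Definition dcoord := sval dcoord_subproof.

Lemma dcoordE f j i x : dcoord f j i x = derive1n j f x 0 i.
Proof. exact: svalP dcoord_subproof f j i x. Qed.

Lemma dcoord_funE f j i : dcoord f j i = fun x => derive1n j f x 0 i.
Proof. by apply/funext => x; exact: dcoordE. Qed.

Lemma smooth_dcoord f j i (x : R) : smooth f ->
  has_deriv (dcoord f j i) x (dcoord f j.+1 i x).
Proof.
move=> sf; have : is_derive x 1 (derive1n j f) (derive1n j.+1 f x).
  by apply: DeriveDef; [exact: sf | rewrite derive1nS derive1E].
by rewrite dcoord_funE dcoordE => /row_derivP/(_ i).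
Qed.

Lemma dcoord_continuous f j i : smooth f -> continuous (dcoord f j i).
Proof.
by move=> sf; apply: (@derive_continuous _ _ (dcoord f j.+1 i)) => x; exact: smooth_dcoord.
Qed.

Lemma derive1n_family (G : nat -> R -> 'rV[R]_3) :
  (forall j i x, has_deriv (fun y => G j y 0 i) x (G j.+1 x 0 i)) ->
  forall j, derive1n j (G 0%N) = G j.
Proof.
move=> dG; elim=> [//|j ih]; rewrite derive1nS ih; apply/funext => x.
have /row_derivP[_ <-] := fun i => dG j i x; exact: derive1E.
Qed.

Lemma smooth_family (G : nat -> R -> 'rV[R]_3) :
  (forall j i x, has_deriv (fun y => G j y 0 i) x (G j.+1 x 0 i)) ->
  smooth (G 0%N).
Proof.
move=> dG j x; rewrite derive1n_family//.
by have /row_derivP[] := fun i => dG j i x.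
Qed.

Lemma periodic_dcoord f j i : smooth f -> Defs.periodic f ->
  forall x, dcoord f j i (x + 2 * pi) = dcoord f j i x.
Proof.
move=> sf pf; elim: j => [|j ih] x; first by rewrite !dcoordE /= pf.
apply: (@has_deriv_unique (dcoord f j i) x); last exact: smooth_dcoord.
rewrite [X in has_deriv X](_ : _ = fun y => dcoord f j i (y + 2 * pi)); last first.
  by apply/funext => y; rewrite ih.
apply: has_deriv_eq; first apply: (@has_deriv_comp _ (dcoord f j i)); first exact: smooth_dcoord.
  by repeat dstep.
by rewrite addr0 mulr1.
Qed.

Lemma l2prodE f g :
  l2prod f g = cint (fun x => f x 0 ax0 * g x 0 ax0 + f x 0 ax1 * g x 0 ax1
                              + f x 0 ax2 * g x 0 ax2).
Proof. by apply: eq_cint => x; rewrite dotE. Qed.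

Definition sqdcoord f (j : nat) : R -> R :=
  fun x => dcoord f j ax0 x ^+ 2 + dcoord f j ax1 x ^+ 2 + dcoord f j ax2 x ^+ 2.

Lemma l2prod_dcoord f j : l2prod (derive1n j f) (derive1n j f) = cint (sqdcoord f j).
Proof. by rewrite l2prodE; apply: eq_cint => x; rewrite /sqdcoord !dcoordE !expr2. Qed.

Lemma continuous_sqdcoord f j : smooth f -> continuous (sqdcoord f j).
Proof.
by move=> sf; apply: contD; [apply: contD|]; apply: contX; exact: dcoord_continuous.
Qed.

Lemma sqdcoord_ge0 f j x : 0 <= sqdcoord f j x.
Proof. by rewrite !addr_ge0// sqr_ge0. Qed.

Lemma dcoord_le_sqdcoord f j i x : dcoord f j i x ^+ 2 <= sqdcoord f j x.
Proof.
have := sqr_ge0 (dcoord f j ax0 x); have := sqr_ge0 (dcoord f j ax1 x).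
have := sqr_ge0 (dcoord f j ax2 x).
by elim/ord3_ind: i; rewrite /sqdcoord; lra.
Qed.

Lemma sobolev_sq_ge k f j : smooth f -> (j <= k)%N ->
  cint (sqdcoord f j) <= sobolev_sq k f.
Proof.
move=> sf jk; rewrite /sobolev_sq (bigD1 (Ordinal (jk : (j < k.+1)%N)))//=.
rewrite l2prod_dcoord lerDl sumr_ge0// => i _; rewrite l2prod_dcoord.
by apply: cint_ge0; [exact: continuous_sqdcoord | exact: sqdcoord_ge0].
Qed.

Lemma sobolev_sq_ge0 k f : smooth f -> 0 <= sobolev_sq k f.
Proof.
move=> sf; apply: le_trans (sobolev_sq_ge sf (leq0n k)).
by apply: cint_ge0; [exact: continuous_sqdcoord | exact: sqdcoord_ge0].
Qed.

(** The constant is the 2 of [sobolev_sup] times two terms, of orders [j] and [j.+1], each at most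
    [sobolev_sq k f]. *)
Lemma dcoord_le_sobolev k f j i x : smooth f -> Defs.periodic f -> (j < k)%N ->
  dcoord f j i x ^+ 2 <= 4 * sobolev_sq k f.
Proof.
move=> sf pf jk.
have := @sobolev_sup _ _ (dcoord f j.+1 i) (fun y => smooth_dcoord j i y sf)
  (@dcoord_continuous f j.+1 i sf) (periodic_dcoord j i sf pf) x.
move=> /le_trans; apply.
have c0 := @continuous_sqdcoord f j sf; have c1 := @continuous_sqdcoord f j.+1 sf.
have := sobolev_sq_ge sf (ltnW jk); have := sobolev_sq_ge sf jk.
suff : cint (fun y => dcoord f j i y ^+ 2 + dcoord f j.+1 i y ^+ 2) <=
    cint (sqdcoord f j) + cint (sqdcoord f j.+1) by lra.
rewrite -cintD//; apply: cint_le.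
- by apply: contD; apply: contX; exact: dcoord_continuous.
- exact: contD.
- by move=> y; apply: lerD; exact: dcoord_le_sqdcoord.
Qed.

End vector_fields.

(** * Solutions and uniqueness *)

Section uniform_limits.
Context {R : realType}.
Implicit Types (h k : R -> R -> R) (l m : R -> R).

(** The filter is arbitrary because the parameter runs through full neighbourhoods for continuity in
    time and through punctured ones for difference quotients. *)
Definition uniform_limit (F : set_system R) h l :=
  forall e, 0 < e -> \forall t \near F, forall x, `|h t x - l x| <= e.

Variables (F : set_system R).
Context {FF : Filter F}.

Lemma uniform_limit_cst l : uniform_limit F (fun=> l) l.
Proof. by move=> e e0; near=> t => x; rewrite subrr normr0 ltW.
Unshelve. all: by end_near. Qed.

Lemma uniform_limitD h k l m : uniform_limit F h l -> uniform_limit F k m ->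
  uniform_limit F (fun t x => h t x + k t x) (fun x => l x + m x).
Proof.
move=> hl km e e0; have e2 : 0 < e / 2 by rewrite divr_gt0.
near=> t => x.
have h1 : `|h t x - l x| <= e / 2 by move: x; near: t; exact: hl.
have h2 : `|k t x - m x| <= e / 2 by move: x {h1}; near: t; exact: km.
rewrite (_ : _ - _ = (h t x - l x) + (k t x - m x)); last by ring.
by have := ler_normD (h t x - l x) (k t x - m x); lra.
Unshelve. all: by end_near. Qed.

Lemma uniform_limitM h k l m (K : R) :
  (forall x, `|l x| <= K) -> (forall x, `|m x| <= K) ->
  uniform_limit F h l -> uniform_limit F k m ->
  uniform_limit F (fun t x => h t x * k t x) (fun x => l x * m x).
Proof.
move=> lK mK hl km e e0.
have K0 : 0 <= K by apply: le_trans (lK 0).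
(* With both errors at most [d <= 1], the three products of the expansion add up to at most
   [d + 2 * d * K <= e]; only the limits need a bound. *)
pose d := Num.min 1 (e / (2 * K + 1)).
have d0 : 0 < d by rewrite lt_min ltr01 divr_gt0//; lra.
have d1 : d <= 1 by rewrite ge_min lexx.
have de : d * (2 * K + 1) <= e.
  by rewrite -ler_pdivlMr ?ge_min ?lexx ?orbT//; lra.
near=> t => x.
have h1 : `|h t x - l x| <= d by move: x; near: t; exact: hl.
have h2 : `|k t x - m x| <= d by move: x {h1}; near: t; exact: km.
rewrite (_ : _ - _ = (h t x - l x) * (k t x - m x) + (h t x - l x) * m x
                     + l x * (k t x - m x)); last by ring.
apply: le_trans (ler_normD _ _) _; apply: le_trans (lerD (ler_normD _ _) (lexx _)) _.
rewrite !normrM.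
have p1 : `|h t x - l x| * `|k t x - m x| <= d * 1.
  by apply: ler_pM => //; exact: le_trans h2 d1.
have p2 : `|h t x - l x| * `|m x| <= d * K by apply: ler_pM.
have p3 : `|l x| * `|k t x - m x| <= K * d by apply: ler_pM.
lra.
Unshelve. all: by end_near. Qed.

Lemma uniform_limitN h l : uniform_limit F h l ->
  uniform_limit F (fun t x => - h t x) (fun x => - l x).
Proof.
move=> hl e e0; near=> t => x; rewrite -opprD normrN; move: x.
by near: t; exact: hl.
Unshelve. all: by end_near. Qed.

Lemma uniform_limit_cint h l : (forall t, continuous (h t)) -> continuous l ->
  uniform_limit F h l -> cint (h t) @[t --> F] --> cint l.
Proof.
move=> ch cl hl; apply/cvgrPdist_le => e e0.
have d0 : 0 < e / (2 * pi) by rewrite divr_gt0// twopi_gt0.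
near=> t; rewrite distrC -cintB//.
apply: le_trans (cint_bound (K := e / (2 * pi)) _ _) _.
- by apply: contD => //; exact: contN.
- by near: t; exact: hl.
- by rewrite mulrC divfK// gt_eqF// twopi_gt0.
Unshelve. all: by end_near. Qed.

End uniform_limits.

(** * Differences of smooth fields; regularity of solutions in time *)

Section comparison.
Context {R : realType}.
Implicit Types f g : R -> 'rV[R]_3.

Lemma derive1nB f g j : smooth f -> smooth g ->
  derive1n j (fun x => f x - g x) = (fun x => derive1n j f x - derive1n j g x).
Proof.
move=> sf sg.
apply: (@derive1n_family _ (fun j x => derive1n j f x - derive1n j g x)).
move=> n i x; rewrite !mxE.
rewrite [X in has_deriv X](_ : _ = fun y => dcoord f n i y + - dcoord g n i y).
  by rewrite -(dcoordE f n.+1) -(dcoordE g n.+1);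
    apply: has_derivD; [|apply: has_derivN]; exact: smooth_dcoord.
by apply/funext => y; rewrite !mxE !dcoordE.
Qed.

Lemma smoothB f g : smooth f -> smooth g -> smooth (fun x => f x - g x).
Proof.
by move=> sf sg n x; rewrite derive1nB//; apply: derivableB; [exact: sf|exact: sg].
Qed.

Lemma dcoordB f g j i x : smooth f -> smooth g ->
  dcoord (fun x => f x - g x) j i x = dcoord f j i x - dcoord g j i x.
Proof. by move=> sf sg; rewrite !dcoordE derive1nB// !mxE. Qed.

Definition crossc f (i : 'I_3) (x : R) : R :=
  dcoord f 0 (i + 1) x * dcoord f 2 (i + 2%:R) x - dcoord f 0 (i + 2%:R) x * dcoord f 2 (i + 1) x.

Lemma crosscE f i x : crossc f i x = cross (f x) (derive1n 2 f x) 0 i.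
Proof. by rewrite mxE /crossc !dcoordE. Qed.

(** The product rule gives a second term [f' x f'], which vanishes. *)
Lemma smooth_cross f i (x : R) : smooth f ->
  (derive1 (fun y => cross (f y) (derive1 f y)) x) 0 i = crossc f i x.
Proof.
move=> sf; have d j l y := @smooth_dcoord _ f j l y sf.
suff /(@derive_val _ _ _ _ _ _ _) : is_derive x 1
    (fun y => cross (f y) (derive1 f y)) (cross (f x) (derive1n 2 f x)).
  by rewrite derive1E => ->; rewrite crosscE.
apply/row_derivP => l; rewrite -crosscE.
rewrite [X in has_deriv X](_ : _ = fun y => dcoord f 0 (l + 1) y * dcoord f 1 (l + 2%:R) y
  - dcoord f 0 (l + 2%:R) y * dcoord f 1 (l + 1) y).
  by apply: has_deriv_eq; [repeat dstep | rewrite /crossc; ring].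
by apply/funext=> y; rewrite mxE !dcoordE.
Qed.

Implicit Types u : R -> R -> 'rV[R]_3.

Lemma solution_deriv u t s i : is_solution u ->
  has_deriv (fun tau => dcoord (u tau) 0 i s) t (crossc (u t) i s).
Proof.
move=> [su _ /(_ t s)]; have [_ smu _] := su t.
move=> /row_derivP/(_ i); rewrite smooth_cross//.
by under [in X in _ -> X]eq_fun do rewrite dcoordE.
Qed.

Lemma solution_uniform u t j i : is_solution u ->
  uniform_limit (nbhs t) (fun tau => dcoord (u tau) j i) (dcoord (u t) j i).
Proof.
move=> [su cu _] e e0; have [pt st _] := su t.
(* The order is [j.+2] because continuity in time is assumed in H^k for [k >= 2] only; the 4 is the
   constant of [dcoord_le_sobolev]. *)
have /cvgr0Pnorm_lt/(_ (e ^+ 2 / 4)) := cu j.+2 t isT.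
have e4 : 0 < e ^+ 2 / 4 by rewrite divr_gt0// exprn_gt0.
move=> /(_ e4) He; near=> tau => x; have [ptau stau _] := su tau.
have sB := smoothB stau st.
have pB : Defs.periodic (fun s => u tau s - u t s) by move=> y; rewrite ptau pt.
have := dcoord_le_sobolev i x sB pB (leqnSn j.+1); rewrite dcoordB// => le4.
have : `|sobolev_sq j.+2 (fun s => u tau s - u t s)| < e ^+ 2 / 4 by near: tau.
rewrite ger0_norm ?sobolev_sq_ge0// => lt4.
rewrite -(@ler_pXn2r _ 2)// ?nnegrE ?(ltW e0)// real_normK ?num_real//; lra.
Unshelve. all: by end_near. Qed.

End comparison.

Section gronwall.
Context {R : realType}.

(** The two-sided bound on [D] serves both directions of time: [exp(-C t) E] is nonincreasing, which
    settles [t >= 0], and [exp(C t) E] is nondecreasing, which settles [t <= 0]. *)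
Lemma gronwall_zero (E D : R -> R) (C : R) :
  (forall t : R, has_deriv E t (D t)) -> (forall t, `|D t| <= C * E t) ->
  E 0 = 0 -> forall t, E t <= 0.
Proof.
move=> dE DE E0 t.
have dexpR (c x : R) : has_deriv (fun y => expR (c * y)) x (expR (c * x) * c).
  apply: (@has_deriv_comp _ expR); first exact: is_derive_expR.
  by apply: has_deriv_eq; [repeat dstep | cbv beta; ring].
have [t0|/ltW t0] := leP 0 t.
  have : {homo (fun y => - (expR (- C * y) * E y)) : x y / x <= y}.
    apply: (@derive_ge0_homo _ _ (fun y => expR (- C * y) * (C * E y - D y))).
      by move=> y; apply: has_deriv_eq; [repeat dstep; exact: dexpR | cbv beta; ring].
    move=> y; rewrite mulr_ge0 ?expR_ge0// subr_ge0.
    by apply: le_trans (DE y); exact: ler_norm.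
  move=> /(_ _ _ t0); rewrite E0 !mulr0 oppr0 oppr_ge0.
  by rewrite pmulr_rle0// expR_gt0.
have : {homo (fun y => expR (C * y) * E y) : x y / x <= y}.
  apply: (@derive_ge0_homo _ _ (fun y => expR (C * y) * (D y + C * E y))).
    by move=> y; apply: has_deriv_eq; [repeat dstep; exact: dexpR | cbv beta; ring].
  move=> y; rewrite mulr_ge0 ?expR_ge0//.
  by have := DE y; rewrite ler_norml => /andP[]; lra.
move=> /(_ _ _ t0); rewrite E0 !mulr0.
by rewrite pmulr_rle0// expR_gt0.
Qed.

End gronwall.

(** * Energy estimate for the H^1 distance of two solutions *)

Section energy_estimate.
Context {R : realType}.
Variables (U W : nat -> 'I_3 -> R -> R) (K : R).
Hypotheses (dU : forall j i (x : R), has_deriv (U j i) x (U j.+1 i x))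
  (dW : forall j i (x : R), has_deriv (W j i) x (W j.+1 i x)).
Hypotheses (pU : forall j i x, U j i (x + 2 * pi) = U j i x)
  (pW : forall j i x, W j i (x + 2 * pi) = W j i x).
Hypotheses (U1K : forall i x, `|U 1 i x| <= K) (U3K : forall i x, `|U 3 i x| <= K).

Let cU j i : continuous (U j i).
Proof. exact: derive_continuous (dU j i). Qed.

Let cW j i : continuous (W j i).
Proof. exact: derive_continuous (dW j i). Qed.

Definition energy_density x : R :=
  W 0 ax0 x ^+ 2 + W 0 ax1 x ^+ 2 + W 0 ax2 x ^+ 2
  + (W 1 ax0 x ^+ 2 + W 1 ax1 x ^+ 2 + W 1 ax2 x ^+ 2).

(** With [U j] and [W j] the space derivatives of order [j] of a solution [u] and of [w = v - u],
    this is [2 (w - w_ss) . w_t]: the rate of [|w|^2 + |w_s|^2], once the time derivative of [w_s]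
    has been integrated by parts. *)
Definition energy_rate_density x : R :=
  (W 0 ax0 x + W 0 ax0 x - (W 2 ax0 x + W 2 ax0 x)) *
    ((U 0 ax1 x + W 0 ax1 x) * (U 2 ax2 x + W 2 ax2 x)
     - (U 0 ax2 x + W 0 ax2 x) * (U 2 ax1 x + W 2 ax1 x)
     - (U 0 ax1 x * U 2 ax2 x - U 0 ax2 x * U 2 ax1 x))
  + (W 0 ax1 x + W 0 ax1 x - (W 2 ax1 x + W 2 ax1 x)) *
    ((U 0 ax2 x + W 0 ax2 x) * (U 2 ax0 x + W 2 ax0 x)
     - (U 0 ax0 x + W 0 ax0 x) * (U 2 ax2 x + W 2 ax2 x)
     - (U 0 ax2 x * U 2 ax0 x - U 0 ax0 x * U 2 ax2 x))
  + (W 0 ax2 x + W 0 ax2 x - (W 2 ax2 x + W 2 ax2 x)) *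
    ((U 0 ax0 x + W 0 ax0 x) * (U 2 ax1 x + W 2 ax1 x)
     - (U 0 ax1 x + W 0 ax1 x) * (U 2 ax0 x + W 2 ax0 x)
     - (U 0 ax0 x * U 2 ax1 x - U 0 ax1 x * U 2 ax0 x)).

Let bilinear_bound (k a b : R) : `|k| <= K ->
  `|2 * k * a * b| <= K * (a ^+ 2 + b ^+ 2).
Proof.
move=> kK; rewrite !normrM (ger0_norm (ler0n _ 2)).
have K0 : 0 <= K by exact: le_trans kK.
apply: (@le_trans _ _ (K * (2 * (`|a| * `|b|)))).
  rewrite [leLHS](_ : _ = `|k| * (2 * (`|a| * `|b|))); last by ring.
  by rewrite ler_wpM2r// !mulr_ge0.
rewrite ler_wpM2l// -(real_normK (num_real a)) -(real_normK (num_real b)).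
by have := sqr_ge0 (`|a| - `|b|); nra.
Qed.

Let triple (a b c : 'I_3 -> R) :=
  a ax0 * (b ax1 * c ax2 - b ax2 * c ax1) + a ax1 * (b ax2 * c ax0 - b ax0 * c ax2)
  + a ax2 * (b ax0 * c ax1 - b ax1 * c ax0).

(** In [w_t = u x w_ss + w x u_ss + w x w_ss], the last term is orthogonal to both [w] and [w_ss].
    What remains is linear in [U], so that bounds on one of the two solutions suffice; integrating
    by parts trades its orders 0 and 2 for 1 and 3. *)
Let Q x := 2 * (triple (fun i => W 1 i x) (fun i => W 0 i x) (fun i => U 3 i x)
  - triple (fun i => W 0 i x) (fun i => U 1 i x) (fun i => W 1 i x)).

(** [Q] is a sum of twelve products, each bounded by [K] times two squares; each of the six squares
    of [energy_density] occurs four times. *)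
Let Q_bound x : `|Q x| <= 4 * K * energy_density x.
Proof.
pose b (k a c : R) := 2 * k * a * c.
have bP (k a c : R) : `|k| <= K ->
    - (K * (a ^+ 2 + c ^+ 2)) <= b k a c <= K * (a ^+ 2 + c ^+ 2).
  by move=> kK; rewrite -ler_norml; exact: bilinear_bound.
have QE : Q x =
    b (U 3 ax0 x) (W 1 ax1 x) (W 0 ax2 x) + b (U 3 ax0 x) (W 1 ax2 x) (- W 0 ax1 x)
  + b (U 3 ax1 x) (W 1 ax0 x) (- W 0 ax2 x) + b (U 3 ax1 x) (W 1 ax2 x) (W 0 ax0 x)
  + b (U 3 ax2 x) (W 1 ax0 x) (W 0 ax1 x) + b (U 3 ax2 x) (W 1 ax1 x) (- W 0 ax0 x)
  + b (U 1 ax0 x) (W 0 ax1 x) (W 1 ax2 x) + b (U 1 ax0 x) (W 0 ax2 x) (- W 1 ax1 x)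
  + b (U 1 ax1 x) (W 0 ax0 x) (- W 1 ax2 x) + b (U 1 ax1 x) (W 0 ax2 x) (W 1 ax0 x)
  + b (U 1 ax2 x) (W 0 ax0 x) (W 1 ax1 x) + b (U 1 ax2 x) (W 0 ax1 x) (- W 1 ax0 x).
  by rewrite /Q /b /triple; cbv beta; ring.
rewrite ler_norml QE /energy_density.
have := bP _ (W 1 ax1 x) (W 0 ax2 x) (U3K ax0 x).
have := bP _ (W 1 ax2 x) (- W 0 ax1 x) (U3K ax0 x).
have := bP _ (W 1 ax0 x) (- W 0 ax2 x) (U3K ax1 x).
have := bP _ (W 1 ax2 x) (W 0 ax0 x) (U3K ax1 x).
have := bP _ (W 1 ax0 x) (W 0 ax1 x) (U3K ax2 x).
have := bP _ (W 1 ax1 x) (- W 0 ax0 x) (U3K ax2 x).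
have := bP _ (W 0 ax1 x) (W 1 ax2 x) (U1K ax0 x).
have := bP _ (W 0 ax2 x) (- W 1 ax1 x) (U1K ax0 x).
have := bP _ (W 0 ax0 x) (- W 1 ax2 x) (U1K ax1 x).
have := bP _ (W 0 ax2 x) (W 1 ax0 x) (U1K ax1 x).
have := bP _ (W 0 ax0 x) (W 1 ax1 x) (U1K ax2 x).
have := bP _ (W 0 ax1 x) (- W 1 ax0 x) (U1K ax2 x).
(* The twelve products become variables, which makes the goal linear in them and in the squares. *)
rewrite !sqrrN; move: (b _ _ _) => b1 /andP[? ?].
move: (b _ _ _) => b2 /andP[? ?]; move: (b _ _ _) => b3 /andP[? ?].
move: (b _ _ _) => b4 /andP[? ?]; move: (b _ _ _) => b5 /andP[? ?].
move: (b _ _ _) => b6 /andP[? ?]; move: (b _ _ _) => b7 /andP[? ?].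
move: (b _ _ _) => b8 /andP[? ?]; move: (b _ _ _) => b9 /andP[? ?].
move: (b _ _ _) => b10 /andP[? ?]; move: (b _ _ _) => b11 /andP[? ?].
move: (b _ _ _) => b12 /andP[? ?].
by apply/andP; split; lra.
Qed.

(* The density differs from Q, which is quadratic in (w, w_s), by the
   derivative of 2 w.(u x w_s) - 2 w_s.(w x u_ss). *)
Lemma energy_rate : `|cint energy_rate_density| <= 4 * K * cint energy_density.
Proof.
pose P x := 2 * (triple (fun i => W 0 i x) (fun i => U 0 i x) (fun i => W 1 i x)
  - triple (fun i => W 1 i x) (fun i => W 0 i x) (fun i => U 2 i x)).
have cQ : continuous Q.
  by rewrite /Q /triple; repeat cstep.
have cr : continuous energy_rate_density.
  by rewrite /energy_rate_density; repeat cstep.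
have ce : continuous energy_density.
  by rewrite /energy_density; repeat cstep.
have -> : cint energy_rate_density = cint Q.
  apply/eqP; rewrite -subr_eq0 -cintB//.
  apply/eqP; apply: (@cint_periodic _ _ P).
  - by apply: contD => //; exact: contN.
  - move=> x; apply: has_deriv_eq; first by rewrite /P /triple; repeat dstep.
    by cbv beta; rewrite /energy_rate_density /Q /triple; ring.
  - by move=> x; rewrite /P /triple !pU !pW.
have cKe : continuous (fun x => 4 * K * energy_density x).
  by apply: contM; [exact: cont_cst | exact: ce].
rewrite -cintZ// ler_norml -cintN//; apply/andP; split; apply: cint_le => //.
- exact: contN.
- by move=> x; have := Q_bound x; rewrite ler_norml => /andP[].
- by move=> x; have := Q_bound x; rewrite ler_norml => /andP[].
Qed.

End energy_estimate.

(** * Uniqueness of bounded solutions *)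

Section uniqueness.
Context {R : realType}.
Variables (u v : R -> R -> 'rV[R]_3) (K : R).
Hypotheses (su : is_solution u) (sv : is_solution v).
Hypothesis u1K : forall t i x, `|dcoord (u t) 1 i x| <= K.
Hypothesis u3K : forall t i x, `|dcoord (u t) 3 i x| <= K.

Let smu t : smooth (u t). Proof. by have [/(_ t)[]] := su. Qed.
Let smv t : smooth (v t). Proof. by have [/(_ t)[]] := sv. Qed.

Let w j i t x : R := dcoord (v t) j i x - dcoord (u t) j i x.

Let wt i t x : R :=
  crossc (v t) i x - crossc (u t) i x.

Let dw j i t x : has_deriv (w j i t) x (w j.+1 i t x).
Proof. by apply: has_derivD; [|apply: has_derivN]; exact: smooth_dcoord. Qed.

Let cw j i t : continuous (w j i t).
Proof. by apply: (derive_continuous (dw j i t)). Qed.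

Let pw j i t x : w j i t (x + 2 * pi) = w j i t x.
Proof.
have [/(_ t)[pu _ _] _ _] := su; have [/(_ t)[pv _ _] _ _] := sv.
by rewrite /w !periodic_dcoord.
Qed.

Let dwt i t x : has_deriv (fun tau => w 0 i tau x) t (wt i t x).
Proof. by apply: has_derivD; [|apply: has_derivN]; exact: solution_deriv. Qed.

Let uw j i t : uniform_limit (nbhs t) (fun tau => w j i tau) (w j i t).
Proof. by apply: uniform_limitD; [|apply: uniform_limitN]; exact: solution_uniform. Qed.

Let bounded_dcoord (f : R -> 'rV[R]_3) j i : Defs.periodic f -> smooth f ->
  exists M, forall x, `|dcoord f j i x| <= M.
Proof.
by move=> pf sf; apply: periodic_bounded; [exact: dcoord_continuous | exact: periodic_dcoord].
Qed.

Let uniform_dcoord_mul (z : R -> R -> 'rV[R]_3) (t : R) j i k l : is_solution z ->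
  uniform_limit (nbhs t) (fun tau x => dcoord (z tau) j i x * dcoord (z tau) k l x)
    (fun x => dcoord (z t) j i x * dcoord (z t) k l x).
Proof.
move=> sz; have [/(_ t)[pz smz _] _ _] := sz.
have [M1 M1P] := bounded_dcoord j i pz smz; have [M2 M2P] := bounded_dcoord k l pz smz.
apply: (@uniform_limitM _ _ _ _ _ _ _ (Num.max M1 M2)); last 2 first.
- exact: solution_uniform.
- exact: solution_uniform.
- by move=> x; rewrite le_max M1P.
- by move=> x; rewrite le_max M2P orbT.
Qed.

Let uniform_cross (z : R -> R -> 'rV[R]_3) (t : R) i : is_solution z ->
  uniform_limit (nbhs t) (fun tau => crossc (z tau) i) (crossc (z t) i).
Proof.
by move=> sz; apply: uniform_limitD; [|apply: uniform_limitN];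
  exact: uniform_dcoord_mul.
Qed.

Let uwt i t : uniform_limit (nbhs t) (fun tau => wt i tau) (wt i t).
Proof. by apply: uniform_limitD; [|apply: uniform_limitN]; exact: uniform_cross. Qed.

Let continuous_cross (f : R -> 'rV[R]_3) i : smooth f -> continuous (crossc f i).
Proof.
by move=> sf; have c j l := @dcoord_continuous _ f j l sf; rewrite /crossc; repeat cstep.
Qed.

Let cwt i t : continuous (wt i t).
Proof. by apply: contD; [|apply: contN]; exact: continuous_cross. Qed.

Let quotient i t h x : R := h^-1 * (w 0 i (h + t) x - w 0 i t x).

Let cquotient i t h : continuous (quotient i t h).
Proof. by apply: contM; [exact: cont_cst | apply: contD; [|apply: contN]; exact: cw]. Qed.

Let uquotient i t :
  uniform_limit (0 : R)^' (fun h => quotient i t h) (wt i t).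
Proof.
move=> e e0; have /nbhs_ballP[d /= d0 Hd] := @uwt i t e e0.
near=> h => x; have h0 : h != 0 by near: h; exact: nbhs_dnbhs_neq.
(* The intermediate time [c] depends on [x], but it stays within [|h|] of [t], where [wt] is close
   to its value at [t] uniformly in space. *)
rewrite /quotient; have [c cI ->] := mvt t (h + t) (fun s => dwt i s x).
rewrite addrK mulrCA mulVf// mulr1; apply: Hd.
have hd : `|h| < d by near: h; exact: dnbhs0_lt.
rewrite /ball/= ltr_distl; move: hd cI; rewrite ltr_norml => /andP[].
by rewrite ge_min le_max => h1 h2 /andP[/orP[] ? /orP[] ?]; apply/andP; split; lra.
Unshelve. all: by end_near. Qed.

Let S j i t h x : R := w j i (h + t) x + w j i t x.

Let uS j i t : uniform_limit (0 : R)^' (fun h => S j i t h) (fun x => w j i t x + w j i t x).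
Proof.
apply: uniform_limitD; last exact: uniform_limit_cst.
move=> e e0; have /nbhs_ballP[d /= d0 Hd] := @uw j i t e e0.
near=> h; apply: Hd; rewrite /ball/= opprD addrCA subrr addr0 normrN.
by near: h; exact: dnbhs0_lt.
Unshelve. all: by end_near. Qed.

Let cS j i t h : continuous (S j i t h).
Proof. by apply: contD; exact: cw. Qed.

Let e t x : R := w 0 ax0 t x ^+ 2 + w 0 ax1 t x ^+ 2 + w 0 ax2 t x ^+ 2
  + (w 1 ax0 t x ^+ 2 + w 1 ax1 t x ^+ 2 + w 1 ax2 t x ^+ 2).

Let E t : R := cint (e t).

Let ce t : continuous (e t).
Proof. by apply: contD; (apply: contD; [apply: contD|]); apply: contX; exact: cw. Qed.

Let term i t h x : R := (S 0 i t h x - S 2 i t h x) * quotient i t h x.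
Let term_lim i t x : R :=
  (w 0 i t x + w 0 i t x - (w 2 i t x + w 2 i t x)) * wt i t x.

Let uterm i t : uniform_limit (0 : R)^' (fun h => term i t h) (term_lim i t).
Proof.
have [/(_ t)[pu _ _] _ _] := su; have [/(_ t)[pv _ _] _ _] := sv.
have pwt x : wt i t (x + 2 * pi) = wt i t x.
  by rewrite /wt /crossc !periodic_dcoord.
have [M1 M1P] := periodic_bounded (@cwt i t) pwt.
pose l x := w 0 i t x + w 0 i t x - (w 2 i t x + w 2 i t x).
have cl : continuous l.
  by apply: contD; [|apply: contN]; apply: contD; exact: cw.
have [M2 M2P] : exists M, forall x, `|l x| <= M.
  by apply: periodic_bounded => // x; rewrite /l !pw.
apply: (@uniform_limitM _ _ _ _ _ l _ (Num.max M1 M2)).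
- by move=> x; rewrite le_max M2P orbT.
- by move=> x; rewrite le_max M1P.
- by apply: uniform_limitD; [|apply: uniform_limitN]; exact: uS.
- exact: uquotient.
Qed.

Let cterm i t h : continuous (term i t h).
Proof.
by apply: contM; [apply: contD; [|apply: contN]; exact: cS | exact: cquotient].
Qed.

Let cterm_lim i t : continuous (term_lim i t).
Proof.
by apply: contM; [apply: contD; [|apply: contN]; apply: contD; exact: cw | exact: cwt].
Qed.

Let D t : R := cint (fun x => term_lim ax0 t x + term_lim ax1 t x + term_lim ax2 t x).

(* |w(t+h)|^2 - |w(t)|^2 factors as a difference times a sum; in the
   derivative part the difference is then integrated by parts, so that no
   time derivative of w_s is needed. *)
Let E_quotient t h : h^-1 * (E (h + t) - E t) =
  cint (fun x => term ax0 t h x + term ax1 t h x + term ax2 t h x).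
Proof.
rewrite -cintB; [|exact: ce|exact: ce].
rewrite -cintZ; last by apply: contD; [|apply: contN]; exact: ce.
apply/eqP; rewrite -subr_eq0; apply/eqP.
rewrite -cintB; first last.
- by apply: contD; [apply: contD|]; exact: cterm.
- by apply: contM; [exact: cont_cst | apply: contD; [|apply: contN]; exact: ce].
pose B i x := S 1 i t h x * quotient i t h x.
apply: (@cint_periodic _ _ (fun x => B ax0 x + B ax1 x + B ax2 x)).
- apply: contD; [|apply: contN; by apply: contD; [apply: contD|]; exact: cterm].
  by apply: contM; [exact: cont_cst | apply: contD; [|apply: contN]; exact: ce].
- move=> x; have dS j i : has_deriv (S j i t h) x (S j.+1 i t h x).
    by apply: has_derivD; exact: dw.
  have dq i : has_deriv (quotient i t h) x (h^-1 * (w 1 i (h + t) x - w 1 i t x)).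
    apply: has_deriv_eq; first by apply: has_derivM; [exact: has_deriv_cst |
      apply: has_derivD; [|apply: has_derivN]; exact: dw].
    by cbv beta; ring.
  have dB i : has_deriv (B i) x (S 1 i t h x * (h^-1 * (w 1 i (h + t) x - w 1 i t x))
      + quotient i t h x * S 2 i t h x) by apply: has_derivM.
  apply: has_deriv_eq; first by repeat dstep.
  cbv beta; rewrite /term /e /S /quotient; ring.
- by move=> x; rewrite /B /S /quotient !pw.
Qed.

(** The integrands of [E_quotient] converge uniformly, so the limit passes under the integral. *)
Let dE t : has_deriv E t (D t).
Proof.
have lim : h^-1 * (E (h + t) - E t) @[h --> (0 : R)^'] --> D t.
  under eq_fun do rewrite E_quotient.
  apply: uniform_limit_cint.
  - by move=> h; apply: contD; [apply: contD|]; exact: cterm.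
  - by apply: contD; [apply: contD|]; exact: cterm_lim.
  - by apply: uniform_limitD; [apply: uniform_limitD|]; exact: uterm.
have lim' : h^-1 *: ((E \o shift t) (h *: (1 : R)) - E t) @[h --> (0 : R)^'] --> D t.
  by under eq_fun do rewrite /= [_ *: (1 : R)]mulr1.
apply: DeriveDef; first by apply/cvg_ex; exists (D t).
exact: cvg_lim lim'.
Qed.

Let DE t : `|D t| <= 4 * K * E t.
Proof.
have [/(_ t)[pu _ _] _ _] := su.
pose U j i := dcoord (u t) j i; pose W j i := w j i t.
have -> : D t = cint (energy_rate_density U W).
  apply: eq_cint => x; rewrite /energy_rate_density /term_lim /wt.
  have vE j i : U j i x + W j i x = dcoord (v t) j i x by rewrite addrC subrK.
  rewrite !vE /crossc.
  have [-> -> ->] : [/\ ax0 + 1 = ax1, ax1 + 1 = ax2 & ax2 + 1 = ax0].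
    by rewrite !axE; split=> //; exact: val_inj.
  have [-> -> ->] : [/\ ax0 + 2%:R = ax2, ax1 + 2%:R = ax0 & ax2 + 2%:R = ax1].
    by rewrite !axE; split=> //; exact: val_inj.
  by [].
apply: (@energy_rate _ U W K).
- by move=> j i x; exact: smooth_dcoord.
- by move=> j i x; exact: dw.
- by move=> j i x; exact: periodic_dcoord.
- by move=> j i x; exact: pw.
- exact: u1K.
- exact: u3K.
Qed.

Lemma solution_unique : u 0 = v 0 -> u = v.
Proof.
move=> uv0; have E0 : E 0 = 0.
  rewrite /E (_ : e 0 = fun=> 0) ?cint_cst ?mulr0//; apply/funext => x.
  by rewrite /e /w uv0 !subrr expr0n/=; ring.
apply/funext => t; apply/funext => x.
have e0 : e t x = 0.
  apply: cint_eq0 (@ce t) _ _ (gronwall_zero dE DE E0 t) x.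
    by move=> y; rewrite /e !pw.
  by move=> y; rewrite !addr_ge0// sqr_ge0.
have w0 i : w 0 i t x = 0.
  apply/eqP; rewrite -sqrf_eq0 eq_le sqr_ge0 andbT -e0 /e.
  have q0 j l := sqr_ge0 (w j l t x).
  have := q0 0%N ax0; have := q0 0%N ax1; have := q0 0%N ax2.
  have := q0 1%N ax0; have := q0 1%N ax1; have := q0 1%N ax2.
  by elim/ord3_ind: i; lra.
by apply/rowP => i; have /eqP := w0 i; rewrite /w subr_eq0 !dcoordE => /eqP/esym.
Qed.

End uniqueness.

(** * Rotating waves *)

Section rotating_waves.
Context {R : realType}.

Definition row3 (a b c : R) : 'rV[R]_3 := \row_(i < 3) [:: a; b; c]`_i.

Lemma row3_0 a b c : row3 a b c 0 ax0 = a.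
Proof. by rewrite axE mxE. Qed.

Lemma row3_1 a b c : row3 a b c 0 ax1 = b.
Proof. by rewrite axE mxE. Qed.

Lemma row3_2 a b c : row3 a b c 0 ax2 = c.
Proof. by rewrite axE mxE. Qed.

Definition row3E := (row3_0, row3_1, row3_2).

Variables (V : nat -> 'I_3 -> R -> R) (om c : R).
Hypotheses (dV : forall j i (x : R), has_deriv (V j i) x (V j.+1 i x))
  (pV : forall i x, V 0 i (x + 2 * pi) = V 0 i x)
  (nV : forall x, V 0 ax0 x ^+ 2 + V 0 ax1 x ^+ 2 + V 0 ax2 x ^+ 2 = 1).
Hypotheses
  (ode0 : forall x, V 0 ax1 x * V 2 ax2 x - V 0 ax2 x * V 2 ax1 x
                    = - om * V 0 ax1 x - c * V 1 ax0 x)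
  (ode1 : forall x, V 0 ax2 x * V 2 ax0 x - V 0 ax0 x * V 2 ax2 x
                    = om * V 0 ax0 x - c * V 1 ax1 x)
  (ode2 : forall x, V 0 ax0 x * V 2 ax1 x - V 0 ax1 x * V 2 ax0 x
                    = - c * V 1 ax2 x).

Let G j (t s : R) : 'rV[R]_3 :=
  row3 (cos (om * t) * V j ax0 (s - c * t) - sin (om * t) * V j ax1 (s - c * t))
       (sin (om * t) * V j ax0 (s - c * t) + cos (om * t) * V j ax1 (s - c * t))
       (V j ax2 (s - c * t)).

Definition rotating_wave (t s : R) : 'rV[R]_3 := G 0 t s.

Let u := rotating_wave.

Let dVs j i (t s : R) :
  has_deriv (fun y => V j i (y - c * t)) s (V j.+1 i (s - c * t)).
Proof.
apply: has_deriv_eq; first apply: (@has_deriv_comp _ (V j i)); first exact: dV.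
  by repeat dstep.
by cbv beta; ring.
Qed.

Let dVt j i (t s : R) :
  has_deriv (fun y => V j i (s - c * y)) t (- c * V j.+1 i (s - c * t)).
Proof.
apply: has_deriv_eq; first apply: (@has_deriv_comp _ (V j i)); first exact: dV.
  by repeat dstep.
by cbv beta; ring.
Qed.

Let dG t j i s : has_deriv (fun y => G j t y 0 i) s (G j.+1 t s 0 i).
Proof.
have d k l := dVs k l t s.
elim/ord3_ind: i; rewrite /G; [under eq_fun do rewrite row3_0; rewrite row3_0
  | under eq_fun do rewrite row3_1; rewrite row3_1
  | under eq_fun do rewrite row3_2; rewrite row3_2 ].
- by apply: has_deriv_eq; [repeat dstep | cbv beta; ring].
- by apply: has_deriv_eq; [repeat dstep | cbv beta; ring].
- exact: d.
Qed.

Let smooth_u t : smooth (u t).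
Proof. exact: (@smooth_family _ (fun j => G j t) (dG t)). Qed.

Lemma dcoord_rotating_wave t j i s : dcoord (rotating_wave t) j i s = G j t s 0 i.
Proof.
by rewrite dcoordE -[rotating_wave t]/(G 0 t) (@derive1n_family _ (fun j => G j t) (dG t)).
Qed.

Let pVj j i x : V j i (x + 2 * pi) = V j i x.
Proof.
elim: j x => [|j ih] x; first exact: pV.
apply: (@has_deriv_unique _ (V j i) x); last exact: dV.
rewrite [X in has_deriv X](_ : _ = fun y => V j i (y + 2 * pi)); last first.
  by apply/funext => y; rewrite ih.
apply: has_deriv_eq; first apply: (@has_deriv_comp _ (V j i)); first exact: dV.
  by repeat dstep.
by cbv beta; rewrite addr0 mulr1.
Qed.

Let bounded_V j : exists M, forall i x, `|V j i x| <= M.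
Proof.
have b i : exists M, forall x, `|V j i x| <= M.
  apply: periodic_bounded => //; exact: derive_continuous (dV j i).
have [M0 b0] := b ax0; have [M1 b1] := b ax1; have [M2 b2] := b ax2.
exists (`|M0| + `|M1| + `|M2|) => i x.
have := normr_ge0 M0; have := normr_ge0 M1; have := normr_ge0 M2.
have := ler_norm M0; have := ler_norm M1; have := ler_norm M2.
by elim/ord3_ind: i; have := b0 x; have := b1 x; have := b2 x; lra.
Qed.

Lemma trig_combination_le (a b M x : R) : `|a| <= M -> `|b| <= M ->
  `|cos x * a + sin x * b| <= 2 * M.
Proof.
move=> aM bM; apply: le_trans (ler_normD _ _) _; rewrite !normrM.
have := cos_max x; have := sin_max x => ? ?.
have : `|cos x| * `|a| <= 1 * M by apply: ler_pM.
have : `|sin x| * `|b| <= 1 * M by apply: ler_pM.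
lra.
Qed.

Lemma rotating_wave_bounded j :
  exists M, forall t i s, `|dcoord (rotating_wave t) j i s| <= M.
Proof.
have [M bM] := bounded_V j; exists (2 * M) => t i s; rewrite dcoord_rotating_wave.
elim/ord3_ind: i; rewrite row3E.
- by rewrite -[- (sin _ * _)]mulrN; apply: trig_combination_le; rewrite ?normrN.
- by rewrite addrC; apply: trig_combination_le.
- by have := bM ax2 (s - c * t); have := normr_ge0 (V j ax2 (s - c * t)); lra.
Qed.

(** The time derivative of [G j]: the translation contributes [- c] times the space derivative, the
    rotation [om] times the product by [e3]. *)
Let H j i (t s : R) : R := - c * G j.+1 t s 0 i + om *
  row3 (- G j t s 0 ax1) (G j t s 0 ax0) 0 0 i.

Let dGt j i (t s : R) : has_deriv (fun y => G j y s 0 i) t (H j i t s).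
Proof.
have d k l := dVt k l t s.
have dc : has_deriv (fun y => cos (om * y)) t (- om * sin (om * t)).
  by apply: has_deriv_eq; [repeat dstep | cbv beta; ring].
have ds : has_deriv (fun y => sin (om * y)) t (om * cos (om * t)).
  by apply: has_deriv_eq; [repeat dstep | cbv beta; ring].
rewrite /H /G; elim/ord3_ind: i; [under eq_fun do rewrite row3_0; rewrite !row3E
  | under eq_fun do rewrite row3_1; rewrite !row3E
  | under eq_fun do rewrite row3_2; rewrite !row3E ].
- apply: has_deriv_eq; first by
    apply: has_derivD; [apply: has_derivM|apply: has_derivN; apply: has_derivM]; dhyp.
  by cbv beta; ring.
- apply: has_deriv_eq; first by apply: has_derivD; apply: has_derivM; dhyp.
  by cbv beta; ring.
- apply: has_deriv_eq; first by dhyp.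
  by ring.
Qed.

(** The bound on [H] is uniform in time and space, so every space derivative is Lipschitz in time
    uniformly in [s]. This gives the continuity in H^k for all [k]. *)
Let uniform_G j i t :
  uniform_limit (nbhs t) (fun tau => dcoord (u tau) j i) (dcoord (u t) j i).
Proof.
have [M0 bM0] := rotating_wave_bounded j.
have [M1 bM1] := rotating_wave_bounded j.+1.
have M00 : 0 <= M0 by apply: le_trans (bM0 0 ax0 0).
have M10 : 0 <= M1 by apply: le_trans (bM1 0 ax0 0).
pose L := `|c| * M1 + `|om| * M0.
have L0 : 0 <= L by rewrite addr_ge0// mulr_ge0.
have HL tau s : `|H j i tau s| <= L.
  apply: le_trans (ler_normD _ _) _; rewrite !normrM normrN lerD//.
    by rewrite ler_wpM2l// -dcoord_rotating_wave.
  rewrite ler_wpM2l//.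
  elim/ord3_ind: i; rewrite row3E ?normrN -?dcoord_rotating_wave//.
  by rewrite normr0.
move=> e e0; have /nbhs_ballP : nbhs t (ball t (e / (L + 1))).
  by apply: nbhsx_ballx; rewrite divr_gt0//; lra.
move=> [d /= d0 Hd]; near=> tau => s.
rewrite !dcoord_rotating_wave.
have := lipschitz_of_derive (fun y => dGt j i y s) (fun y => HL y s) t tau.
move=> /le_trans; apply.
have : ball t (e / (L + 1)) tau by apply: Hd; near: tau; exact: nbhsx_ballx.
rewrite /ball/= distrC => /ltW h.
apply: (@le_trans _ _ ((L + 1) * `|tau - t|)).
  by rewrite ler_wpM2r//; lra.
by rewrite mulrC -ler_pdivlMr//; lra.
Unshelve. all: by end_near. Qed.

(** Rotations commute with the vector product: the equation at [t, s] is the profile equation at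
    [s - c * t] rotated by the angle [om * t]. The final steps combine its first two coordinates
    with the cosine and the sine accordingly. *)
Lemma rotating_wave_solution : is_solution rotating_wave.
Proof.
have sm t : smooth_sphere_map (u t).
  split; [|exact: smooth_u|].
  - move=> x; rewrite /u /rotating_wave /G.
    by rewrite (_ : x + 2 * pi - c * t = x - c * t + 2 * pi) ?pV//; ring.
  - move=> x; rewrite dotE /u /rotating_wave !row3E.
    have := nV (x - c * t); have := cos2Dsin2 (om * t).
    move: (cos _) (sin _) (V 0 ax0 _) (V 0 ax1 _) (V 0 ax2 _) => C S a b z CS ab.
    rewrite -[RHS]ab -[X in _ = X + _ + _]mul1r -[X in _ = _ + X + _]mul1r -CS.
    by ring.
split=> [//|k t _|t s].
- suff lim (j : 'I_k.+1) : l2prod (derive1n j (fun s => u tau s - u t s))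
      (derive1n j (fun s => u tau s - u t s)) @[tau --> t] --> (0 : R).
    have := @cvg_big R _ _ 0 xpredT (@add_continuous _) R (nbhs t)
      (index_enum 'I_k.+1) _ (fun=> 0) _ (fun j _ => lim j).
    by rewrite big1 => [h|//]; exact: h.
  under eq_fun do rewrite l2prod_dcoord.
  rewrite (_ : 0 = cint (fun x => 0 + 0 + 0 : R)); last first.
    by rewrite cint_cst !addr0 mulr0.
  have lim i : uniform_limit (nbhs t)
      (fun tau x => dcoord (fun s => u tau s - u t s) j i x ^+ 2) (fun=> 0).
    rewrite [X in uniform_limit _ X](_ : _ = fun tau x =>
      (dcoord (u tau) j i x - dcoord (u t) j i x) * (dcoord (u tau) j i x - dcoord (u t) j i x)).
      rewrite (_ : (fun=> 0) = fun x => (dcoord (u t) j i x - dcoord (u t) j i x)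
        * (dcoord (u t) j i x - dcoord (u t) j i x)); last first.
        by apply/funext => x; rewrite subrr mulr0.
      have l0 : uniform_limit (nbhs t)
        (fun tau x => dcoord (u tau) j i x - dcoord (u t) j i x)
        (fun x => dcoord (u t) j i x - dcoord (u t) j i x).
        apply: uniform_limitD; first exact: uniform_G.
        exact: uniform_limit_cst.
      by apply: (@uniform_limitM _ _ _ _ _ _ _ 0) => // x; rewrite subrr normr0.
    by apply/funext => tau; apply/funext => x; rewrite dcoordB// expr2.
  apply: uniform_limit_cint.
  + by move=> tau; apply: continuous_sqdcoord; exact: smoothB.
  + exact: cont_cst.
  + by apply: uniform_limitD; [apply: uniform_limitD|]; exact: lim.
- apply/row_derivP => i; rewrite smooth_cross//.
  apply: has_deriv_eq; first exact: (dGt 0).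
  have n1 : prod (ax0 + 1 = ax1) (prod (ax1 + 1 = ax2) (ax2 + 1 = ax0)).
    by rewrite !axE; do ![split]; exact: val_inj.
  have n2 : prod (ax0 + 2%:R = ax2) (prod (ax1 + 2%:R = ax0) (ax2 + 2%:R = ax1)).
    by rewrite !axE; do ![split]; exact: val_inj.
  rewrite /crossc /H; elim/ord3_ind: i; rewrite ?n1 ?n2 !dcoord_rotating_wave !row3E;
    have := ode0 (s - c * t); have := ode1 (s - c * t); have := ode2 (s - c * t);
    have := cos2Dsin2 (om * t);
    move: (cos _) (sin _) (V 0 ax0 _) (V 0 ax1 _) (V 0 ax2 _)
      (V 1 ax0 _) (V 1 ax1 _) (V 1 ax2 _) (V 2 ax0 _) (V 2 ax1 _) (V 2 ax2 _)
      => C S v0 v1 v2 p0 p1 p2 q0 q1 q2 CS e2 e1 e0.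
  + have := congr1 ( *%R C) e0; have := congr1 ( *%R S) e1; lra.
  + have := congr1 ( *%R S) e0; have := congr1 ( *%R C) e1; lra.
  + rewrite mulr0 addr0 -[LHS]mul1r -CS -e2; ring.
Qed.

End rotating_waves.

(** * Smoothness of functions in an algebra stable under derivation *)

Section derivation_closed.
Context {R : realType}.
Variable gen : (R -> R) -> Prop.

(* The algebra of functions generated by gen and the constants. *)
Inductive generated : (R -> R) -> Prop :=
| generated_cst c : generated (fun=> c)
| generated_gen f : gen f -> generated f
| generated_add f g : generated f -> generated g ->
    generated (fun x => f x + g x)
| generated_mul f g : generated f -> generated g ->
    generated (fun x => f x * g x).

Lemma generated_opp f : generated f -> generated (fun x => - f x).
Proof.
move=> gf; rewrite (_ : (fun x => - f x) = fun x => (fun=> -1) x * f x).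
  by apply: generated_mul => //; exact: generated_cst.
by apply/funext => x; rewrite mulN1r.
Qed.

Hypothesis gen_deriv : forall f, gen f ->
  exists2 f', generated f' & forall x : R, has_deriv f x (f' x).

Lemma generated_deriv f : generated f ->
  exists2 f', generated f' & forall x : R, has_deriv f x (f' x).
Proof.
elim=> {f} [c|f /gen_deriv//|f g gf [f' gf' df] gg [g' gg' dg]|
  f g gf [f' gf' df] gg [g' gg' dg]].
- by exists (fun=> 0); [exact: generated_cst | move=> x; exact: has_deriv_cst].
- exists (fun x => f' x + g' x); first exact: generated_add.
  by move=> x; exact: has_derivD.
- exists (fun x => f x * g' x + g x * f' x).
    by apply: (@generated_add (fun x => f x * g' x) (fun x => g x * f' x));
      exact: generated_mul.
  by move=> x; exact: has_derivM.
Qed.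

(** The derivative of an element is again an element, so the choice of a derivative can be iterated;
    no formula for higher derivatives is ever written. *)
Lemma generated_family f : generated f -> exists F : nat -> R -> R,
  F 0%N = f /\ forall j (x : R), has_deriv (F j) x (F j.+1 x).
Proof.
move=> gf; pose D (h : {h | generated h}) : {h | generated h} :=
  let h' := cid2 (generated_deriv (svalP h)) in exist _ (s2val h') (s2valP h').
exists (fun j => sval (iter j D (exist _ f gf))); split=> // j x.
by rewrite /= /D; case: cid2.
Qed.

End derivation_closed.

(** * The profile equation as a second-order system *)

Section profile.
Context {R : realType}.
Variables (v0 v1 v2 p0 p1 p2 : R -> R) (om c : R).
Let N x := p0 x * p0 x + p1 x * p1 x + p2 x * p2 x.
Hypotheses (d0 : forall x : R, has_deriv v0 x (p0 x))
  (d1 : forall x : R, has_deriv v1 x (p1 x))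
  (d2 : forall x : R, has_deriv v2 x (p2 x)).
Hypotheses
  (e0 : forall x : R, has_deriv p0 x (- N x * v0 x + om * v2 x * v0 x
     + c * (v1 x * p2 x + - (v2 x * p1 x))))
  (e1 : forall x : R, has_deriv p1 x (- N x * v1 x + om * v2 x * v1 x
     + c * (v2 x * p0 x + - (v0 x * p2 x))))
  (e2 : forall x : R, has_deriv p2 x (- N x * v2 x + om * (v2 x * v2 x + -1)
     + c * (v0 x * p1 x + - (v1 x * p0 x)))).
Hypothesis nV : forall x, v0 x ^+ 2 + v1 x ^+ 2 + v2 x ^+ 2 = 1.

Let gen (f : R -> R) :=
  [\/ f = v0, f = v1 | f = v2] \/ [\/ f = p0, f = p1 | f = p2].

Let gen_generated f : gen f -> generated gen f.
Proof. exact: generated_gen. Qed.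

Let gen_deriv f : gen f ->
  exists2 f', generated gen f' & forall x : R, has_deriv f x (f' x).
Proof.
have g0 : generated gen v0 by apply: gen_generated; left; constructor 1.
have g1 : generated gen v1 by apply: gen_generated; left; constructor 2.
have g2 : generated gen v2 by apply: gen_generated; left; constructor 3.
have h0 : generated gen p0 by apply: gen_generated; right; constructor 1.
have h1 : generated gen p1 by apply: gen_generated; right; constructor 2.
have h2 : generated gen p2 by apply: gen_generated; right; constructor 3.
have gM f' g' : generated gen f' -> generated gen g' ->
  generated gen (fun x => f' x * g' x) := @generated_mul _ gen f' g'.
have gD f' g' : generated gen f' -> generated gen g' ->
  generated gen (fun x => f' x + g' x) := @generated_add _ gen f' g'.
have gN f' : generated gen f' -> generated gen (fun x => - f' x) :=
  @generated_opp _ gen f'.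
have gc a : generated gen (fun=> a) := generated_cst gen a.
have gNN : generated gen (fun x => - N x).
  exact: (gN _ (gD _ _ (gD _ _ (gM _ _ h0 h0) (gM _ _ h1 h1)) (gM _ _ h2 h2))).
case=> -[] ->.
- by exists p0.
- by exists p1.
- by exists p2.
- eexists; last exact: e0.
  exact: (gD _ _ (gD _ _ (gM _ _ gNN g0) (gM _ _ (gM _ _ (gc om) g2) g0))
    (gM _ _ (gc c) (gD _ _ (gM _ _ g1 h2) (gN _ (gM _ _ g2 h1))))).
- eexists; last exact: e1.
  exact: (gD _ _ (gD _ _ (gM _ _ gNN g1) (gM _ _ (gM _ _ (gc om) g2) g1))
    (gM _ _ (gc c) (gD _ _ (gM _ _ g2 h0) (gN _ (gM _ _ g0 h2))))).
- eexists; last exact: e2.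
  exact: (gD _ _ (gD _ _ (gM _ _ gNN g2) (gM _ _ (gc om) (gD _ _ (gM _ _ g2 g2) (gc (-1)))))
    (gM _ _ (gc c) (gD _ _ (gM _ _ g0 h1) (gN _ (gM _ _ g1 h0))))).
Qed.

Let orthogonal x : v0 x * p0 x + v1 x * p1 x + v2 x * p2 x = 0.
Proof.
have d : has_deriv (fun y => v0 y ^+ 2 + v1 y ^+ 2 + v2 y ^+ 2) x
    (2 * (v0 x * p0 x + v1 x * p1 x + v2 x * p2 x)).
  by apply: has_deriv_eq; [repeat dstep | cbv beta; ring].
have d' : has_deriv (fun y => v0 y ^+ 2 + v1 y ^+ 2 + v2 y ^+ 2) x 0.
  rewrite [X in has_deriv X](_ : _ = fun=> 1); first exact: has_deriv_cst.
  by apply/funext => y; exact: nV.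
by have := has_deriv_unique d d'; lra.
Qed.

(** The hypotheses on [p0], [p1], [p2] are the profile equation multiplied by [V] on the sphere:
    [V'' = - |V'|^2 V - om e3 + om V3 V + c (V x V')]. This system is polynomial in [V] and [V'],
    whence derivatives of all orders. The profile equation is recovered from it by [|V| = 1],
    [V . V' = 0] and [V x (V x V') = (V . V') V - |V|^2 V']. *)
Lemma profile_family : exists V : nat -> 'I_3 -> R -> R,
  [/\ forall j i (x : R), has_deriv (V j i) x (V j.+1 i x),
      V 0 ax0 = v0 /\ V 0 ax1 = v1 /\ V 0 ax2 = v2,
      forall x, V 1 ax0 x = p0 x /\ V 1 ax1 x = p1 x /\ V 1 ax2 x = p2 x,
      forall x, V 0 ax1 x * V 2 ax2 x - V 0 ax2 x * V 2 ax1 x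
        = - om * V 0 ax1 x - c * V 1 ax0 x &
      (forall x, V 0 ax2 x * V 2 ax0 x - V 0 ax0 x * V 2 ax2 x
        = om * V 0 ax0 x - c * V 1 ax1 x) /\
      (forall x, V 0 ax0 x * V 2 ax1 x - V 0 ax1 x * V 2 ax0 x
        = - c * V 1 ax2 x)].
Proof.
have fam f : gen f -> exists F : nat -> R -> R,
    F 0%N = f /\ forall j (x : R), has_deriv (F j) x (F j.+1 x).
  by move=> gf; apply: (generated_family gen_deriv); exact: generated_gen.
have [F0 [F00 dF0]] : exists F : nat -> R -> R,
  F 0%N = v0 /\ forall j (x : R), has_deriv (F j) x (F j.+1 x).
  by apply: fam; left; constructor 1.
have [F1 [F10 dF1]] : exists F : nat -> R -> R,
  F 0%N = v1 /\ forall j (x : R), has_deriv (F j) x (F j.+1 x).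
  by apply: fam; left; constructor 2.
have [F2 [F20 dF2]] : exists F : nat -> R -> R,
  F 0%N = v2 /\ forall j (x : R), has_deriv (F j) x (F j.+1 x).
  by apply: fam; left; constructor 3.
have next F v p : F 0%N = v -> (forall j (x : R), has_deriv (F j) x (F j.+1 x)) ->
    (forall x : R, has_deriv v x (p x)) -> F 1%N = p.
  move=> Fv dF dv; apply/funext => x; apply: has_deriv_unique (dv x).
  by rewrite -Fv; exact: dF.
have F01 := next _ _ _ F00 dF0 d0; have F02 x := has_deriv_unique (dF0 1%N x).
have F11 := next _ _ _ F10 dF1 d1; have F12 x := has_deriv_unique (dF1 1%N x).
have F21 := next _ _ _ F20 dF2 d2; have F22 x := has_deriv_unique (dF2 1%N x).
rewrite F01 in F02; rewrite F11 in F12; rewrite F21 in F22.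
pose V (j : nat) (i : 'I_3) : R -> R :=
  if i == ax0 then F0 j else if i == ax1 then F1 j else F2 j.
have V0 j : V j ax0 = F0 j by rewrite /V eqxx.
have V1 j : V j ax1 = F1 j by rewrite /V !axE.
have V2 j : V j ax2 = F2 j by rewrite /V !axE.
exists V; split.
- by move=> j i x; elim/ord3_ind: i; rewrite !(V0, V1, V2).
- by rewrite !(V0, V1, V2).
- by move=> x; rewrite !(V0, V1, V2) F01 F11 F21.
- move=> x; rewrite !(V0, V1, V2) ?(F00, F10, F20) F01 (F12 _ _ (e1 x)) (F22 _ _ (e2 x)).
  have := congr1 ( *%R (c * v0 x)) (orthogonal x).
  have := congr1 ( *%R (c * p0 x)) (nV x); rewrite /N; lra.
- split=> x; rewrite !(V0, V1, V2) ?(F00, F10, F20) ?(F11, F21) (F02 _ _ (e0 x)).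
    rewrite (F22 _ _ (e2 x)).
    have := congr1 ( *%R (c * v1 x)) (orthogonal x).
    have := congr1 ( *%R (c * p1 x)) (nV x); rewrite /N; lra.
  rewrite (F12 _ _ (e1 x)).
  have := congr1 ( *%R (c * v2 x)) (orthogonal x).
  have := congr1 ( *%R (c * p2 x)) (nV x); rewrite /N; lra.
Qed.

End profile.

(** * Profiles in terms of height and azimuth *)

Section spherical_coordinates.
Context {R : realType}.
Variables (z y J phi : R -> R) (om c : R).
Let rho x := (1 - z x * z x)^-1.
Hypothesis z1 : forall x, z x ^+ 2 < 1.
Hypotheses (dz : forall x : R, has_deriv z x (y x))
  (dJ : forall x : R, has_deriv J x (- c * y x))
  (dphi : forall x : R, has_deriv phi x (J x * rho x))
  (dy : forall x : R, has_deriv y x (- ((y x ^+ 2 + J x ^+ 2) * rho x) * z x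
     - om * (1 - z x * z x) + c * J x)).
Hypotheses (pz : forall x, z (x + 2 * pi) = z x)
  (pphi : forall x, phi (x + 2 * pi) = phi x + 2 * pi).

Definition wave_v0 x := Num.sqrt (1 - z x * z x) * cos (phi x).
Definition wave_v1 x := Num.sqrt (1 - z x * z x) * sin (phi x).
Definition wave_p0 x := (- (z x * y x * wave_v0 x) - J x * wave_v1 x) * rho x.
Definition wave_p1 x := (- (z x * y x * wave_v1 x) + J x * wave_v0 x) * rho x.

Let q0 x : 0 < 1 - z x * z x.
Proof. by rewrite subr_gt0 -expr2. Qed.

Let q0' x : 1 - z x * z x != 0.
Proof. by rewrite gt_eqF. Qed.

Let drho (x : R) : has_deriv rho x (2 * z x * y x * rho x ^+ 2).
Proof.
apply: has_deriv_eq; first by apply: has_derivV => //; repeat dstep.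
by cbv beta; rewrite exprVn; field.
Qed.

Let dr (x : R) : has_deriv (fun x => Num.sqrt (1 - z x * z x)) x
  (- (z x * y x * Num.sqrt (1 - z x * z x)) * rho x).
Proof.
apply: has_deriv_eq; first by apply: has_deriv_sqrt => //; repeat dstep.
cbv beta; have s0 : Num.sqrt (1 - z x * z x) != 0.
  by rewrite gt_eqF// sqrtr_gt0.
rewrite /rho -[X in _ = _ * X^-1](sqr_sqrtr (ltW (q0 x))).
by field.
Qed.

Let dv0 (x : R) : has_deriv wave_v0 x (wave_p0 x).
Proof.
apply: has_deriv_eq; first by apply: has_derivM; [exact: dr | repeat dstep].
by cbv beta; rewrite /wave_p0 /wave_v0 /wave_v1; ring.
Qed.

Let dv1 (x : R) : has_deriv wave_v1 x (wave_p1 x).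
Proof.
apply: has_deriv_eq; first by apply: has_derivM; [exact: dr | repeat dstep].
by cbv beta; rewrite /wave_p1 /wave_v0 /wave_v1; ring.
Qed.

Let norm01 x : wave_v0 x ^+ 2 + wave_v1 x ^+ 2 = 1 - z x * z x.
Proof.
rewrite /wave_v0 /wave_v1 !exprMn -mulrDr cos2Dsin2 mulr1 sqr_sqrtr//.
exact/ltW.
Qed.

Lemma wave_norm x : wave_v0 x ^+ 2 + wave_v1 x ^+ 2 + z x ^+ 2 = 1.
Proof. by rewrite norm01; ring. Qed.

Lemma wave_speed x :
  wave_p0 x * wave_p0 x + wave_p1 x * wave_p1 x + y x * y x
  = (y x ^+ 2 + J x ^+ 2) * rho x.
Proof.
transitivity ((z x ^+ 2 * y x ^+ 2 + J x ^+ 2) * rho x ^+ 2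
  * (wave_v0 x ^+ 2 + wave_v1 x ^+ 2) + y x * y x).
  by rewrite /wave_p0 /wave_p1; ring.
by rewrite norm01 /rho; field.
Qed.

(** [J] is the third component of [V x V'], that is [(1 - z^2) phi'], so [dJ] is the third component
    of the profile equation; [dy] is that of the system solved for [V'']. The azimuth has to gain
    exactly one turn per period, as the equator does. *)
Lemma spherical_wave : exists V : nat -> 'I_3 -> R -> R,
  [/\ is_solution (rotating_wave V om c),
      V 0 ax0 = wave_v0 /\ V 0 ax1 = wave_v1 /\ V 0 ax2 = z,
      forall x, V 1 ax0 x = wave_p0 x /\ V 1 ax1 x = wave_p1 x /\ V 1 ax2 x = y x,
      forall j i (x : R), has_deriv (V j i) x (V j.+1 i x) &
      forall i x, V 0 i (x + 2 * pi) = V 0 i x].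
Proof.
have [] := @profile_family _ wave_v0 wave_v1 z wave_p0 wave_p1 y om c dv0 dv1 dz.
- move=> x; apply: has_deriv_eq; first by apply: has_derivM; [|exact: drho]; repeat dstep.
  cbv beta; rewrite wave_speed /wave_p0 /wave_p1 /rho.
  move: (q0' x) (wave_v0 x) (wave_v1 x) => q1 a b; by field.
- move=> x; apply: has_deriv_eq; first by apply: has_derivM; [|exact: drho]; repeat dstep.
  cbv beta; rewrite wave_speed /wave_p0 /wave_p1 /rho.
  move: (q0' x) (wave_v0 x) (wave_v1 x) => q1 a b; by field.
- move=> x; apply: has_deriv_eq; first exact: dy.
  rewrite wave_speed.
  have -> : wave_v0 x * wave_p1 x + - (wave_v1 x * wave_p0 x)
     = J x * rho x * (wave_v0 x ^+ 2 + wave_v1 x ^+ 2).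
    by rewrite /wave_p0 /wave_p1; ring.
  by rewrite norm01 /rho; field.
- exact: wave_norm.
move=> V [dV [V0 [V1 V2]] VP m0 [m1 m2]].
have pV i x : V 0 i (x + 2 * pi) = V 0 i x.
  have e : phi (x + 2 * pi) = phi x + pi *+ 2 by rewrite pphi mulr_natl.
  elim/ord3_ind: i; rewrite ?(V0, V1, V2)// /wave_v0 /wave_v1 pz e.
    by rewrite cosD2pi.
  by rewrite sinD2pi.
exists V; split=> //; apply: rotating_wave_solution => //.
by move=> x; rewrite V0 V1 V2 wave_norm.
Qed.

End spherical_coordinates.

(** * The quadrature *)

Section quadrature.
Context {R : realType}.
Variable B : R.
Hypotheses (B0 : 0 <= B) (B2 : B <= 1 / 2).

Let beta := Num.sqrt (1 - B ^+ 2).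

Let Bsqr : B ^+ 2 <= 1 / 4.
Proof.
have : B * B <= 1 / 2 * (1 / 2) by apply: ler_pM.
by rewrite expr2; lra.
Qed.

Let beta2 : beta ^+ 2 = 1 - B ^+ 2.
Proof. by rewrite sqr_sqrtr//; have := Bsqr; lra. Qed.

(** From [B <= 1 / 2], [beta^2] is at least 3/4, which exceeds 16/25. *)
Lemma beta_bounds : 4 / 5 <= beta <= 1.
Proof.
have b0 : 0 <= beta by exact: sqrtr_ge0.
have B4 := Bsqr; have Bp := sqr_ge0 B; have b2 := beta2.
by apply/andP; split; rewrite leNgt; apply/negP => h; nra.
Qed.

Let sin2 (x : R) : sin x ^+ 2 <= 1.
Proof. by have := cos2Dsin2 x; have := sqr_ge0 (cos x); lra. Qed.

(** This is [1 - z^2] at phase [x], the squared distance to the axis of rotation. *)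
Definition gap (x : R) : R := 1 - B * sin x * (B * sin x).

Lemma gap_bounds x : 3 / 4 <= gap x <= 1.
Proof.
have s2 := sin2 x; rewrite /gap (_ : B * sin x * (B * sin x) = B ^+ 2 * sin x ^+ 2); last by ring.
have : 0 <= B ^+ 2 * sin x ^+ 2 by rewrite mulr_ge0// sqr_ge0.
have : B ^+ 2 * sin x ^+ 2 <= 1 / 4 * 1.
  by apply: ler_pM => //; exact: sqr_ge0.
by lra.
Qed.

(** The remaining factor of the cubic: [z'^2 = n^2 (B^2 - z^2) (1 + k^2 - 2 k eps z)], where
    [eps z = B sin psi]. *)
Definition slope2 (k x : R) : R := 1 + k * k - 2 * k * (B * sin x).

Lemma slope2_ge k x : gap x <= slope2 k x.
Proof.
rewrite -subr_ge0.
rewrite (_ : _ - _ = (k - B * sin x) ^+ 2) ?sqr_ge0// /slope2 /gap; ring.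
Qed.

Let slope2_gt0 k x : 0 < slope2 k x.
Proof. by have := slope2_ge k x; have := gap_bounds x; lra. Qed.

(* psi' = n * slope and, for the azimuth, dphi/dpsi = azimuth. *)
Definition slope k x := Num.sqrt (slope2 k x).

Lemma slope_gt0 k x : 0 < slope k x.
Proof. by rewrite sqrtr_gt0. Qed.

Lemma slope_sqr k x : slope k x ^+ 2 = slope2 k x.
Proof. by rewrite sqr_sqrtr// ltW. Qed.

Definition azimuth k x : R := beta * (k - B * sin x) * (gap x)^-1 * (slope k x)^-1.

(* The derivative with respect to k is explicit because
   slope^2 - (k - B sin x)^2 = gap. *)
Lemma azimuth_deriv x (k : R) :
  has_deriv (fun k => azimuth k x) k (beta * (slope k x)^-1 ^+ 3).
Proof.
have s0 : slope k x != 0 by rewrite gt_eqF// slope_gt0.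
have g0 : gap x != 0 by rewrite gt_eqF//; have := gap_bounds x; lra.
have ds : has_deriv (fun k => slope k x) k ((k - B * sin x) * (slope k x)^-1).
  apply: has_deriv_eq; first by
    apply: has_deriv_sqrt; [exact: slope2_gt0 | rewrite /slope2; repeat dstep].
  by cbv beta; rewrite -/(slope k x); field.
apply: has_deriv_eq; first by
  apply: has_derivM; [repeat dstep | apply: has_derivV; [exact: s0 | exact: ds]].
cbv beta; move: g0.
have -> : gap x = slope k x ^+ 2 - (k - B * sin x) ^+ 2.
  by rewrite slope_sqr /slope2 /gap; ring.
move: (slope k x) s0 => s s0 g0.
by field; rewrite s0.
Qed.

(** [slope^2] is at least [gap], hence at least 3/4, which exceeds 25/36. *)
Let inv_slope_le k x : (slope k x)^-1 <= 6 / 5.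
Proof.
have s0 := slope_gt0 k x; rewrite -[leLHS]div1r ler_pdivrMr//.
rewrite leNgt; apply/negP => h.
have := slope_sqr k x; have := slope2_ge k x; have := gap_bounds x; nra.
Qed.

Let inv_slope_ge0 k x : 0 <= (slope k x)^-1.
Proof. by rewrite invr_ge0 ltW// slope_gt0. Qed.

(** For [k >= 0] it bounds [|slope^2 - 1|]. With [k] of order [1/N] and [B] of order [N^(-1/2)] it
    is of order [N^(-3/2)], which is still small after multiplication by [N]. *)
Definition defect k := k ^+ 2 + 2 * k * B.

Lemma inv_slope_near1 (k x : R) : 0 <= k -> `|(slope k x)^-1 - 1| <= defect k.
Proof.
move=> k0; have s0 := slope_gt0 k x; have s2 := slope_sqr k x.
have sh : 5 / 6 <= slope k x.
  rewrite leNgt; apply/negP => h.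
  by have := slope2_ge k x; have := gap_bounds x; nra.
have d0 : 0 <= defect k by rewrite addr_ge0 ?sqr_ge0// !mulr_ge0.
have e : `|slope k x ^+ 2 - 1| <= defect k.
  have := sin_max x; rewrite ler_norml => /andP[m1 m2].
  have kB : 0 <= k * B by rewrite mulr_ge0.
  rewrite s2 /slope2 /defect ler_norml; apply/andP; split; nra.
have -> : (slope k x)^-1 - 1 = - (slope k x ^+ 2 - 1) * ((slope k x)^-1 * (slope k x + 1)^-1).
  by field; rewrite !gt_eqF//; lra.
rewrite normrM normrN -[leRHS]mulr1; apply: ler_pM => //.
rewrite -invfM ger0_norm ?invr_ge0; last by rewrite mulr_ge0//; lra.
by rewrite invf_le1 ?mulr_gt0//; nra.
Qed.

Lemma inv_slope3_near1 (k x : R) : 0 <= k -> `|(slope k x)^-1 ^+ 3 - 1| <= 5 * defect k.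
Proof.
move=> k0; have := inv_slope_near1 x k0; have := inv_slope_le k x.
have := inv_slope_ge0 k x; move: (slope k x)^-1 => h h0 h1 hd.
rewrite (_ : _ - 1 = (h ^+ 2 + h + 1) * (h - 1)); last by ring.
by rewrite normrM; apply: ler_pM => //; rewrite ger0_norm; nra.
Qed.

Let azimuth_increment k k' x :
  `|azimuth k x - azimuth k' x| <= 2 * `|k - k'|.
Proof.
apply: (lipschitz_of_derive (fun k => azimuth_deriv x k)) => l.
have /andP[b1 b2] := beta_bounds.
have h0 := inv_slope_ge0 l x; have h1 := inv_slope_le l x.
rewrite ger0_norm; last by rewrite mulr_ge0 ?exprn_ge0//; lra.
have : (slope l x)^-1 ^+ 3 <= (6 / 5) ^+ 3 by rewrite lerXn2r// nnegrE; lra.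
have : 0 <= (slope l x)^-1 ^+ 3 by rewrite exprn_ge0.
move: ((slope l x)^-1 ^+ 3) => h; nra.
Qed.

(** By the mean value theorem in [k]: the derivative of [azimuth] is [beta * slope^(-3)], which
    differs from [beta] by at most [5 * beta * defect]. *)
Lemma azimuth_near (k x : R) : 0 <= k ->
  `|azimuth k x - azimuth 0 x - beta * k| <= 5 * k * defect k.
Proof.
move=> k0; have [l] := mvt 0 k (azimuth_deriv x).
rewrite minEle maxEle k0 subr0 => /andP[l0 lk] ->.
rewrite (_ : _ - _ = (beta * k) * ((slope l x)^-1 ^+ 3 - 1)); last by ring.
have /andP[b1 b2] := beta_bounds.
rewrite normrM ger0_norm; last by rewrite mulr_ge0//; lra.
have dl : defect l <= defect k.
  by rewrite /defect lerD ?lerXn2r ?nnegrE// ler_wpM2r// ler_wpM2l.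
have := inv_slope3_near1 x l0.
have : 0 <= defect l by rewrite addr_ge0 ?sqr_ge0// !mulr_ge0.
have : 0 <= beta * k by rewrite mulr_ge0//; lra.
have : beta * k <= k by nra.
move: (beta * k) `|_| => bk u; nra.
Qed.

Lemma azimuth_bound (k x : R) : `|azimuth k x| <= 2 * (`|k| + B).
Proof.
have /andP[b1 b2] := beta_bounds; have /andP[g1 g2] := gap_bounds x.
have g0 : 0 < gap x by lra.
rewrite !normrM.
have h1 : `|beta| <= 1 by rewrite ger0_norm//; lra.
have h2 : `|k - B * sin x| <= `|k| + B.
  apply: le_trans (ler_normB _ _) _; rewrite lerD2l normrM (ger0_norm B0).
  by rewrite ler_piMr// sin_max.
have h3 : `|(gap x)^-1| <= 4 / 3.
  rewrite ger0_norm ?invr_ge0 ?(ltW g0)// -[leLHS]div1r ler_pdivrMr//; lra.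
have h4 : `|(slope k x)^-1| <= 6 / 5 by rewrite ger0_norm.
apply: (@le_trans _ _ (1 * (`|k| + B) * (4 / 3) * (6 / 5))).
  by do 3?[apply: ler_pM => //; rewrite ?mulr_ge0//].
have k0 := normr_ge0 k; have b0 := B0; lra.
Qed.

Lemma continuous_slope k : continuous (fun x => (slope k x)^-1).
Proof.
apply: contV => [x|x]; last by rewrite gt_eqF// slope_gt0.
move: x; apply: (cont_comp (f := Num.sqrt)); first exact: sqrt_continuous.
have cs : continuous (@sin R) by exact: continuous_sin.
by rewrite /slope2; repeat cstep.
Qed.

Lemma continuous_azimuth k : continuous (azimuth k).
Proof.
have cs : continuous (@sin R) by exact: continuous_sin.
apply: contM; last exact: continuous_slope.
apply: contM; first by repeat cstep.
apply: contV => [|x]; first by rewrite /gap; repeat cstep.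
by rewrite gt_eqF//; have := gap_bounds x; lra.
Qed.

(** For a primitive [F], the function [F (2 pi - y) - F y] has zero derivative and vanishes at
    [y = pi]; its value at 0 is the integral. *)
Lemma cint_antisymmetric (f : R -> R) : continuous f ->
  (forall x, f (2 * pi - x) = - f x) -> cint f = 0.
Proof.
move=> cf of_; have [F dF] := has_primitive cf.
rewrite (cint_FTC cf dF).
have d (z : R) : has_deriv (fun y => F (2 * pi - y) - F y) z 0.
  apply: has_deriv_eq; first apply: has_derivD; first (apply: (@has_deriv_comp _ F); [exact: dF|]).
  - by repeat dstep.
  - by repeat dstep.
  - by cbv beta; rewrite of_; ring.
have := is_derive_0_is_cst 0 pi d.
by rewrite subr0 => ->; rewrite (_ : 2 * pi - pi = pi) ?subrr//; ring.
Qed.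

Lemma cint_azimuth0 : cint (azimuth 0) = 0.
Proof.
apply: cint_antisymmetric => [|x]; first exact: continuous_azimuth.
have e : sin (2 * pi - x) = - sin x.
  by rewrite addrC (_ : 2 * pi = pi *+ 2) ?mulr_natl// sinD2pi sinN.
have sE y : azimuth 0 y = beta * (- (B * sin y)) * (gap y)^-1.
  rewrite /azimuth /slope /slope2 (_ : 1 + _ - _ = 1); last by ring.
  by rewrite sqrtr1 invr1; ring.
rewrite !sE (_ : gap (2 * pi - x) = gap x) ?e; first by ring.
by rewrite /gap e; ring.
Qed.

Lemma cint_azimuth_near (k : R) : 0 <= k ->
  `|cint (azimuth k) - 2 * pi * (beta * k)| <= 2 * pi * (5 * k * defect k).
Proof.
move=> k0; have ck := @continuous_azimuth k; have c0 := @continuous_azimuth 0.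
rewrite -[cint _]subr0 -cint_azimuth0 -(cint_cst (beta * k)) -!cintB//; last 2 first.
- by repeat cstep.
- exact: cont_cst.
apply: cint_bound; first by repeat cstep.
by move=> x; exact: azimuth_near.
Qed.

(** The intermediate value theorem applies on [[0, 2/N]]: the increase of the azimuth is 0 at
    [k = 0], by symmetry, and at [k = 2/N] it is at least [2 pi / N] times [2 beta - 10 defect],
    which is more than 1. The last bound is [cint_azimuth_near] multiplied by [N], with
    [k N <= 2]. *)
Lemma holonomy (N : R) : 1000 <= N -> exists k : R,
  [/\ 0 <= k <= 2 / N, cint (azimuth k) = 2 * pi / N &
      `|beta * k * N - 1| <= 10 * defect k].
Proof.
move=> N1; have N0 : 0 < N by lra.
have /andP[b1 b2] := beta_bounds.
have P0 := @twopi_gt0 R.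
have cF : continuous (fun k => cint (azimuth k)).
  move=> k; apply/cvgrPdist_le => e e0.
  near=> l; rewrite -cintB; [|exact: continuous_azimuth..].
  apply: le_trans (cint_bound (K := 2 * `|k - l|) _ _) _.
  - by apply: contD; [|apply: contN]; exact: continuous_azimuth.
  - by move=> x; exact: azimuth_increment.
  - rewrite mulrCA -ler_pdivlMl// -ler_pdivlMl//.
    by near: l; apply: cvgr_dist_le => //; rewrite !mulr_gt0 ?invr_gt0.
have iN : 0 < N^-1 <= 1 / 1000.
  by rewrite invr_gt0 N0/= -[leLHS]div1r ler_pdivrMr//; lra.
have d2 : defect (2 / N) <= 1 / 100.
  rewrite /defect; move: iN => /andP[i0 i1]; have b0 := B0; have b2' := B2.
  have : (2 / N) * B <= 2 / 1000 * (1 / 2) by apply: ler_pM; lra.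
  have : (2 / N) * (2 / N) <= 2 / 1000 * (2 / 1000) by apply: ler_pM; lra.
  by rewrite expr2 -mulrA; lra.
have N2 : 0 <= 2 / N by rewrite divr_ge0// ltW.
have F2 : 2 * pi / N <= cint (azimuth (2 / N)).
  have := cint_azimuth_near N2; rewrite ler_norml => /andP[+ _].
  suff : 2 * pi * N^-1 <= 2 * pi * (beta * (2 / N) - 5 * (2 / N) * defect (2 / N)) by lra.
  rewrite ler_pM2l// -[leLHS]mul1r.
  rewrite (_ : _ - _ = (2 * beta - 10 * defect (2 / N)) * N^-1); last by ring.
  by rewrite ler_wpM2r; lra.
have [|k] := IVT N2 (continuous_subspaceT cF) (v := 2 * pi / N).
  have h0 : 0 <= 2 * pi / N by rewrite divr_ge0// ltW.
  rewrite cint_azimuth0 minEle maxEle (le_trans h0 F2) h0 F2//.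
rewrite in_itv/= => /andP[k0 k2] kE.
exists k; split=> //; first by rewrite k0.
have := cint_azimuth_near k0; rewrite kE.
rewrite (_ : _ - _ = - (2 * pi * (N^-1 * (beta * k * N - 1)))); last first.
  by field; rewrite gt_eqF.
rewrite normrN normrM (ger0_norm (ltW P0)) ler_pM2l// normrM gtr0_norm ?invr_gt0//.
rewrite mulrC ler_pdivrMr// => /le_trans; apply.
have dk : 0 <= defect k by rewrite addr_ge0 ?sqr_ge0// !mulr_ge0.
have kN : k * N <= 2 by rewrite -ler_pdivlMr.
nra.
Unshelve. all: by end_near. Qed.

End quadrature.

(** * Inverses and shifts of primitives *)

Section inverse_primitive.
Context {R : realType}.

Lemma primitive_inverse (G g : R -> R) (m : R) : 0 < m ->
  (forall x : R, has_deriv G x (g x)) -> (forall x, m <= g x) ->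
  exists psi : R -> R, [/\ cancel G psi, cancel psi G &
    forall s : R, has_deriv psi s (g (psi s))^-1].
Proof.
move=> m0 dG gm; have cG := derive_continuous dG.
have g0 x : 0 < g x := lt_le_trans m0 (gm x).
have Gm x y : x <= y -> m * (y - x) <= G y - G x.
  move=> xy; have [c _ ->] := mvt x y dG.
  by rewrite ler_wpM2r// subr_ge0.
have surj s : exists x, G x = s.
  (* Growing at rate at least [m], [G] has passed [s] at this distance from 0. *)
  pose a := `|s - G 0| / m.
  have a0 : 0 <= a by rewrite divr_ge0// ltW.
  have ma : m * a = `|s - G 0| by rewrite mulrC divfK// gt_eqF.
  have h1 := Gm _ _ a0; have h2 : m * (0 - - a) <= G 0 - G (- a) by apply: Gm; lra.
  have n1 := ler_norm (s - G 0); have n2 := ler_norm (- (s - G 0)).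
  rewrite normrN in n2.
  have aa : - a <= a by lra.
  have [|x _ xs] := IVT aa (continuous_subspaceT cG) (v := s); last by exists x.
  rewrite subr0 ma in h1; rewrite sub0r opprK ma in h2.
  have : G (- a) <= s by lra.
  have : s <= G a by lra.
  by move=> h3 h4; rewrite ge_min h4 le_max h3 orbT.
have /choice[psi psiP] := surj; exists psi.
have Ginj x y : G x = G y -> x = y.
  move=> e; apply/eqP; rewrite eq_le; apply/andP; split; rewrite leNgt; apply/negP.
    by move=> /(derive_gt0_homo dG g0); rewrite e ltxx.
  by move=> /(derive_gt0_homo dG g0); rewrite e ltxx.
have GK : cancel G psi by move=> x; apply: Ginj; rewrite psiP.
split=> // s; rewrite -{1}(psiP s); apply: is_derive_inverse.
- by near=> x; exact: GK.
- by near=> x; exact: cG.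
- exact: dG.
- by rewrite gt_eqF.
Unshelve. all: by end_near. Qed.

Lemma primitive_shift (f F : R -> R) : continuous f ->
  (forall x, f (x + 2 * pi) = f x) -> (forall x : R, has_deriv F x (f x)) ->
  forall x, F (x + 2 * pi) = F x + cint f.
Proof.
move=> cf pf dF x.
have d (z : R) : has_deriv (fun y => F (y + 2 * pi) - F y) z 0.
  apply: has_deriv_eq; first apply: has_derivD; first (apply: (@has_deriv_comp _ F); [exact: dF|]).
  - by repeat dstep.
  - by repeat dstep.
  - by cbv beta; rewrite pf; ring.
have := is_derive_0_is_cst x 0 d; rewrite add0r (cint_FTC cf dF) => <-.
by rewrite addrCA subrr addr0.
Qed.

Lemma cos_lipschitz (x y : R) : `|cos x - cos y| <= `|x - y|.
Proof.
rewrite -[leRHS]mul1r; apply: (@lipschitz_of_derive _ cos (fun x => - sin x)).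
  by move=> z; exact: is_derive_cos.
by move=> z; rewrite normrN; exact: sin_max.
Qed.

Lemma sin_lipschitz (x y : R) : `|sin x - sin y| <= `|x - y|.
Proof.
rewrite -[leRHS]mul1r; apply: (@lipschitz_of_derive _ sin cos).
  by move=> z; exact: is_derive_sin.
by move=> z; exact: cos_max.
Qed.

End inverse_primitive.

(** * The waves with [N] windings *)

Section kida_wave.
Context {R : realType}.
Variables (B k eps : R) (N : nat).
Hypotheses (B0 : 0 <= B) (B2 : B <= 1 / 2) (eps2 : eps * eps = 1).
Hypotheses (N1 : 1000 <= N%:R :> R) (k0 : 0 <= k) (kN : k <= 2 / N%:R).
Hypothesis holo : cint (azimuth B k) = 2 * pi / N%:R.

Let beta := Num.sqrt (1 - B ^+ 2).

(** The value of [n] for which one period of the phase, of length the integral of [1 / (n slope)],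
    takes [2 pi / N] in [s]. *)
Definition frequency : R := N%:R / (2 * pi) * cint (fun x => (slope B k x)^-1).

Let n := frequency.

Let N0 : 0 < N%:R :> R. Proof. by have := N1; lra. Qed.

Let pi_neq0 : pi != 0 :> R. Proof. by rewrite gt_eqF// pi_gt0. Qed.
Let Nneq0 : N%:R != 0 :> R. Proof. by rewrite gt_eqF. Qed.

Let defect_small : defect B k <= 1 / 100.
Proof.
have b0 := B0; have b2 := B2; have k0' := k0; have kN' := kN; have N0' := N0; have N1' := N1.
have /andP[i0 i1] : 0 < (N%:R : R)^-1 <= 1 / 1000.
  by rewrite invr_gt0 N0/= -[leLHS]div1r ler_pdivrMr//; lra.
have : k <= 2 / 1000 by lra.
have : k * B <= 2 / 1000 * (1 / 2) by apply: ler_pM => //; lra.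
have : k * k <= 2 / 1000 * (2 / 1000) by apply: ler_pM => //; lra.
by rewrite /defect expr2 -mulrA; lra.
Qed.

Lemma frequency_near : `|n / N%:R - 1| <= defect B k.
Proof.
have P0 := @twopi_gt0 R.
have cs : continuous (fun x => (slope B k x)^-1) by exact: continuous_slope.
have -> : n / N%:R - 1 = (2 * pi)^-1 * cint (fun x => (slope B k x)^-1 - 1).
  rewrite cintB//; last exact: cont_cst.
  rewrite cint_cst /n /frequency; move: pi pi_neq0 => p p0.
  by field; rewrite p0 Nneq0.
rewrite normrM gtr0_norm ?invr_gt0// mulrC ler_pdivrMr// mulrC.
apply: cint_bound; first by repeat cstep.
by move=> x; exact: inv_slope_near1.
Qed.

Let n_bounds : 99 / 100 * N%:R <= n <= 101 / 100 * N%:R.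
Proof.
have := frequency_near; rewrite ler_norml => /andP[h1 h2].
have b0 := B0; have b2 := B2; have k0' := k0; have kN' := kN; have N0' := N0; have N1' := N1.
have e : n = n / N%:R * N%:R by rewrite divfK// gt_eqF.
have d := defect_small.
by apply/andP; split; rewrite e ler_wpM2r// ?(ltW N0)//; lra.
Qed.

Let n0 : 0 < n. Proof. by have /andP[] := n_bounds; have := N0; lra. Qed.

Let inv_slope_bounds x : 99 / 100 <= (slope B k x)^-1 <= 101 / 100.
Proof.
have b0 := B0; have b2 := B2; have k0' := k0; have kN' := kN; have N0' := N0; have N1' := N1.
have := inv_slope_near1 B0 B2 x k0; rewrite ler_norml => /andP[h1 h2].
by have d := defect_small; apply/andP; split; lra.
Qed.

(** [G] expresses [s] by the phase, so that [psi] is its inverse, and [F] expresses the azimuth by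
    the phase. Both gain [2 pi / N] over a period of the phase. Hence [F - G] is periodic, and
    [phi s - s], its value at [psi s], accumulates no error over the [N] windings. *)
Lemma kida_phase : exists psi phi : R -> R,
  [/\ forall s : R, has_deriv psi s (n * slope B k (psi s)),
      forall s : R, has_deriv phi s (n * beta * (k - B * sin (psi s)) * (gap B (psi s))^-1),
      forall s, psi (s + 2 * pi / N%:R) = psi s + 2 * pi,
      forall s, phi (s + 2 * pi) = phi s + 2 * pi &
      forall s, `|phi s - s| <= 2 * pi * (8 / N%:R + 2 * B)].
Proof.
have b0 := B0; have b2 := B2; have k0' := k0; have kN' := kN; have N0' := N0; have N1' := N1.
have P0 := @twopi_gt0 R.
have cs := @continuous_slope R B B0 B2 k; have ca := @continuous_azimuth R B B0 B2 k.
pose g x := n^-1 * (slope B k x)^-1.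
have cg : continuous g by rewrite /g; repeat cstep.
have [G1 dG1] := has_primitive cg; have [F1 dF1] := has_primitive ca.
pose G x := G1 x - G1 0; pose F x := F1 x - F1 0.
have dG (x : R) : has_deriv G x (g x).
  by apply: has_deriv_eq; [rewrite /G; repeat dstep | rewrite addr0].
have dF (x : R) : has_deriv F x (azimuth B k x).
  by apply: has_deriv_eq; [rewrite /F; repeat dstep | rewrite addr0].
have sin2pi_ x : sin (x + 2 * pi) = sin x.
  by rewrite (_ : 2 * pi = pi *+ 2) ?mulr_natl// sinD2pi.
have ps x : slope B k (x + 2 * pi) = slope B k x by rewrite /slope /slope2 sin2pi_.
have pa x : azimuth B k (x + 2 * pi) = azimuth B k x.
  by rewrite /azimuth ps /gap sin2pi_.
have Gs x : G (x + 2 * pi) = G x + 2 * pi / N%:R.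
  rewrite (primitive_shift cg _ dG); last by move=> y; rewrite /g ps.
  rewrite /g cintZ// /n /frequency.
  have I0 : cint (fun x => (slope B k x)^-1) != 0.
    apply: contraTneq n0 => e; by rewrite /n /frequency e mulr0 ltxx.
  congr (_ + _); move: pi pi_neq0 I0 => p p0; move: (cint _) => I I0.
  by field; rewrite I0 p0 Nneq0.
have Fs x : F (x + 2 * pi) = F x + 2 * pi / N%:R.
  by rewrite (primitive_shift ca pa dF) holo.
have m0 : 0 < n^-1 * (99 / 100) by rewrite mulr_gt0 ?invr_gt0//; lra.
have gm x : n^-1 * (99 / 100) <= g x.
  by rewrite ler_wpM2l ?invr_ge0 ?(ltW n0)//; have /andP[] := inv_slope_bounds x.
have [psi [GK psiK dpsi]] := primitive_inverse m0 dG gm.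
have s0 x : slope B k x != 0 by rewrite gt_eqF// slope_gt0.
have dpsi' (s : R) : has_deriv psi s (n * slope B k (psi s)).
  by apply: has_deriv_eq; [exact: dpsi | rewrite /g invfM !invrK].
have psis s : psi (s + 2 * pi / N%:R) = psi s + 2 * pi.
  by apply: (can_inj GK); rewrite Gs !psiK.
have HH s : F (psi s) - s = F (psi s) - G (psi s) by rewrite psiK.
have pH s : F (psi (s + 2 * pi / N%:R)) - (s + 2 * pi / N%:R) = F (psi s) - s.
  by rewrite psis Fs; ring.
exists psi, (fun s => F (psi s)); split=> //.
- move=> s; apply: has_deriv_eq; first by apply: (@has_deriv_comp _ F); [exact: dF | exact: dpsi'].
  rewrite /azimuth -/beta; field; rewrite s0 gt_eqF//.
  by have := gap_bounds B0 B2 (psi s); lra.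
- move=> s; have := periodic_int pH N s.
  rewrite (_ : N%:~R * _ = 2 * pi); last by rewrite -pmulrn mulrC divfK// gt_eqF.
  by lra.
- move=> s; rewrite HH.
  have pFG x : F (x + 2 * pi) - G (x + 2 * pi) = F x - G x by rewrite Fs Gs; ring.
  have [x /andP[x0 x1] ->] := periodic_reduce P0 pFG (psi s).
  (* The azimuth contributes [2 (k + B) <= 4 / N + 2 B], and [g], which is close to [1 / N], at most
     [4 / N]. *)
  have bH z : `|azimuth B k z - g z| <= 8 / N%:R + 2 * B.
    apply: le_trans (ler_normB _ _) _.
    have := azimuth_bound B0 B2 k z; rewrite (ger0_norm k0).
    have /andP[s1 s2] := inv_slope_bounds z.
    have g0 : 0 <= g z by rewrite (le_trans _ (gm z))// ltW.
    rewrite (ger0_norm g0).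
    suff : g z <= 4 / N%:R by lra.
    rewrite /g ler_pdivlMr//.
    have nN : n^-1 * N%:R <= 100 / 99.
      by rewrite mulrC ler_pdivrMr//; have /andP[] := n_bounds; lra.
    have : 0 <= n^-1 * N%:R by rewrite mulr_ge0 ?invr_ge0 ?ltW.
    rewrite mulrAC; move: (n^-1 * N%:R) nN => a; nra.
  have FG0 : F 0 - G 0 = 0 by rewrite /F /G !subrr.
  have dFG (t : R) : has_deriv (fun x => F x - G x) t (azimuth B k t - g t).
    by repeat dstep.
  have := lipschitz_of_derive dFG bH 0 x; rewrite FG0 !subr0 => h.
  rewrite mulrC; apply: le_trans h _.
  rewrite ger0_norm// ler_wpM2l//.
  have : 0 <= 8 / (N%:R : R) by rewrite divr_ge0// ltW.
  lra.
Qed.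

Lemma kida_wave : exists V : nat -> 'I_3 -> R -> R,
  [/\ is_solution (rotating_wave V (eps * k * n ^+ 2) (eps * beta * n)),
      forall j i (x : R), has_deriv (V j i) x (V j.+1 i x),
      forall i x, V 0 i (x + 2 * pi) = V 0 i x,
      forall i x, `|V 0 i x - row3 (cos x) (sin x) 0 0 i| <=
        B + 2 * pi * (8 / N%:R + 2 * B) &
      forall i x, `|V 1 i x| <= 2 * N%:R * (k + B)].
Proof.
have b0 := B0; have b2 := B2; have k0' := k0; have kN' := kN; have N0' := N0; have N1' := N1.
have [psi [phi [dpsi dphi psis phis phi_near]]] := kida_phase.
pose z s := eps * (B * sin (psi s)).
pose q s := n * slope B k (psi s).
pose y s := eps * B * (cos (psi s) * q s).
pose J s := n * beta * (k - B * sin (psi s)).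
have zz s : 1 - z s * z s = gap B (psi s).
  rewrite /gap /z (_ : eps * _ * _ = eps * eps * (B * sin (psi s) * (B * sin (psi s)))).
    by rewrite eps2 mul1r.
  by ring.
have g0 s : gap B (psi s) != 0.
  by rewrite gt_eqF//; have := gap_bounds B0 B2 (psi s); lra.
have s0 x : slope B k x != 0 by rewrite gt_eqF// slope_gt0.
have q2 s : q s ^+ 2 = n ^+ 2 * slope2 B k (psi s) by rewrite exprMn slope_sqr.
have dq (s : R) : has_deriv q s (- (n ^+ 2 * k * B * cos (psi s))).
  have dslope (x : R) : has_deriv (slope B k) x (- (k * B * cos x) * (slope B k x)^-1).
    apply: has_deriv_eq; first apply: has_deriv_sqrt.
    - by apply: lt_le_trans (slope2_ge _ _ _); have := gap_bounds B0 B2 x; lra.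
    - rewrite /slope2; repeat dstep.
    - by cbv beta; rewrite -/(slope B k x); field.
  apply: has_deriv_eq; first by apply: has_derivM; [exact: has_deriv_cst |
    apply: has_deriv_comp; [exact: dslope|exact: dpsi]].
  by cbv beta; field.
have CS s := cos2Dsin2 (psi s).
have beta2 : beta ^+ 2 = 1 - B ^+ 2.
  by rewrite sqr_sqrtr//; have : B * B <= 1 / 2 * (1 / 2) by [apply: ler_pM]; rewrite expr2; lra.
have dz (s : R) : has_deriv z s (y s).
  by apply: has_deriv_eq; [rewrite /z; repeat dstep | cbv beta; rewrite /y /q; ring].
have dJ (s : R) : has_deriv J s (- (eps * beta * n) * y s).
  apply: has_deriv_eq; first by rewrite /J; repeat dstep.
  cbv beta; rewrite /y /q -[LHS]mul1r -eps2; ring.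
(* The left-hand side is [|V'|^2], so this is the first integral
   [|V'|^2 + 2 om z = n^2 (B^2 + k^2)]. *)
have speed s : (y s ^+ 2 + J s ^+ 2) * (1 - z s * z s)^-1 =
    n ^+ 2 * (B ^+ 2 + k ^+ 2 - 2 * k * (B * sin (psi s))).
  rewrite zz; apply: (canLR (mulfK (g0 s))).
  have -> : y s ^+ 2 = B ^+ 2 * cos (psi s) ^+ 2 * (n ^+ 2 * slope2 B k (psi s)).
    by rewrite -q2 /y -[RHS]mul1r -eps2; ring.
  have -> : J s ^+ 2 = n ^+ 2 * (1 - B ^+ 2) * (k - B * sin (psi s)) ^+ 2.
    by rewrite /J -beta2; ring.
  have -> : cos (psi s) ^+ 2 = 1 - sin (psi s) ^+ 2 by rewrite -(CS s); ring.
  by rewrite /slope2 /gap; ring.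
have dy (s : R) : has_deriv y s (- ((y s ^+ 2 + J s ^+ 2) * (1 - z s * z s)^-1) * z s
     - (eps * k * n ^+ 2) * (1 - z s * z s) + eps * beta * n * J s).
  apply: has_deriv_eq; first by rewrite /y; repeat dstep.
  cbv beta; rewrite speed zz -/(q s).
  rewrite [LHS](_ : _ = - eps * B * (sin (psi s) * q s ^+ 2
    + n ^+ 2 * k * B * cos (psi s) ^+ 2)); last by rewrite /q; ring.
  have -> : cos (psi s) ^+ 2 = 1 - sin (psi s) ^+ 2 by rewrite -(CS s); ring.
  rewrite [X in _ = _ + X](_ : _ = eps * n ^+ 2 * beta ^+ 2 * (k - B * sin (psi s))).
    by rewrite q2 beta2 /slope2 /gap /z; ring.
  by rewrite /J; ring.
have z1 s : z s ^+ 2 < 1.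
  by have := gap_bounds B0 B2 (psi s); rewrite -zz expr2; lra.
have pz s : z (s + 2 * pi) = z s.
  have pzN t : z (t + 2 * pi / N%:R) = z t.
    by rewrite /z psis (_ : 2 * pi = pi *+ 2) ?mulr_natl// sinD2pi.
  have := periodic_int pzN N s.
  by rewrite (_ : N%:~R * _ = 2 * pi)//; rewrite -pmulrn mulrC divfK// gt_eqF.
have dphi' (s : R) : has_deriv phi s (J s * (1 - z s * z s)^-1) by rewrite zz; exact: dphi.
have [V [sV [V0 [V1 V2]] VP dV pV]] := spherical_wave z1 dz dJ dphi' dy pz phis.
exists V; split=> // i x.
- have /andP[g1 g2] := gap_bounds B0 B2 (psi x).
  have r2 : Num.sqrt (gap B (psi x)) ^+ 2 = gap B (psi x) by rewrite sqr_sqrtr//; lra.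
  have r0 : 0 <= Num.sqrt (gap B (psi x)) by exact: sqrtr_ge0.
  have gB : 1 - gap B (psi x) <= B ^+ 2.
    rewrite /gap (_ : B * sin (psi x) * _ = B ^+ 2 * sin (psi x) ^+ 2); last by ring.
    have := CS x; have := sqr_ge0 (cos (psi x)) => c0 cs.
    have : B ^+ 2 * sin (psi x) ^+ 2 <= B ^+ 2 * 1 by rewrite ler_wpM2l ?sqr_ge0//; lra.
    by lra.
  have BB : B ^+ 2 <= B.
    have : B * B <= B * 1 by rewrite ler_wpM2l//; lra.
    by rewrite expr2; lra.
  (* For [r] in [[0, 1]], [1 - r <= 1 - r^2]; with [r^2 = gap] this is at most [B^2 <= B]. *)
  have rB (t : R) : `|t| <= 1 -> `|Num.sqrt (gap B (psi x)) * t - t| <= B.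
    move=> t1; rewrite -[X in _ - X]mul1r -mulrBl normrM.
    rewrite -[leRHS]mulr1; apply: ler_pM => //.
    rewrite distrC ger0_norm; first by nra.
    by rewrite subr_ge0 leNgt; apply/negP => h; nra.
  have near := phi_near x.
  elim/ord3_ind: i; rewrite row3E ?(V0, V1, V2) /wave_v0 /wave_v1 ?zz.
  + rewrite (_ : _ - _ = (Num.sqrt (gap B (psi x)) * cos (phi x) - cos (phi x))
      + (cos (phi x) - cos x)); last by ring.
    apply: le_trans (ler_normD _ _) _; apply: lerD; first exact: (rB _ (cos_max _)).
    exact: le_trans (cos_lipschitz _ _) near.
  + rewrite (_ : _ - _ = (Num.sqrt (gap B (psi x)) * sin (phi x) - sin (phi x))
      + (sin (phi x) - sin x)); last by ring.
    apply: le_trans (ler_normD _ _) _; apply: lerD; first exact: (rB _ (sin_max _)).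
    exact: le_trans (sin_lipschitz _ _) near.
  + rewrite subr0 /z !normrM.
    have -> : `|eps| = 1.
      apply/eqP; rewrite -(@eqrXn2 _ 2)// -normrX expr2 eps2 normr1 expr1n//.
    have p2 := le_trans (normr_ge0 _) near; have sm := sin_max (psi x).
    rewrite mul1r (ger0_norm B0).
    have : B * `|sin (psi x)| <= B * 1 by rewrite ler_wpM2l.
    lra.
- have /andP[n1 n2] := n_bounds.
  have sp := @wave_speed R z y J phi z1 x.
  rewrite speed in sp.
  have [v0 [v1 v2]] := VP x.
  have nk0 : 0 <= n * (k + B) by rewrite mulr_ge0 ?addr_ge0// ltW.
  (* The squared speed is largest where [sin psi = -1], and there it equals the right-hand side. *)
  have sq : V 1 i x ^+ 2 <= (n * (k + B)) ^+ 2.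
    apply: (@le_trans _ _ (n ^+ 2 * (B ^+ 2 + k ^+ 2 - 2 * k * (B * sin (psi x))))).
      rewrite -sp; have := sqr_ge0 (V 1 ax0 x); have := sqr_ge0 (V 1 ax1 x).
      have := sqr_ge0 (V 1 ax2 x).
      by elim/ord3_ind: i; rewrite v0 v1 v2 !expr2; lra.
    rewrite [leRHS]exprMn ler_wpM2l ?sqr_ge0//.
    have : - (sin (psi x)) <= 1.
      by have := sin_max (psi x); rewrite ler_norml => /andP[]; lra.
    have : 0 <= k * B by rewrite mulr_ge0.
    move: (sin _) => t kB t1; rewrite expr2 expr2; nra.
  apply: (@le_trans _ _ (n * (k + B))).
    rewrite -(@ler_pXn2r _ 2)// ?nnegrE//.
    by rewrite real_normK ?num_real.
  by rewrite ler_wpM2r ?addr_ge0//; lra.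
Qed.

End kida_wave.

(** * Asymptotics as the number of windings grows *)

Section kida_sequence.
Context {R : realType}.

(** With [a = n / N] and [w = beta k N], both close to 1, [n (k n - beta) = (a / beta) (N (w a - 1)
    + b^2)], because [1 - beta^2 = B^2] and [N B^2 = b^2]. The main term [b^2] is what the deviation
    of [beta] from 1 produces. *)
Lemma drift_estimate (b eta beta N n k B : R) : 0 < eta <= 1 -> 0 <= b ->
  N * eta ^+ 2 = 1 -> B = b * eta -> 4 / 5 <= beta <= 1 -> beta ^+ 2 = 1 - B ^+ 2 ->
  0 <= k <= 2 / N -> 0 < N -> defect B k <= 1 / 100 ->
  `|n / N - 1| <= defect B k -> `|beta * k * N - 1| <= 10 * defect B k ->
  `|n * (k * n - beta) - b ^+ 2| <=
    ((16 + 2 * b ^+ 2) * (4 * (1 + b)) + 2 * b ^+ 2 * b ^+ 2) * eta.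
Proof.
move=> /andP[e0 e1] b0 Ne BE /andP[b1 b2] bB /andP[k0 kN] N0 d1.
set d := defect B k in d1 * => ha hw.
have kE : k <= 2 * eta ^+ 2.
  by apply: le_trans kN _; rewrite ler_pdivrMr// -mulrA (mulrC _ N) Ne mulr1.
have e2 : eta ^+ 2 <= eta by rewrite expr2 ler_piMr// ltW.
have e20 : 0 <= eta ^+ 2 by rewrite sqr_ge0.
have Nk : 0 <= N * k <= 2.
  by rewrite mulr_ge0 ?(ltW N0)//= mulrC -ler_pdivlMr.
(* [defect] is [k (k + 2 B)], of order [eta^3], while [N = eta^(-2)]. *)
have D : N * d <= 4 * (1 + b) * eta.
  rewrite /d /defect BE (_ : N * _ = (N * k) * (k + 2 * (b * eta))); last by ring.
  have : (N * k) * (k + 2 * (b * eta)) <= 2 * (2 * eta + 2 * (b * eta)).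
    have be : 0 <= b * eta by rewrite mulr_ge0// ltW.
    by move/andP: Nk => [? ?]; apply: ler_pM => //; lra.
  by lra.
have N1 : 1 <= N.
  by rewrite -Ne ler_piMr ?(ltW N0)//; lra.
have d0 : 0 <= d by exact: le_trans ha.
have dD : d <= 4 * (1 + b) * eta by apply: le_trans D; rewrite ler_peMl.
set a := n / N in ha; set w := beta * k * N in hw.
have be0 : 0 < beta by lra.
have nE : n = a * N by rewrite /a divfK// gt_eqF.
have -> : n * (k * n - beta) = a / beta * (N * (w * a - 1) + b ^+ 2).
  have -> : b ^+ 2 = N * B ^+ 2 by rewrite BE exprMn mulrCA Ne mulr1.
  have -> : B ^+ 2 = 1 - beta ^+ 2 by rewrite bB; ring.
  by rewrite nE /w; field; rewrite gt_eqF.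
set X := N * (w * a - 1).
have /andP[a1 a2] : - d <= a - 1 <= d by rewrite -ler_norml.
have a101 : `|a| <= 101 / 100 by rewrite ler_norml; apply/andP; split; lra.
have hX : `|X| <= 12 * (4 * (1 + b) * eta).
  rewrite /X normrM gtr0_norm//.
  have h : `|w * a - 1| <= 12 * d.
    rewrite (_ : w * a - 1 = (w - 1) * a + (a - 1)); last by ring.
    apply: le_trans (ler_normD _ _) _; rewrite normrM.
    have : `|w - 1| * `|a| <= 10 * d * (101 / 100) by apply: ler_pM.
    by lra.
  have : N * `|w * a - 1| <= N * (12 * d) by rewrite ler_wpM2l// ltW.
  by lra.
have ab : 0 <= a / beta <= 4 / 3.
  rewrite divr_ge0/= ?(ltW be0)//; last by lra.
  by rewrite ler_pdivrMr//; lra.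
have ab1 : `|a / beta - 1| <= 2 * (d + b ^+ 2 * eta).
  have -> : a / beta - 1 = (a - beta) / beta by field; rewrite gt_eqF.
  have B2e : B ^+ 2 <= b ^+ 2 * eta.
    by rewrite BE exprMn ler_wpM2l ?sqr_ge0.
  have p : 0 <= b ^+ 2 * eta by rewrite mulr_ge0 ?sqr_ge0// ltW.
  rewrite normrM normfV (gtr0_norm be0) ler_pdivrMr//.
  have : `|a - beta| <= d + b ^+ 2 * eta.
    by rewrite ler_norml; apply/andP; split; nra.
  by move=> h; nra.
rewrite (_ : _ - _ = a / beta * X + b ^+ 2 * (a / beta - 1)); last by ring.
apply: le_trans (ler_normD _ _) _; rewrite (normrM (a / beta)) (normrM (b ^+ 2)).
have t1 : `|a / beta| * `|X| <= 4 / 3 * (12 * (4 * (1 + b) * eta)).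
  by move/andP: ab => [ab0 ab4]; apply: ler_pM => //; rewrite ger0_norm.
have t2 : `|b ^+ 2| * `|a / beta - 1| <= b ^+ 2 * (2 * (4 * (1 + b) * eta + b ^+ 2 * eta)).
  rewrite ger0_norm ?sqr_ge0// ler_wpM2l ?sqr_ge0//.
  by apply: le_trans ab1 _; lra.
by apply: le_trans (lerD t1 t2) _; lra.
Qed.

Lemma kida_sequence (sigma : R) : exists C : R, exists N0 : nat, forall N : nat,
  (N0 <= N)%N -> [/\ 0 < Num.sqrt (N%:R : R) & exists V om c,
  [/\ is_solution (rotating_wave V om c),
      forall j i (x : R), has_deriv (V j i) x (V j.+1 i x),
      forall i x, V 0%N i (x + 2 * pi) = V 0%N i x,
      `|om - c - sigma| <= C / Num.sqrt N%:R &
      (forall i x, `|V 0%N i x - row3 (cos x) (sin x) 0 0 i| <= C / Num.sqrt N%:R) /\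
      (forall i x, `|V 1%N i x| <= C * Num.sqrt N%:R)]].
Proof.
pose b := Num.sqrt `|sigma|.
have b0 : 0 <= b by exact: sqrtr_ge0.
have bb : b ^+ 2 = `|sigma| by rewrite sqr_sqrtr.
have P0 := @twopi_gt0 R.
pose C1 := (16 + 2 * b ^+ 2) * (4 * (1 + b)) + 2 * b ^+ 2 * b ^+ 2.
pose C2 := b + 2 * pi * (8 + 2 * b).
pose C3 := 4 + 2 * b.
have C10 : 0 <= C1 by rewrite addr_ge0 ?mulr_ge0 ?addr_ge0 ?mulr_ge0 ?sqr_ge0.
have C20 : 0 <= C2 by rewrite addr_ge0 // mulr_ge0 ?(ltW P0) // addr_ge0 // mulr_ge0.
have C30 : 0 <= C3 by rewrite addr_ge0 ?mulr_ge0.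
(* The 1000 is the threshold of [holonomy]; the rest ensures [B^2 = b^2 / N <= 1 / 4]. *)
have [N0 N0P] : exists N0 : nat, 1000 + 4 * b ^+ 2 <= N0%:R.
  have : 0 <= 1000 + 4 * b ^+ 2 by have := sqr_ge0 b; lra.
  move: (1000 + _) => r r0; exists (Num.bound r); exact/ltW/archi_boundP.
exists (C1 + C2 + C3), N0 => N NN.
have Nb : 1000 + 4 * b ^+ 2 <= N%:R :> R by apply: le_trans N0P _; rewrite ler_nat.
have b20 := sqr_ge0 b.
have N1 : 1000 <= N%:R :> R by lra.
have Npos : 0 < N%:R :> R by lra.
have s0 : 0 < Num.sqrt (N%:R : R) by rewrite sqrtr_gt0.
split=> //; set sN := Num.sqrt _ in s0 *.
have sN2 : sN ^+ 2 = N%:R by rewrite sqr_sqrtr// ltW.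
pose eta := sN^-1; have e0 : 0 < eta by rewrite invr_gt0.
have Ne : N%:R * eta ^+ 2 = 1.
  by rewrite -sN2 -exprMn divff ?expr1n// gt_eqF.
have s1 : 1 <= sN by rewrite leNgt; apply/negP => h; nra.
have e1 : eta <= 1 by rewrite invf_le1.
pose B := b * eta.
have B0 : 0 <= B by rewrite mulr_ge0// ltW.
have B2 : B <= 1 / 2.
  have : B ^+ 2 <= 1 / 4.
    rewrite /B exprMn; move: Ne; move: (eta ^+ 2) (sqr_ge0 eta) => t t0 Ne.
    have : 4 * b ^+ 2 * t <= N%:R * t by rewrite ler_wpM2r//; lra.
    by lra.
  by move=> h; rewrite leNgt; apply/negP => h'; nra.
(* The drift of a wave has the sign of [eps], since [om] and [c] are both proportional to it. *)
pose eps : R := if 0 <= sigma then 1 else -1.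
have eps2 : eps * eps = 1 by rewrite /eps; case: ifP => _; ring.
have sigmaE : sigma = eps * b ^+ 2.
  rewrite bb /eps; case: leP => [h|h]; first by rewrite mul1r ger0_norm.
  by rewrite ltr0_norm// mulN1r opprK.
have [k [/andP[k0 kN] holo kdef]] := holonomy B0 B2 N1.
have [V [sV dV pV V0 V1]] := kida_wave B0 B2 eps2 N1 k0 kN holo.
have NE : N%:R^-1 = eta ^+ 2 by rewrite -sN2 exprVn.
have e2 : eta ^+ 2 <= eta by rewrite expr2 ler_piMr// ltW.
have k2 : k <= 2 * eta ^+ 2 by rewrite -NE.
eexists; eexists; eexists; split; [exact: sV | exact: dV | exact: pV | | split].
- set beta := Num.sqrt _; set n := frequency _ _ _.
  have nn : `|eps| = 1.
    by apply/eqP; rewrite -(@eqrXn2 _ 2)// -normrX expr2 eps2 normr1 expr1n.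
  rewrite sigmaE (_ : _ - _ - _ = eps * (n * (k * n - beta) - b ^+ 2)); last by ring.
  rewrite normrM nn mul1r.
  have d1 : defect B k <= 1 / 100.
    have t3 : eta ^+ 2 <= 1 / 1000 by rewrite -NE -[leLHS]div1r ler_pdivrMr//; lra.
    have : k * B <= 2 / 1000 * (1 / 2) by apply: ler_pM => //; lra.
    have : k * k <= 2 / 1000 * (2 / 1000) by apply: ler_pM => //; lra.
    by rewrite /defect expr2 -mulrA; lra.
  have e01 : 0 < eta <= 1 by rewrite e0 e1.
  have kk : 0 <= k <= 2 / N%:R by rewrite k0 kN.
  have bet2 : beta ^+ 2 = 1 - B ^+ 2.
    by rewrite sqr_sqrtr//; have : B * B <= 1 / 2 * (1 / 2) by [apply: ler_pM]; rewrite expr2; lra.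
  have fn := frequency_near B0 B2 N1 k0.
  apply: le_trans (drift_estimate e01 b0 Ne erefl (beta_bounds B0 B2) bet2 kk Npos d1 fn kdef) _.
  by rewrite -/C1 -/eta ler_wpM2r ?(ltW e0)//; lra.
- move=> i x; apply: le_trans (V0 i x) _; rewrite -/eta NE.
  apply: (@le_trans _ _ (C2 * eta)); last by rewrite ler_wpM2r ?(ltW e0)//; lra.
  rewrite /C2 /B [leRHS]mulrDl lerD2l -(mulrA (2 * pi)) ler_pM2l//; lra.
- move=> i x; apply: le_trans (V1 i x) _.
  apply: (@le_trans _ _ (C3 * sN)); last by rewrite ler_wpM2r ?(ltW s0)//; lra.
  have NEs : N%:R * eta = sN by rewrite -sN2 expr2 mulfK// gt_eqF.
  have : N%:R * (k + B) <= 2 + b * sN.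
    rewrite mulrDr lerD//; first by rewrite mulrC -ler_pdivlMr.
    by rewrite /B mulrCA NEs.
  rewrite /C3; have : 0 <= b * sN by rewrite mulr_ge0// ltW.
  by lra.
Qed.

End kida_sequence.

(** * Fourier coefficients *)

Section smooth_functions.
Context {R : realType}.
Implicit Types (h k : R -> R) (f g : R -> 'rV[R]_3).

(** A whole tower of derivatives is easier to add, scale and translate than iterated derivatives;
    [smoothP] relates the two. *)
Definition smooth_fun h := exists F : nat -> R -> R,
  F 0%N = h /\ forall j (x : R), has_deriv (F j) x (F j.+1 x).

Lemma smooth_fun_continuous h : smooth_fun h -> continuous h.
Proof. by move=> [F [<- dF]]; exact: derive_continuous (dF 0%N). Qed.

Lemma smooth_funD h k : smooth_fun h -> smooth_fun k ->
  smooth_fun (fun x => h x + k x).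
Proof.
move=> [F [<- dF]] [G [<- dG]]; exists (fun j x => F j x + G j x); split=> // j x.
by repeat dstep.
Qed.

Lemma smooth_funZ (a : R) h : smooth_fun h -> smooth_fun (fun x => a * h x).
Proof.
move=> [F [<- dF]]; exists (fun j x => a * F j x); split=> // j x.
by apply: has_deriv_eq; [repeat dstep | cbv beta; ring].
Qed.

Lemma smooth_fun0 : smooth_fun (fun=> 0).
Proof. by exists (fun _ _ => 0); split=> // j x; exact: has_deriv_cst. Qed.

Lemma smoothP f : smooth f <-> forall i, smooth_fun (fun x => f x 0 i).
Proof.
split=> [sf i|sf].
  exists (fun j => dcoord f j i); split=> [|j x]; last exact: smooth_dcoord.
  by apply/funext => x; rewrite dcoordE.
have /choice[F FP] := sf.
have := @smooth_family _ (fun j x => \row_i F i j x).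
rewrite (_ : (fun x => \row_i F i 0%N x) = f); last first.
  by apply/funext => x; apply/rowP => i; rewrite mxE; have [-> _] := FP i.
apply=> j i x; rewrite mxE (_ : (fun y => _) = F i j).
  by have [_ dF] := FP i; exact: dF.
by apply/funext => y; rewrite mxE.
Qed.

Definition trig (b : bool) (n : nat) (x : R) : R :=
  if b then sin (n%:R * x) else cos (n%:R * x).

Arguments trig : simpl never.

Lemma trig_deriv b n (x : R) : has_deriv (trig b n) x
  ((if b then n%:R else - n%:R) * trig (~~ b) n x).
Proof.
have d : has_deriv (fun y => n%:R * y) x n%:R.
  by apply: has_deriv_eq; [repeat dstep | cbv beta; ring].
case: b; apply: has_deriv_eq.
- by apply: has_deriv_sin; exact: d.
- by rewrite mulrC.
- by apply: has_deriv_cos; exact: d.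
- by rewrite /trig/=; ring.
Qed.

Lemma smooth_trig b n : smooth_fun (trig b n).
Proof.
pose gen (h : R -> R) := exists b, h = trig b n.
apply: (@generated_family _ gen) => [h [b' ->]|]; last first.
  by apply: generated_gen; exists b.
exists (fun x => (if b' then n%:R else - n%:R) * trig (~~ b') n x).
  apply: (@generated_mul _ gen (fun=> if b' then n%:R else - n%:R)).
    exact: generated_cst.
  by apply: generated_gen; exists (~~ b').
by move=> x; exact: trig_deriv.
Qed.

Lemma continuous_trig b n : continuous (trig b n).
Proof. exact: smooth_fun_continuous (smooth_trig b n). Qed.

Lemma periodic_trig b n x : trig b n (x + 2 * pi) = trig b n x.
Proof.
have e : n%:R * (x + 2 * pi) = n%:R * x + (pi *+ 2) *+ n.
  by rewrite mulrDr -[(pi *+ 2) *+ n]mulr_natl -[pi *+ 2]mulr_natl.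
by rewrite /trig e; case: b; rewrite periodicn//; [exact: sinD2pi | exact: cosD2pi].
Qed.

Lemma trig_le1 b n x : `|trig b n x| <= 1.
Proof. by case: b; [exact: sin_max | exact: cos_max]. Qed.

Lemma cint_trig b n : (0 < n)%N -> cint (trig b n) = 0.
Proof.
move=> n0; have nn : n%:R != 0 :> R by rewrite pnatr_eq0 -lt0n.
apply: (@cint_periodic _ _ (fun x => (if b then - n%:R^-1 else n%:R^-1) * trig (~~ b) n x)).
- exact: continuous_trig.
- move=> x; apply: has_deriv_eq; first by apply: has_derivM; [exact: has_deriv_cst | exact: trig_deriv].
  by cbv beta; case: b => /=; field.
- by move=> x; rewrite periodic_trig.
Qed.

Lemma trig_mul b n b' n' x : (n' <= n)%N -> trig b n x * trig b' n' x =
  if b then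
    if b' then 2^-1 * trig false (n - n') x - 2^-1 * trig false (n + n') x
    else 2^-1 * trig true (n + n') x + 2^-1 * trig true (n - n') x
  else
    if b' then 2^-1 * trig true (n + n') x - 2^-1 * trig true (n - n') x
    else 2^-1 * trig false (n - n') x + 2^-1 * trig false (n + n') x.
Proof.
move=> nn; rewrite /trig natrD natrB// !mulrDl !mulNr.
by case: b; case: b'; rewrite ?sinD ?cosD ?sinN ?cosN; field.
Qed.

(** At order 0 the sine is the zero function and the cosine is the constant 1. *)
Definition trig_norm (b : bool) (n : nat) : R :=
  if n is 0 then if b then 0 else 2 * pi else pi.

Lemma cint_trig_mul b n b' n' : cint (fun x => trig b n x * trig b' n' x) =
  if (b == b') && (n == n') then trig_norm b n else 0.
Proof.
(* The product formula involves [n - n'], which is truncated in [nat]. *)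
wlog nn : b n b' n' / (n' <= n)%N => [H|].
  have [nn|/ltnW nn] := leqP n' n; first exact: H.
  have := H b' n' b n nn; rewrite (eq_sym b') (eq_sym n') => e.
  rewrite (eq_cint (g := fun x => trig b' n' x * trig b n x)) ?e; last by move=> x; rewrite mulrC.
  by case: ifP => // /andP[/eqP -> /eqP ->].
have ct b0 (k : nat) : continuous (fun x => 2^-1 * trig b0 k x).
  by apply: contM; [exact: cont_cst | exact: continuous_trig].
have cE b0 (k : nat) : cint (fun x => 2^-1 * trig b0 k x) =
    if k is 0 then if b0 then 0 else pi else 0.
  rewrite cintZ; last exact: continuous_trig.
  case: k => [|k]; last by rewrite cint_trig ?mulr0.
  rewrite (eq_cint (g := fun=> (if b0 then 0 else 1))) ?cint_cst; last first.
    by move=> x; rewrite /trig mul0r sin0 cos0.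
  by case: b0; rewrite ?mulr0 ?mulr1 ?mulrA ?mulVf ?mul1r// pnatr_eq0.
have cD b0 (k : nat) b1 (k' : nat) : cint (fun x => 2^-1 * trig b0 k x + 2^-1 * trig b1 k' x) =
    cint (fun x => 2^-1 * trig b0 k x) + cint (fun x => 2^-1 * trig b1 k' x).
  exact: cintD.
have cB b0 (k : nat) b1 (k' : nat) : cint (fun x => 2^-1 * trig b0 k x - 2^-1 * trig b1 k' x) =
    cint (fun x => 2^-1 * trig b0 k x) - cint (fun x => 2^-1 * trig b1 k' x).
  exact: cintB.
rewrite (eq_cint (fun x => trig_mul b b' x nn)).
have n0 : (n == n') = (n - n' == 0)%N.
  by rewrite subn_eq0 eqn_leq nn andbT.
have nn0 : (n + n' == 0)%N -> (n - n' == 0)%N.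
  by rewrite addn_eq0 => /andP[/eqP -> _].
have nn1 : (n + n' == 0)%N -> n = 0%N by rewrite addn_eq0 => /andP[/eqP ->].
have nn2 : (n - n' == 0)%N -> n = 0%N -> (n + n' == 0)%N.
  by move=> h1 h2; move: nn; rewrite h2 leqn0 => /eqP ->.
rewrite n0; case: b; case: b' => /=;
  rewrite ?cD ?cB !cE;
  move: nn0 nn1 nn2; case: (n - n')%N => [|d]; case: (n + n')%N => [|s] nn0 nn1 nn2;
  rewrite /= ?addr0 ?subrr ?add0r ?subr0 ?oppr0//.
- by rewrite (nn1 isT).
- by case: n nn2 {nn0 nn1 nn n0} => // /(_ isT erefl).
- by have := nn0 isT.
- by rewrite (nn1 isT) /= mulr_natl mulr2n.
- by case: n nn2 {nn0 nn1 nn n0} => // /(_ isT erefl).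
- by have := nn0 isT.
Qed.

Lemma trig_norm_le b n : trig_norm b n <= 2 * pi.
Proof.
have p := pi_ge0 R; case: n => [|n] /=; last by lra.
by case: b; lra.
Qed.

Lemma cint_sum (I : Type) (s : seq I) (F : I -> R -> R) :
  (forall i, continuous (F i)) ->
  continuous (fun x => \sum_(i <- s) F i x) /\
  cint (fun x => \sum_(i <- s) F i x) = \sum_(i <- s) cint (F i).
Proof.
move=> cF; elim: s => [|i s [ih1 ih2]].
  rewrite big_nil; under eq_fun do rewrite big_nil.
  by split; [exact: cont_cst | rewrite cint_cst mulr0].
rewrite big_cons; under eq_fun do rewrite big_cons.
by split; [exact: contD | rewrite cintD// ih2].
Qed.

(** Expand the integral of [(h - P)^2], where [P] has coefficients [a i / (2 pi)]. The squared norms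
    are only bounded by [2 pi], not equal to it: this admits the vanishing sine of order 0 and all
    other modes at once, at the cost of a factor 2. *)
Lemma bessel (I : finType) (e : I -> R -> R) h :
  continuous h -> (forall i, continuous (e i)) ->
  (forall i j, i != j -> cint (fun x => e i x * e j x) = 0) ->
  (forall i, cint (fun x => e i x * e i x) <= 2 * pi) ->
  \sum_i cint (fun x => h x * e i x) ^+ 2 <= 2 * pi * cint (fun x => h x ^+ 2).
Proof.
move=> ch ce orth nrm.
pose a i := cint (fun x => h x * e i x).
have p0 : 0 < 2 * pi :> R := twopi_gt0; set p := 2 * pi in nrm p0 *.
pose P x := \sum_i (p^-1 * a i) * e i x.
have cPi i : continuous (fun x => (p^-1 * a i) * e i x) by apply: contM => //; exact: cont_cst.
have cP : continuous P by exact: (cint_sum _ cPi).1.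
have hP : cint (fun x => h x * P x) = \sum_i p^-1 * a i ^+ 2.
  have cc i : continuous (fun x => (p^-1 * a i) * (h x * e i x)).
    by repeat cstep.
  rewrite (eq_cint (g := fun x => \sum_i (p^-1 * a i) * (h x * e i x))); last first.
    by move=> x; rewrite /P mulr_sumr; apply: eq_bigr => i _; ring.
  rewrite (cint_sum _ cc).2; apply: eq_bigr => i _.
  by rewrite cintZ; [rewrite -/(a i); ring | repeat cstep].
have PP : cint (fun x => P x * P x) <= \sum_i p^-1 * a i ^+ 2.
  have cc i : continuous (fun x => (p^-1 * a i) * (e i x * P x)).
    by repeat cstep.
  rewrite (eq_cint (g := fun x => \sum_i (p^-1 * a i) * (e i x * P x))); last first.
    by move=> x; rewrite {1}/P mulr_suml; apply: eq_bigr => i _; ring.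
  rewrite (cint_sum _ cc).2; apply: ler_sum => i _.
  rewrite cintZ; last by repeat cstep.
  have -> : cint (fun x => e i x * P x) = p^-1 * a i * cint (fun x => e i x * e i x).
    have cj j : continuous (fun x => (p^-1 * a j) * (e i x * e j x)) by repeat cstep.
    rewrite (eq_cint (g := fun x => \sum_j (p^-1 * a j) * (e i x * e j x))); last first.
      by move=> x; rewrite {1}/P mulr_sumr; apply: eq_bigr => j _; ring.
    rewrite (cint_sum _ cj).2 (bigD1 i)//= big1 ?addr0 => [|j ji].
      by rewrite cintZ//; repeat cstep.
    by rewrite cintZ ?orth ?mulr0 1?eq_sym//; repeat cstep.
  have -> : p^-1 * a i * (p^-1 * a i * cint (fun x => e i x * e i x)) =
    p^-1 * a i ^+ 2 * (cint (fun x => e i x * e i x) / p) by ring.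
  apply: ler_piMr; first by rewrite mulr_ge0 ?sqr_ge0// invr_ge0 ltW.
  by rewrite ler_pdivrMr// mul1r.
have : 0 <= cint (fun x => (h x - P x) ^+ 2).
  by apply: cint_ge0; [repeat cstep | move=> x; exact: sqr_ge0].
rewrite (eq_cint (g := fun x => h x ^+ 2 + - (2 * (h x * P x)) + P x * P x)); last first.
  by move=> x; ring.
rewrite cintD; [|repeat cstep..].
rewrite cintB; [|repeat cstep..].
rewrite cintZ; last by repeat cstep.
rewrite hP => H.
rewrite -ler_pdivrMl// mulr_sumr -/a; lra.
Qed.

End smooth_functions.

(** * The H^{1/2} sum between L^2 and H^1 *)

Section fourier.
Context {R : realType}.
Implicit Types (f g : R -> 'rV[R]_3) (n N M : nat).

Local Notation mode_index := ('I_3 * bool)%type.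
Implicit Types k : mode_index.

Definition coef f n k : R := pi^-1 * cint (fun x => f x 0 k.1 * trig k.2 n x).

Definition weight n : R := Num.sqrt (1 + n%:R ^+ 2).

Definition mode f n : R := \sum_k coef f n k ^+ 2.

Lemma sum_mode (F : 'I_3 -> bool -> R) :
  \sum_(k : mode_index) F k.1 k.2 = \sum_i (F i false + F i true).
Proof.
rewrite -(pair_big xpredT xpredT (fun i b => F i b))/=.
by apply: eq_bigr => i _; rewrite big_bool/= addrC.
Qed.

Lemma Hhalf_sqE f : Hhalf_sq f = (\sum_(0 <= n <oo) (weight n * mode f n)%:E)%E.
Proof.
apply: eq_eseriesr => n _; congr (_ * _)%:E.
rewrite /mode (sum_mode (fun i b => coef f n (i, b) ^+ 2)) big_split/=.
by rewrite /dot; congr (_ + _); apply: eq_bigr => i _; rewrite !mxE -expr2.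
Qed.

Lemma weight_gt0 n : 0 < weight n.
Proof. by rewrite sqrtr_gt0; have := sqr_ge0 (n%:R : R); lra. Qed.

Lemma weight_sqr n : weight n ^+ 2 = 1 + n%:R ^+ 2.
Proof. by rewrite sqr_sqrtr//; have := sqr_ge0 (n%:R : R); lra. Qed.

Lemma mode_ge0 f n : 0 <= mode f n.
Proof. by apply: sumr_ge0 => k _; exact: sqr_ge0. Qed.

Lemma term_ge0 f n : 0 <= weight n * mode f n.
Proof. by rewrite mulr_ge0 ?mode_ge0// ltW// weight_gt0. Qed.

Definition psum f N : R := \sum_(0 <= n < N) weight n * mode f n.

Lemma Hhalf_sq_le f (A : R) N :
  (forall M, (N <= M)%N -> psum f M <= A) -> (Hhalf_sq f <= A%:E)%E.
Proof.
move=> H; rewrite Hhalf_sqE; apply: lime_le.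
  by apply: is_cvg_nneseries => n _ _; rewrite lee_fin term_ge0.
near=> M; rewrite sumEFin lee_fin; apply: H.
by near: M; exact: nbhs_infty_ge.
Unshelve. all: by end_near. Qed.

Lemma Hhalf_norm_le f (A : R) N :
  (forall M, (N <= M)%N -> psum f M <= A) -> Hhalf_norm f ^+ 2 <= A.
Proof.
move=> H; have := Hhalf_sq_le H.
have : (0 <= Hhalf_sq f)%E.
  rewrite Hhalf_sqE; apply: nneseries_ge0 => n _ _.
  by rewrite lee_fin term_ge0.
rewrite /Hhalf_norm; case: (Hhalf_sq f) => [r|//|//].
by rewrite !lee_fin/= => r0 rA; rewrite sqr_sqrtr.
Qed.

Definition smooth_periodic f := smooth f /\ Defs.periodic f.

Lemma smooth_periodic_continuous f i : smooth_periodic f ->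
  continuous (fun x => f x 0 i).
Proof. by move=> [/smoothP/(_ i) sf _]; exact: smooth_fun_continuous. Qed.

Lemma cint_sqdcoord f j : smooth f ->
  cint (sqdcoord f j) = \sum_i cint (fun x => dcoord f j i x ^+ 2).
Proof.
move=> sf; rewrite sum3; have c i := @dcoord_continuous _ f j i sf.
rewrite -!cintD; by repeat cstep.
Qed.

Lemma bessel_component (h : R -> R) N : continuous h ->
  \sum_(0 <= n < N) (cint (fun x => h x * trig false n x) ^+ 2
    + cint (fun x => h x * trig true n x) ^+ 2) <= 2 * pi * cint (fun x => h x ^+ 2).
Proof.
move=> ch.
have := @bessel R ('I_N * bool)%type (fun j => trig j.2 j.1) h ch
  (fun j => @continuous_trig R _ _).
rewrite big_mkord => H.
apply: le_trans (H _ _).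
- rewrite -(pair_big xpredT xpredT (fun (n : 'I_N) b =>
    cint (fun x => h x * trig b n x) ^+ 2))/=.
  by apply: ler_sum => n _; rewrite big_bool/= addrC.
- move=> [n b] [n' b'] /= ne; rewrite cint_trig_mul.
  case: ifP => // /andP[/eqP e1 /eqP e2]; move: ne; rewrite e1.
  by rewrite (val_inj e2) eqxx.
- by move=> [n b]; rewrite cint_trig_mul !eqxx/=; exact: trig_norm_le.
Qed.

Lemma sum_mode_coef f n : mode f n = (pi^-1) ^+ 2 *
  \sum_i (cint (fun x => f x 0 i * trig false n x) ^+ 2
    + cint (fun x => f x 0 i * trig true n x) ^+ 2).
Proof.
rewrite /mode (sum_mode (fun i b => coef f n (i, b) ^+ 2)) mulr_sumr.
by apply: eq_bigr => i _; rewrite /coef/= !exprMn mulrDr.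
Qed.

Lemma bessel_mode f N : smooth_periodic f ->
  \sum_(0 <= n < N) mode f n <= 2 / pi * cint (sqdcoord f 0).
Proof.
move=> [sf pf]; rewrite cint_sqdcoord//.
under eq_bigr do rewrite sum_mode_coef.
rewrite -mulr_sumr exchange_big/=.
have p0 : 0 < pi :> R := pi_gt0 R.
have -> : 2 / pi * \sum_i cint (fun x => dcoord f 0 i x ^+ 2) =
  pi^-1 ^+ 2 * \sum_i (2 * pi * cint (fun x => dcoord f 0 i x ^+ 2)) :> R.
  rewrite -mulr_sumr; move: (pi) p0 => p p0; by field; rewrite gt_eqF.
rewrite ler_wpM2l ?sqr_ge0//; apply: ler_sum => i _.
rewrite (_ : dcoord f 0 i = fun x => f x 0 i); last by rewrite dcoord_funE.
by apply: bessel_component; exact: smooth_periodic_continuous.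
Qed.

Lemma cint_trig_derive f i b n : smooth_periodic f ->
  cint (fun x => dcoord f 1 i x * trig b n x) =
  (if b then - n%:R else n%:R) * cint (fun x => dcoord f 0 i x * trig (~~ b) n x).
Proof.
move=> [sf pf]; have c j := @dcoord_continuous _ f j i sf.
have ct b' := @continuous_trig R b' n.
rewrite -cintZ; last by repeat cstep.
apply/eqP; rewrite -subr_eq0 -cintB; [|repeat cstep..].
apply/eqP; apply: (@cint_periodic _ _ (fun x => dcoord f 0 i x * trig b n x)).
- by repeat cstep.
- move=> x; apply: has_deriv_eq; first by apply: has_derivM; [exact: smooth_dcoord | exact: trig_deriv].
  by cbv beta; case: b => /=; ring.
- by move=> x; rewrite periodic_trig periodic_dcoord.
Qed.

Lemma bessel_mode_derive f N : smooth_periodic f ->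
  \sum_(0 <= n < N) n%:R ^+ 2 * mode f n <= 2 / pi * cint (sqdcoord f 1).
Proof.
move=> spf; have [sf pf] := spf; rewrite cint_sqdcoord//.
have p0 : 0 < pi :> R := pi_gt0 R.
have -> : 2 / pi * \sum_i cint (fun x => dcoord f 1 i x ^+ 2) =
  pi^-1 ^+ 2 * \sum_i (2 * pi * cint (fun x => dcoord f 1 i x ^+ 2)) :> R.
  rewrite -mulr_sumr; move: (pi) p0 => p p0; by field; rewrite gt_eqF.
rewrite (eq_bigr (fun n => (pi^-1) ^+ 2 *
  \sum_i (cint (fun x => dcoord f 1 i x * trig false n x) ^+ 2
    + cint (fun x => dcoord f 1 i x * trig true n x) ^+ 2))); last first.
  move=> n _; rewrite sum_mode_coef mulrCA; congr (_ * _).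
  rewrite mulr_sumr; apply: eq_bigr => i _; rewrite !cint_trig_derive//=.
  have e : dcoord f 0 i = fun x => f x 0 i by rewrite dcoord_funE.
  by rewrite e; ring.
rewrite -[leLHS]mulr_sumr exchange_big/= ler_wpM2l ?sqr_ge0//; apply: ler_sum => i _.
by apply: bessel_component; exact: dcoord_continuous.
Qed.

(** The weight is at most [(r + (1 + n^2) / r) / 2] for every [r], which interpolates H^{1/2}
    between L^2 and H^1. The parameter is left free, to be balanced against the sizes of [f] and
    [f']. *)
Lemma psum_le f N (r : R) : 0 < r -> smooth_periodic f ->
  psum f N <= pi^-1 * ((r + r^-1) * cint (sqdcoord f 0) + r^-1 * cint (sqdcoord f 1)).
Proof.
move=> r0 sf; have p0 : 0 < pi :> R := pi_gt0 R.
have ri : 0 < r^-1 by rewrite invr_gt0.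
have wle n : weight n <= 2^-1 * (r + r^-1 * (1 + n%:R ^+ 2)).
  rewrite -weight_sqr; move: (weight n) => w.
  have : 0 <= r^-1 * (r - w) ^+ 2 by rewrite mulr_ge0 ?sqr_ge0// ltW.
  have -> : r^-1 * (r - w) ^+ 2 = r - 2 * w + r^-1 * w ^+ 2.
    by field; rewrite gt_eqF.
  by lra.
apply: (@le_trans _ _ (2^-1 * (r + r^-1) * \sum_(0 <= n < N) mode f n
  + 2^-1 * r^-1 * \sum_(0 <= n < N) n%:R ^+ 2 * mode f n)).
  rewrite !mulr_sumr -big_split/=; apply: ler_sum => n _.
  apply: (@le_trans _ _ ((2^-1 * (r + r^-1 * (1 + n%:R ^+ 2))) * mode f n)).
    by rewrite ler_wpM2r ?mode_ge0.
  by rewrite le_eqVlt; apply/orP; left; apply/eqP; ring.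
have b1 := bessel_mode N sf; have b2 := bessel_mode_derive N sf.
have c1 : 0 <= 2^-1 * (r + r^-1) by rewrite mulr_ge0 ?addr_ge0 ?ltW ?invr_gt0.
have c2 : 0 <= 2^-1 * r^-1 by rewrite mulr_ge0 ?ltW ?invr_gt0.
apply: le_trans (lerD (ler_wpM2l c1 b1) (ler_wpM2l c2 b2)) _.
by rewrite le_eqVlt; apply/orP; left; apply/eqP; move: (pi) p0 => p p0; field;
  rewrite !gt_eqF.
Qed.

(** For [n >= N], [N * weight n <= weight n ^ 2 = 1 + n^2], so the tail is controlled by the H^1
    norm. *)
Lemma psum_tail f N M : (0 < N)%N -> smooth_periodic f ->
  \sum_(N <= n < M) weight n * mode f n <=
  N%:R^-1 * (2 / pi * (cint (sqdcoord f 0) + cint (sqdcoord f 1))).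
Proof.
move=> N0 sf; have N0' : 0 < N%:R :> R by rewrite ltr0n.
have [MN|NM] := leqP M N.
  rewrite big_geq// mulr_ge0 ?invr_ge0 ?(ltW N0')// mulr_ge0 ?divr_ge0 ?pi_ge0//.
  have [s _] := sf.
  by rewrite addr_ge0// cint_ge0//; [exact: continuous_sqdcoord | exact: sqdcoord_ge0
    | exact: continuous_sqdcoord | exact: sqdcoord_ge0].
apply: (@le_trans _ _ (\sum_(0 <= n < M) N%:R^-1 * ((1 + n%:R ^+ 2) * mode f n))).
  rewrite [leRHS](big_cat_nat (n := N))//=; last exact: ltnW.
  rewrite ler_wpDl//.
    by apply: sumr_ge0 => n _; rewrite !mulr_ge0 ?mode_ge0 ?invr_ge0// addr_ge0// sqr_ge0.
  apply: ler_sum_nat => n /andP[Nn _]; rewrite mulrA ler_wpM2r ?mode_ge0//.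
  rewrite mulrC ler_pdivlMr// -weight_sqr expr2 ler_pM2l ?weight_gt0//.
  rewrite -(@ler_pXn2r _ 2)// ?nnegrE ?(ltW N0') ?(ltW (weight_gt0 n))//.
  rewrite weight_sqr; have : (N%:R : R) ^+ 2 <= n%:R ^+ 2.
    by rewrite lerXn2r ?nnegrE ?ler_nat.
  by lra.
rewrite -mulr_sumr ler_wpM2l ?invr_ge0 ?(ltW N0')//.
have b1 := bessel_mode M sf; have b2 := bessel_mode_derive M sf.
under eq_bigr do rewrite mulrDl mul1r.
by rewrite big_split/= mulrDr lerD.
Qed.

Lemma smooth_Hhalf f : smooth_periodic f -> Hhalf f.
Proof.
move=> sf; have cf i := @smooth_periodic_continuous f i sf.
split.
- by case: sf.
- by move=> i; exact: continuous_measurable_fun.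
- have cd : continuous (fun x => dot (f x) (f x)).
    by have [s _] := sf; apply: continuous_dot; exact: smooth_continuous.
  have /integrableP[_] := integrable_circle cd.
  apply: le_lt_trans; apply: ge0_le_integral => //=.
  + exact: measurable_itv.
  + by move=> x _; rewrite lee_fin dotE -!expr2 !addr_ge0// sqr_ge0.
  + by apply/measurable_EFinP; apply: measurable_funTS; exact: continuous_measurable_fun.
  + apply/measurable_EFinP; apply: measurable_funTS.
    by apply: continuous_measurable_fun; exact: cont_norm.
  + by move=> x _; rewrite lee_fin ler_norm.
- apply: le_lt_trans (Hhalf_sq_le (N := 0) (fun M _ => psum_le M ltr01 sf)) _.
  by rewrite ltry.
Qed.

End fourier.

(** * Weak convergence in H^{1/2} *)

Section trigonometric_fields.
Context {R : realType}.
Implicit Types (f g : R -> 'rV[R]_3) (n N M : nat).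
Local Notation mode_index := ('I_3 * bool)%type.
Implicit Types k : mode_index.

Lemma smooth_periodicZD (a : R) f g : smooth_periodic f -> smooth_periodic g ->
  smooth_periodic (fun x => a *: f x + g x).
Proof.
move=> [/smoothP sf pf] [/smoothP sg pg]; split; last by move=> x; rewrite pf pg.
apply/smoothP => i; rewrite (_ : (fun x => _) = fun x => a * f x 0 i + g x 0 i).
  by apply: smooth_funD => //; exact: smooth_funZ.
by apply/funext => x; rewrite !mxE.
Qed.

Lemma smooth_periodicB f g : smooth_periodic f -> smooth_periodic g ->
  smooth_periodic (fun x => f x - g x).
Proof.
move=> [sf pf] [sg pg]; split; first exact: smoothB.
by move=> x; rewrite pf pg.
Qed.

Lemma smooth_periodic0 : smooth_periodic (fun=> 0 : 'rV[R]_3).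
Proof.
split=> //; apply/smoothP => i; rewrite (_ : (fun x => _) = fun=> 0).
  exact: smooth_fun0.
by apply/funext => x; rewrite mxE.
Qed.

Lemma smooth_periodic_sum (I : Type) (s : seq I) (c : I -> R) (F : I -> R -> 'rV[R]_3) :
  (forall j, smooth_periodic (F j)) ->
  smooth_periodic (fun x => \sum_(j <- s) c j *: F j x).
Proof.
move=> sF; elim: s => [|j s ih].
  by under eq_fun do rewrite big_nil; exact: smooth_periodic0.
by under eq_fun do rewrite big_cons; exact: smooth_periodicZD.
Qed.

Lemma coefB f g n k : smooth_periodic f -> smooth_periodic g ->
  coef (fun x => f x - g x) n k = coef f n k - coef g n k.
Proof.
move=> sf sg; have cf := @smooth_periodic_continuous _ f k.1 sf.
have cg := @smooth_periodic_continuous _ g k.1 sg.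
have ct := @continuous_trig R k.2 n.
rewrite /coef -mulrBr -cintB; [|repeat cstep..].
by congr (_ * _); apply: eq_cint => x; rewrite !mxE mulrBl.
Qed.

Lemma coef_sum (I : Type) (s : seq I) (c : I -> R) (F : I -> R -> 'rV[R]_3) n k :
  (forall j, smooth_periodic (F j)) ->
  coef (fun x => \sum_(j <- s) c j *: F j x) n k = \sum_(j <- s) c j * coef (F j) n k.
Proof.
move=> sF; have cF j := @smooth_periodic_continuous _ (F j) k.1 (sF j).
have ct := @continuous_trig R k.2 n.
have cc j : continuous (fun x => c j * (F j x 0 k.1 * trig k.2 n x)).
  by have cFj := cF j; repeat cstep.
rewrite /coef (eq_cint (g := fun x => \sum_(j <- s) c j * (F j x 0 k.1 * trig k.2 n x))).
  rewrite (cint_sum _ cc).2 mulr_sumr; apply: eq_bigr => j _.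
  rewrite cintZ; last by have cFj := cF j; repeat cstep.
  by rewrite mulrCA.
move=> x; rewrite summxE mulr_suml; apply: eq_bigr => j _.
by rewrite mxE mulrA.
Qed.

Definition trig_field n k (x : R) : 'rV[R]_3 :=
  \row_i (if i == k.1 then trig k.2 n x else 0).

Lemma smooth_trig_field n k : smooth_periodic (trig_field n k).
Proof.
split; last by move=> x; apply/rowP => i; rewrite !mxE periodic_trig.
apply/smoothP => i.
rewrite (_ : (fun x => _) = fun x => if i == k.1 then trig k.2 n x else 0).
  by case: (i == k.1); [exact: smooth_trig | exact: smooth_fun0].
by apply/funext => x; rewrite mxE.
Qed.

(** The coefficient of a trigonometric field on itself: 1 for [n > 0], but 2 for the constant mode
    and 0 for the sine of order 0. *)
Definition trig_mass n k : R := pi^-1 * trig_norm k.2 n.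

Lemma coef_trig_field n k n' k' :
  coef (trig_field n k) n' k' = if (n == n') && (k == k') then trig_mass n k else 0.
Proof.
rewrite /coef; case: k k' => [i b] [i' b'] /=.
have [->|ii] := eqVneq i' i; last first.
  rewrite (eq_cint (g := fun=> 0)) ?cint_cst ?mulr0.
    by rewrite xpair_eqE (eq_sym i) (negbTE ii) andbF.
  by move=> x; rewrite mxE (negbTE ii) mul0r.
rewrite (eq_cint (g := fun x => trig b n x * trig b' n' x)); last first.
  by move=> x; rewrite mxE eqxx.
rewrite cint_trig_mul xpair_eqE eqxx/= andbC; case: ifP => // _.
by rewrite mulr0.
Qed.

Lemma trig_mass_bounds n k : 0 <= trig_mass n k <= 2.
Proof.
have p0 := pi_gt0 R; rewrite /trig_mass mulr_ge0 ?invr_ge0 ?(ltW p0)//=.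
  by rewrite mulrC ler_pdivrMr// trig_norm_le.
by case: n => [|n] /=; [case: k.2; rewrite // mulr_ge0// ltW | exact: ltW].
Qed.

Definition trig_poly N (c : nat -> mode_index -> R) (x : R) : 'rV[R]_3 :=
  \sum_(j : 'I_N * mode_index) c j.1 j.2 *: trig_field j.1 j.2 x.

Lemma smooth_trig_poly N c : smooth_periodic (trig_poly N c).
Proof. by apply: smooth_periodic_sum => j; exact: smooth_trig_field. Qed.

Lemma coef_trig_poly N c n k : coef (trig_poly N c) n k =
  if (n < N)%N then c n k * trig_mass n k else 0.
Proof.
rewrite coef_sum; last by move=> j; exact: smooth_trig_field.
have [nN|Nn] := ltnP n N.
  rewrite (bigD1 (Ordinal nN, k))//= coef_trig_field !eqxx/= big1 ?addr0//.
  move=> [m k'] /= ne; rewrite coef_trig_field; case: ifP; last by rewrite mulr0.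
  move=> /andP[/eqP mn /eqP kk]; move: ne; rewrite kk.
  by rewrite (_ : m = Ordinal nN) ?eqxx//; apply: val_inj.
rewrite big1// => -[m k'] _ /=; rewrite coef_trig_field.
by rewrite (_ : _ == n = false) ?mulr0//; apply/negbTE; rewrite neq_ltn (leq_trans (ltn_ord m) Nn).
Qed.

(** The normalisation by [pi^-1] at all orders doubles the constant mode; the factor 1/2 compensates
    for it. *)
Definition partial_fourier f N : R -> 'rV[R]_3 :=
  trig_poly N (fun n k => (if n is 0 then 2^-1 else 1) * coef f n k).

Lemma coef_partial_fourier f N n k : coef (partial_fourier f N) n k =
  if (n < N)%N then coef f n k else 0.
Proof.
rewrite coef_trig_poly; case: ifP => // _.
have pn : pi != 0 :> R by rewrite gt_eqF// pi_gt0.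
case: n => [|n]; last by rewrite mul1r /trig_mass /= mulVf// mulr1.
case: k => i [] /=; rewrite /trig_mass /=.
  rewrite mulr0 mulr0 /coef (eq_cint (g := fun=> 0)) ?cint_cst ?mulr0//.
  by move=> x; rewrite /trig/= mul0r sin0 mulr0.
have -> : pi^-1 * (2 * pi) = 2 :> R by rewrite mulrCA mulVf// mulr1.
by rewrite mulrAC mulVf ?mul1r// pnatr_eq0.
Qed.

End trigonometric_fields.

Lemma young {R : realType} (a b : R) (s : R) : 0 < s ->
  `|a * b| <= 2^-1 * (s * a ^+ 2 + s^-1 * b ^+ 2).
Proof.
move=> s0; have si : 0 < s^-1 by rewrite invr_gt0.
rewrite normrM -(real_normK (num_real a)) -(real_normK (num_real b)).
move: `|a| `|b| => x y.
have : 0 <= s^-1 * (s * x - y) ^+ 2 by rewrite mulr_ge0 ?sqr_ge0// ltW.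
have -> : s^-1 * (s * x - y) ^+ 2 = s * x ^+ 2 - 2 * (x * y) + s^-1 * y ^+ 2.
  by field; rewrite gt_eqF.
by lra.
Qed.

(** * Continuous linear forms tested on the Fourier modes *)

Section duality.
Context {R : realType}.
Implicit Types (f g : R -> 'rV[R]_3) (n N M : nat).
Local Notation mode_index := ('I_3 * bool)%type.
Implicit Types k : mode_index.
Variable l : (R -> 'rV[R]_3) -> R.
Hypothesis ldual : is_Hhalf_dual l.

Let llin (a : R) f g : smooth_periodic f -> smooth_periodic g ->
  l (fun x => a *: f x + g x) = a * l f + l g.
Proof. by move=> sf sg; apply: ldual.1; exact: smooth_Hhalf. Qed.

Let l0 : l (fun=> 0) = 0.
Proof.
have s0 := @smooth_periodic0 R.
have := llin 1 s0 s0; rewrite mul1r.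
by under eq_fun do rewrite scaler0 addr0; lra.
Qed.

Lemma dual_sum (I : Type) (s : seq I) (c : I -> R) (F : I -> R -> 'rV[R]_3) :
  (forall j, smooth_periodic (F j)) ->
  l (fun x => \sum_(j <- s) c j *: F j x) = \sum_(j <- s) c j * l (F j).
Proof.
move=> sF; elim: s => [|j s ih].
  by rewrite big_nil -[RHS]l0; congr l; apply/funext => x; rewrite big_nil.
rewrite big_cons -ih -llin//; last exact: smooth_periodic_sum.
by congr l; apply/funext => x; rewrite big_cons.
Qed.

Lemma dualB f g : smooth_periodic f -> smooth_periodic g ->
  l (fun x => f x - g x) = l f - l g.
Proof.
move=> sf sg; have := llin (-1) sg sf; rewrite mulN1r addrC => <-.
by congr l; apply/funext => x; rewrite scaleN1r addrC.
Qed.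

Let L n k := l (trig_field n k).

Lemma dual_trig_poly N c :
  l (trig_poly N c) = \sum_(0 <= n < N) \sum_k c n k * L n k.
Proof.
rewrite dual_sum; last by move=> j; exact: smooth_trig_field.
by rewrite big_mkord -(pair_big xpredT xpredT (fun (n : 'I_N) k => c n k * L n k)).
Qed.

Let riesz N := \sum_(0 <= n < N) \sum_k L n k ^+ 2 / weight n.

Let riesz_term_ge0 n : 0 <= \sum_k L n k ^+ 2 / weight n.
Proof.
by apply: sumr_ge0 => k _; rewrite divr_ge0 ?sqr_ge0// ltW// weight_gt0.
Qed.

(* Testing l on the field with coefficients l(e)/w, of norm at most twice the
   square root of riesz N, on which l takes the value riesz N. *)
Lemma riesz_bounded : exists Q, forall N, riesz N <= Q.
Proof.
have [C0 C0P] := ldual.2; pose C := `|C0|.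
have CP f : Hhalf f -> `|l f| <= C * Hhalf_norm f.
  move=> Hf; apply: le_trans (C0P f Hf) _.
  by rewrite ler_wpM2r ?ler_norm// sqrtr_ge0.
have C1 : 0 <= C by exact: normr_ge0.
exists (4 * C ^+ 2) => N.
pose G := trig_poly N (fun n k => L n k / weight n).
have lG : l G = riesz N.
  rewrite dual_trig_poly; apply: eq_bigr => n _; apply: eq_bigr => k _.
  by rewrite expr2 mulrAC.
have r0 : 0 <= riesz N by apply: sumr_ge0 => n _; exact: riesz_term_ge0.
have nG : Hhalf_norm G ^+ 2 <= 4 * riesz N.
  apply: (@Hhalf_norm_le _ _ _ N) => M NM.
  rewrite /psum (big_cat_nat (n := N))//=.
  rewrite [X in _ + X](_ : _ = 0) ?addr0; last first.
    rewrite big_nat_cond big1// => n /andP[/andP[Nn _] _].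
    rewrite /mode big1 ?mulr0// => k _; rewrite coef_trig_poly ltnNge Nn/=.
    by rewrite expr0n.
  rewrite /riesz mulr_sumr; apply: ler_sum_nat => n /andP[_ nN].
  rewrite /mode !mulr_sumr; apply: ler_sum => k _; rewrite coef_trig_poly nN.
  have w0 := weight_gt0 (R := R) n; have /andP[t0 t2] := trig_mass_bounds (R := R) n k.
  have -> : weight n * (L n k / weight n * trig_mass n k) ^+ 2 =
    (L n k ^+ 2 / weight n) * trig_mass n k ^+ 2 by field; rewrite gt_eqF.
  rewrite mulrC ler_wpM2r ?divr_ge0 ?sqr_ge0 ?(ltW w0)//.
  by rewrite (_ : 4 = 2 ^+ 2) ?lerXn2r ?nnegrE//; rewrite expr2; lra.
have := CP G (smooth_Hhalf (smooth_trig_poly N _)).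
rewrite lG ger0_norm//; have h0 : 0 <= Hhalf_norm G by exact: sqrtr_ge0.
move: (Hhalf_norm G) h0 nG => h h0 h2 h1; rewrite leNgt; apply/negP => h3.
have : riesz N ^+ 2 <= C ^+ 2 * (4 * riesz N).
  apply: (@le_trans _ _ ((C * h) ^+ 2)).
    by rewrite lerXn2r ?nnegrE ?mulr_ge0.
  by rewrite exprMn ler_wpM2l ?sqr_ge0.
have : 0 < riesz N by apply: le_lt_trans h3; rewrite mulr_ge0 ?sqr_ge0.
nra.
Qed.

Let lim_partial f e : smooth_periodic f -> 0 < e ->
  exists N, forall M, (N <= M)%N -> `|l f - l (partial_fourier f M)| <= e.
Proof.
move=> sf e0; have [C0 C0P] := ldual.2; pose C := `|C0| + 1.
have C1 : 0 < C by rewrite ltr_wpDl.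
pose K := 2 / pi * (cint (sqdcoord f 0) + cint (sqdcoord f 1)).
have K0 : 0 <= K.
  have [s _] := sf; rewrite mulr_ge0 ?divr_ge0 ?pi_ge0//.
  by rewrite addr_ge0// cint_ge0//; [exact: continuous_sqdcoord | exact: sqdcoord_ge0
    | exact: continuous_sqdcoord | exact: sqdcoord_ge0].
have d0 : 0 < (e / C) ^+ 2 by rewrite exprn_gt0// divr_gt0.
(* From there on the tail bound [K / M] is at most [(e / C)^2]; the successor keeps the cut-off
   positive. *)
exists (Num.bound (K / (e / C) ^+ 2)).+1 => M NM.
have M0 : (0 < M)%N by exact: leq_trans NM.
have KM : M%:R^-1 * K <= (e / C) ^+ 2.
  rewrite mulrC ler_pdivrMr ?ltr0n// mulrC -ler_pdivrMr//.
  apply/ltW; apply: lt_le_trans (archi_boundP _) _; first by rewrite divr_ge0// ltW.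
  by rewrite ler_nat; exact: ltnW.
have sP := smooth_trig_poly M (fun n k => (if n is 0 then 2^-1 else 1) * coef f n k).
have sB := smooth_periodicB sf sP.
rewrite -dualB//; apply: le_trans (C0P _ (smooth_Hhalf sB)) _.
have : Hhalf_norm (fun x => f x - partial_fourier f M x) ^+ 2 <= (e / C) ^+ 2.
  apply: (@Hhalf_norm_le _ _ _ M) => M' MM'; apply: le_trans KM.
  rewrite /psum (big_cat_nat (n := M))//= [X in X + _](_ : _ = 0) ?add0r.
    apply: le_trans (psum_tail M' M0 sf).
    rewrite le_eqVlt; apply/orP; left; apply/eqP; apply: eq_big_nat => n /andP[Mn _].
    congr (_ * _); apply: eq_bigr => k _; rewrite coefB// coef_partial_fourier.
    by rewrite ltnNge Mn subr0.
  rewrite big_nat_cond big1// => n /andP[/andP[_ nM] _]; rewrite /mode big1 ?mulr0// => k _.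
  by rewrite coefB// coef_partial_fourier nM subrr expr0n.
rewrite -/(partial_fourier f M); set h := Hhalf_norm _ => h2.
have h0 : 0 <= h by exact: sqrtr_ge0.
have eC : 0 < e / C by rewrite divr_gt0.
have : h <= e / C by rewrite -(@ler_pXn2r _ 2)// nnegrE// ltW.
rewrite ler_pdivlMr// => h3; apply: le_trans h3; rewrite mulrC ler_wpM2l//.
by rewrite /C; have := ler_norm C0; lra.
Qed.

(** Young's inequality with parameter [d * weight n] on each mode separates the H^{1/2} sum of the
    field from the increment of [riesz]. *)
Let partial_diff f N M (d : R) : (N <= M)%N -> 0 < d ->
  `|l (partial_fourier f M) - l (partial_fourier f N)| <=
  2^-1 * (d * psum f M + d^-1 * (riesz M - riesz N)).
Proof.
move=> NM d0; rewrite !dual_trig_poly (big_cat_nat (n := N) (p := M))//= [X in X - _]addrC addrK.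
have -> : riesz M - riesz N = \sum_(N <= n < M) \sum_k L n k ^+ 2 / weight n.
  by rewrite /riesz (big_cat_nat (n := N) (p := M))//= [X in X - _]addrC addrK.
have psumE : \sum_(N <= n < M) weight n * mode f n <= psum f M.
  rewrite /psum [leRHS](big_cat_nat (n := N) (p := M))//= lerDr.
  by apply: sumr_ge0 => n _; exact: term_ge0.
apply: (@le_trans _ _ (2^-1 * (d * (\sum_(N <= n < M) weight n * mode f n)
   + d^-1 * (\sum_(N <= n < M) \sum_k L n k ^+ 2 / weight n)))); last first.
  by rewrite ler_wpM2l// lerD2r ler_wpM2l// ltW.
rewrite mulrDr !mulr_sumr -big_split/=.
apply: le_trans (ler_norm_sum _ _ _) _; apply: ler_sum => n _.
rewrite /mode !mulr_sumr -big_split/=.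
apply: le_trans (ler_norm_sum _ _ _) _; apply: ler_sum => k _.
have w0 := weight_gt0 (R := R) n.
have lam : `|if n is 0 then 2^-1 else 1 : R| <= 1.
  by case: (n) => [|_]; rewrite ger0_norm//; lra.
rewrite -mulrA normrM; apply: (@le_trans _ _ (1 * `|coef f n k * L n k|)).
  by rewrite ler_wpM2r.
rewrite mul1r; apply: le_trans (young _ _ (mulr_gt0 d0 w0)) _.
by rewrite le_eqVlt; apply/orP; left; apply/eqP; field; rewrite !gt_eqF.
Qed.

(* The right-hand side bounds the value of l at a field of small L^2 norm:
   its first term by finitely many coefficients, the last one by the
   convergence of riesz. *)
Lemma dual_bound f N (d A Q : R) : smooth_periodic f -> 0 < d ->
  (forall M, psum f M <= A) -> (forall M, riesz M <= Q) ->
  `|l f| <= `|l (partial_fourier f N)| + 2^-1 * (d * A + d^-1 * (Q - riesz N)).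
Proof.
move=> sf d0 fA rQ; apply/ler_addgt0Pr => e e0.
have [N1 N1P] := lim_partial sf e0.
pose M := maxn N N1.
have h1 := N1P M (leq_maxr _ _); have h2 := partial_diff f (leq_maxl N N1) d0.
rewrite -/M in h2.
have h3 : 2^-1 * (d * psum f M + d^-1 * (riesz M - riesz N)) <=
    2^-1 * (d * A + d^-1 * (Q - riesz N)).
  rewrite ler_wpM2l// lerD// ?ler_wpM2l ?invr_ge0 ?(ltW d0)//.
  by rewrite lerD2r.
have -> : l f = (l f - l (partial_fourier f M))
  + (l (partial_fourier f M) - l (partial_fourier f N)) + l (partial_fourier f N) by ring.
apply: le_trans (ler_normD _ _) _.
by have := ler_normD (l f - l (partial_fourier f M))
  (l (partial_fourier f M) - l (partial_fourier f N)); lra.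
Qed.

End duality.

(** * From uniform to weak convergence *)

Section weak_convergence.
Context {R : realType}.
Implicit Types (f g : R -> 'rV[R]_3).

Lemma coef_le f n (k : 'I_3 * bool) (a : R) : smooth_periodic f ->
  (forall i x, `|f x 0 i| <= a) -> `|coef f n k| <= 2 * a.
Proof.
move=> sf fa; have p0 := pi_gt0 R.
have cf := @smooth_periodic_continuous _ f k.1 sf; have ct := @continuous_trig R k.2 n.
rewrite /coef normrM (ger0_norm (x := pi^-1)) ?invr_ge0 ?(ltW p0)//.
rewrite mulrC ler_pdivrMr// mulrAC.
apply: cint_bound; first by repeat cstep.
move=> x; rewrite normrM -[leRHS]mulr1.
by apply: ler_pM => //; exact: trig_le1.
Qed.

Lemma cint_sqdcoord_le f j (a : R) : smooth f -> (forall i x, `|dcoord f j i x| <= a) ->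
  cint (sqdcoord f j) <= 2 * pi * (3 * a ^+ 2).
Proof.
move=> sf fa; rewrite -cint_cst; apply: cint_le.
- exact: continuous_sqdcoord.
- exact: cont_cst.
move=> x; have h i : dcoord f j i x ^+ 2 <= a ^+ 2.
  rewrite -(@real_normK _ (dcoord f j i x)) ?num_real// lerXn2r ?nnegrE//.
  exact: le_trans (fa i x).
by have := h ax0; have := h ax1; have := h ax2; rewrite /sqdcoord; lra.
Qed.

Lemma psum_bound f (C rho : R) M : 1 <= rho -> smooth_periodic f ->
  (forall i x, `|dcoord f 0 i x| <= C / rho) ->
  (forall i x, `|dcoord f 1 i x| <= C * rho) -> psum f M <= 18 * C ^+ 2.
Proof.
move=> r1 spf f0 f1; have [sf pf] := spf; have r0 : 0 < rho by lra.
have p0 := pi_gt0 R.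
have r20 : 0 < rho ^+ 2 by rewrite exprn_gt0.
(* The choice [r = rho^2] compensates for the sizes [C / rho] of [f] and [C * rho] of its
   derivative: both contributions are of order [C^2]. *)
apply: le_trans (psum_le M r20 spf) _.
have h0 := cint_sqdcoord_le sf f0; have h1 := cint_sqdcoord_le sf f1.
have i0 : 0 < (rho ^+ 2)^-1 by rewrite invr_gt0.
have i1 : (rho ^+ 2)^-1 <= 1.
  by rewrite invf_le1// expr2; nra.
apply: (@le_trans _ _ (pi^-1 * ((rho ^+ 2 + (rho ^+ 2)^-1) * (2 * pi * (3 * (C / rho) ^+ 2))
   + (rho ^+ 2)^-1 * (2 * pi * (3 * (C * rho) ^+ 2))))).
  rewrite ler_wpM2l ?invr_ge0 ?(ltW p0)// lerD// ler_wpM2l//; last exact: ltW.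
  by rewrite addr_ge0// ltW.
have -> : pi^-1 * ((rho ^+ 2 + (rho ^+ 2)^-1) * (2 * pi * (3 * (C / rho) ^+ 2))
   + (rho ^+ 2)^-1 * (2 * pi * (3 * (C * rho) ^+ 2)))
  = 6 * C ^+ 2 * (2 + (rho ^+ 2)^-1 * (rho ^+ 2)^-1).
  by move: (pi) p0 => p p0; field; rewrite !gt_eqF.
have C2 := sqr_ge0 C.
have : (rho ^+ 2)^-1 * (rho ^+ 2)^-1 <= 1 * 1 by apply: ler_pM => //; exact: ltW.
move: (_^-1 * _) => t t1; nra.
Qed.

(** The differences are bounded in H^{1/2} and tend to 0 uniformly, hence mode by mode. A cut-off
    [N], chosen by the form alone, leaves a tail of [riesz] so small that the high modes contribute
    little on the bounded set; finitely many low modes remain. *)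
Lemma weak_cvg_criterion (f_ : nat -> R -> 'rV[R]_3) f (rho : nat -> R) (C : R) :
  (forall m, smooth_periodic (f_ m)) -> smooth_periodic f ->
  (forall m, 1 <= rho m) -> rho m @[m --> \oo] --> +oo ->
  (forall m i x, `|dcoord (fun s => f_ m s - f s) 0 i x| <= C / rho m) ->
  (forall m i x, `|dcoord (fun s => f_ m s - f s) 1 i x| <= C * rho m) ->
  weak_Hhalf_cvg f_ f.
Proof.
move=> sf_ sf r1 rcvg h0 h1; split.
- by move=> m; exact: smooth_Hhalf.
- exact: smooth_Hhalf.
move=> l ldual; pose g m := fun s => f_ m s - f s.
have sg m : smooth_periodic (g m) by exact: smooth_periodicB.
pose A := 18 * C ^+ 2; have A0 : 0 <= A by rewrite mulr_ge0// sqr_ge0.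
have gA m M : psum (g m) M <= A by exact: psum_bound (r1 m) (sg m) (h0 m) (h1 m).
have [Q0 Q0P] := riesz_bounded ldual.
pose r N := \sum_(0 <= n < N) \sum_k l (trig_field n k) ^+ 2 / weight n.
have hsup : has_sup (range r).
  by split; [exists (r 0%N); exists 0%N | exists Q0 => _ [N _ <-]; exact: Q0P].
pose Q := sup (range r).
have QP N : r N <= Q by apply: ub_le_sup; [exact: hsup.2 | exists N].
apply/cvgrPdist_le => e e0.
(* The budget is [e / 4] for the low modes, [d * A / 2 <= e / 2] for the bounded part and [e / 4]
   for the tail of [riesz]. *)
pose d := e / (A + 1); have d0 : 0 < d by rewrite divr_gt0//; lra.
have dA : d * A <= e.
  by rewrite /d mulrAC ler_pdivrMr; [nra | lra].
have de : 0 < d * (e / 2) by rewrite mulr_gt0// divr_gt0.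
have [_ [N _ <-] QN] := sup_adherent de hsup.
have QN' : d^-1 * (Q - r N) <= e / 2.
  by rewrite mulrC ler_pdivrMr// mulrC; rewrite -/Q in QN; lra.
pose S := \sum_(0 <= n < N) \sum_k `|l (trig_field n k)|.
have S0 : 0 <= S by apply: sumr_ge0 => n _; apply: sumr_ge0.
have C0 : 0 <= C.
  have := le_trans (normr_ge0 _) (h1 0%N ax0 0).
  by rewrite pmulr_lge0//; have := r1 0%N; lra.
near=> m.
have rm : 8 * C * S / e <= rho m.
  by near: m; move/cvgryPge : rcvg; exact.
have rho0 : 0 < rho m by have := r1 m; lra.
have lP : `|l (partial_fourier (g m) N)| <= e / 4.
  rewrite dual_trig_poly//; apply: (@le_trans _ _ (2 * (C / rho m) * S)).
    apply: le_trans (ler_norm_sum _ _ _) _; rewrite mulr_sumr.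
    apply: ler_sum => n _; apply: le_trans (ler_norm_sum _ _ _) _.
    rewrite mulr_sumr; apply: ler_sum => k _; rewrite normrM ler_wpM2r//.
    have lam : `|if n is 0 then 2^-1 else 1 : R| <= 1.
      by case: (n) => [|_]; rewrite ger0_norm//; lra.
    rewrite normrM -[leRHS]mul1r; apply: ler_pM => //.
    apply: coef_le => // i x; have := h0 m i x; by rewrite dcoordE.
  rewrite (_ : 2 * (C / rho m) * S = 2 * C * S / rho m); last by ring.
  rewrite ler_pdivrMr//; move: rm; rewrite ler_pdivrMr//; lra.
rewrite distrC -dualB//.
apply: le_trans (dual_bound ldual N (sg m) d0 (gA m) QP) _.
rewrite -/(r N); lra.
Unshelve. all: by end_near. Qed.

End weak_convergence.

(** * The flow map *)

Section initial_convergence.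

Lemma cvg_initial (S : choiceType) (T : topologicalType) (f : S -> T)
  (u : nat -> S) (s : S) : f (u m) @[m --> \oo] --> f s ->
  u m @[m --> \oo] --> (s : initial_topology f).
Proof.
move=> cu A; rewrite nbhsE => -[B [[C oC CB] Bs] BA].
have Cs : nbhs (f s) C by apply: open_nbhs_nbhs; split=> //; move: Bs; rewrite -CB.
have nC : \forall m \near \oo, C (f (u m)) := cu C Cs.
suff : \forall m \near \oo, A (u m) by [].
by near=> m; apply: BA; rewrite -CB /=; near: m.
Unshelve. all: by end_near.
Qed.

(** The pointwise topology is the supremum of the initial topologies of the evaluations. *)
Lemma cvg_ptws (X : Type) (T : topologicalType) (u : nat -> X -> T) (f : X -> T) :
  (forall x, u m x @[m --> \oo] --> f x) ->
  (u m : {ptws X -> T}) @[m --> \oo] --> (f : {ptws X -> T}).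
Proof.
move=> cu; apply/cvg_sup => x.
exact: (@cvg_initial _ _ (fun h : forall _ : X, T => h x) u f (cu x)).
Qed.

Lemma ptws_cvg_eval (X : Type) (T : topologicalType) (u : nat -> X -> T) (f : X -> T) x :
  (u m : {ptws X -> T}) @[m --> \oo] --> (f : {ptws X -> T}) ->
  u m x @[m --> \oo] --> f x.
Proof.
move=> /cvg_sup /(_ x) cu.
exact: (cvg_comp _ _ cu (@initial_continuous _ _ (fun h : forall _ : X, T => h x) f)).
Qed.

End initial_convergence.

(** * The waves under the flow; discontinuity *)

Section flow_of_waves.
Context {R : realType}.

(** The solution chosen by [flow] comes without bounds; it is identified with [u] because
    [solution_unique] bounds one solution only. *)
Lemma flow_solution (u : R -> R -> 'rV[R]_3) (u0 : sphere_map R) (K : R) :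
  is_solution u -> u 0 = sval u0 ->
  (forall t i x, `|dcoord (u t) 1 i x| <= K) ->
  (forall t i x, `|dcoord (u t) 3 i x| <= K) ->
  forall t, sval (flow t u0) = u t.
Proof.
move=> su e b1 b3 t; rewrite /flow; case: pselect => [h|[]]; last by exists u.
rewrite /solution_value; case: (cid h) => v [[sm cv dv] ve] /=.
by rewrite (solution_unique su (And3 sm cv dv) b1 b3)// e ve.
Qed.

Lemma rotating_wave_flow (V : nat -> 'I_3 -> R -> R) (om c : R) (u0 : sphere_map R) :
  is_solution (rotating_wave V om c) ->
  (forall j i (x : R), has_deriv (V j i) x (V j.+1 i x)) ->
  (forall i x, V 0%N i (x + 2 * pi) = V 0%N i x) ->
  sval u0 = rotating_wave V om c 0 ->
  forall t, sval (flow t u0) = rotating_wave V om c t.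
Proof.
move=> sV dV pV e.
have [K1 b1] := rotating_wave_bounded om c dV pV 1.
have [K3 b3] := rotating_wave_bounded om c dV pV 3.
apply: (@flow_solution _ _ (Num.max K1 K3)) => // t i x.
- by rewrite le_max b1.
- by rewrite le_max b3 orbT.
Qed.

(** A great circle at unit speed has [V'' = - V], so it solves the profile equation with
    [om = c = 0]; being a bounded wave, it is then also the flow of its own datum. *)
Lemma ustar_wave : exists V : nat -> 'I_3 -> R -> R,
  [/\ is_solution (rotating_wave V 0 0),
      forall j i (x : R), has_deriv (V j i) x (V j.+1 i x),
      forall i x, V 0%N i (x + 2 * pi) = V 0%N i x &
      rotating_wave V 0 0 = @ustar R].
Proof.
have CS x := @cos2Dsin2 R x.
have [] := @profile_family R cos sin (fun=> 0) (fun x => - sin x) cos (fun=> 0) 0 0.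
- by move=> x; exact: is_derive_cos.
- by move=> x; exact: is_derive_sin.
- by move=> x; exact: has_deriv_cst.
- move=> x; apply: has_deriv_eq; first by apply: has_derivN; exact: is_derive_sin.
  by rewrite -[LHS]mulr1 -(CS x); ring.
- move=> x; apply: has_deriv_eq; first exact: is_derive_cos.
  by rewrite -[LHS]mulr1 -(CS x); ring.
- by move=> x; apply: has_deriv_eq; [exact: has_deriv_cst | ring].
- by move=> x; rewrite expr0n/= addr0.
move=> V [dV [V0 [V1 V2]] VP m0 [m1 m2]].
have pV i x : V 0%N i (x + 2 * pi) = V 0%N i x.
  have e : x + 2 * pi = x + pi *+ 2 by rewrite mulr_natl.
  by elim/ord3_ind: i; rewrite ?(V0, V1, V2)// e ?cosD2pi ?sinD2pi.
exists V; split=> //.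
  by apply: rotating_wave_solution => // x; rewrite V0 V1 V2 expr0n/= addr0.
apply/funext => t; apply/funext => s.
rewrite /rotating_wave V0 V1 V2 !mul0r subr0 cos0 sin0 !mul1r !mul0r subr0 add0r.
by [].
Qed.

Lemma ustar_solution : is_solution (@ustar R).
Proof. by have [V [sV _ _ <-]] := ustar_wave. Qed.

Lemma ustar_smooth t : smooth_sphere_map (@ustar R t).
Proof. by have [/(_ t)] := ustar_solution. Qed.

Definition ustar_map : sphere_map R := exist _ (ustar 0) (ustar_smooth 0).

Lemma flow_ustar t : sval (flow t ustar_map) = ustar t.
Proof.
have [V [sV dV pV e]] := ustar_wave.
by rewrite (rotating_wave_flow sV dV pV) ?e.
Qed.

Definition shifted (a s : R) : 'rV[R]_3 := ustar 0 (s + a).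

Lemma shiftedE a i s : shifted a s 0 i = row3 (cos (s + a)) (sin (s + a)) 0 0 i.
Proof. by []. Qed.

Lemma smooth_shifted a : smooth_periodic (shifted a).
Proof.
have [p sm _] := ustar_smooth 0; split; last first.
  by move=> x; rewrite /shifted addrAC p.
apply/smoothP => i; have /smoothP/(_ i)[F [F0 dF]] := sm.
exists (fun j x => F j (x + a)); split; first by rewrite F0.
move=> j x; apply: has_deriv_eq; first by apply: (@has_deriv_comp _ (F j)); [exact: dF | repeat dstep].
by rewrite addr0 mulr1.
Qed.

Lemma dcoord_shifted_1 a i s :
  dcoord (shifted a) 1 i s = row3 (- sin (s + a)) (cos (s + a)) 0 0 i.
Proof.
have [sm _] := smooth_shifted a.
have d := smooth_dcoord 0 i s sm.
have dc : has_deriv (fun y : R => y + a) s 1.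
  by apply: has_deriv_eq; [repeat dstep | rewrite addr0].
apply: (has_deriv_unique d); rewrite dcoord_funE/=.
elim/ord3_ind: i {d}; rewrite row3E.
- under eq_fun do rewrite shiftedE row3_0.
  by apply: has_deriv_eq; [apply: has_deriv_cos; exact: dc | rewrite mulr1].
- under eq_fun do rewrite shiftedE row3_1.
  by apply: has_deriv_eq; [apply: has_deriv_sin; exact: dc | rewrite mulr1].
- under eq_fun do rewrite shiftedE row3_2.
  exact: has_deriv_cst.
Qed.

(** If the profile were the equator, the wave would have the angle [om * t + s - c * t]. The
    constant collects [2 * C] for the rotated deviation of the profile, [|t| * C] for the error on
    the angle and, in the derivative, 1 for the speed of the shifted equator. *)
Lemma wave_close (V : nat -> 'I_3 -> R -> R) (om c sigma C rho t : R) :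
  (forall j i (x : R), has_deriv (V j i) x (V j.+1 i x)) ->
  smooth (rotating_wave V om c t) ->
  1 <= rho ->
  `|om - c - sigma| <= C / rho ->
  (forall i x, `|V 0%N i x - row3 (cos x) (sin x) 0 0 i| <= C / rho) ->
  (forall i x, `|V 1%N i x| <= C * rho) ->
  (forall i s, `|dcoord (fun s => rotating_wave V om c t s - shifted (sigma * t) s) 0 i s|
     <= ((2 + `|t|) * C + 1) / rho) /\
  (forall i s, `|dcoord (fun s => rotating_wave V om c t s - shifted (sigma * t) s) 1 i s|
     <= ((2 + `|t|) * C + 1) * rho).
Proof.
move=> dV sm r1 drift V0 V1.
have r0 : 0 < rho by lra.
have ri : 0 < rho^-1 by rewrite invr_gt0.
have C0 : 0 <= C.
  by have := le_trans (normr_ge0 _) drift; rewrite pmulr_lge0.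
have t0 := normr_ge0 t.
have [smf _] := smooth_shifted (sigma * t).
have phase (s : R) : `|om * t + (s - c * t) - (s + sigma * t)| <= `|t| * (C / rho).
  rewrite (_ : _ - _ = t * (om - c - sigma)); last by ring.
  by rewrite normrM ler_wpM2l.
have Cr : 0 <= C / rho by rewrite divr_ge0// ltW.
have fin (x : R) : x <= 2 * (C / rho) + `|t| * (C / rho) ->
    x <= ((2 + `|t|) * C + 1) / rho.
  move=> h; apply: le_trans h _.
  rewrite [leRHS](_ : _ = 2 * (C / rho) + `|t| * (C / rho) + rho^-1); last by ring.
  by lra.
have tCr : 0 <= `|t| * (C / rho) by rewrite mulr_ge0.
split=> i s; rewrite dcoordB// dcoord_rotating_wave//.
- set y := s - c * t; rewrite (dcoordE (shifted _)) derive1n0 shiftedE.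
  apply: fin; have := phase s; rewrite -/y.
  have := V0 ax0 y; have := V0 ax1 y; have := V0 ax2 y; rewrite !row3E.
  elim/ord3_ind: i; rewrite !row3E => v2 v1 v0 ph.
  + rewrite (_ : _ - _ = (cos (om * t) * (V 0%N ax0 y - cos y)
        + sin (om * t) * (- (V 0%N ax1 y - sin y)))
        + (cos (om * t + y) - cos (s + sigma * t))); last by rewrite (cosD (om * t)); ring.
    apply: le_trans (ler_normD _ _) _; apply: lerD.
      by apply: trig_combination_le => //; rewrite normrN.
    exact: le_trans (cos_lipschitz _ _) ph.
  + rewrite (_ : _ - _ = (cos (om * t) * (V 0%N ax1 y - sin y)
        + sin (om * t) * (V 0%N ax0 y - cos y))
        + (sin (om * t + y) - sin (s + sigma * t))); last by rewrite (sinD (om * t)); ring.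
    apply: le_trans (ler_normD _ _) _; apply: lerD; first exact: trig_combination_le.
    exact: le_trans (sin_lipschitz _ _) ph.
  + by move: v2; rewrite !subr0; lra.
- set y := s - c * t; rewrite dcoord_shifted_1.
  have v0 := V1 ax0 y; have v1 := V1 ax1 y; have v2 := V1 ax2 y.
  have tC : 0 <= `|t| * C * rho by rewrite !mulr_ge0// ltW.
  have fin' (a b : R) : `|a| <= 2 * (C * rho) -> `|b| <= 1 ->
      `|a - b| <= ((2 + `|t|) * C + 1) * rho.
    move=> h1 h2; apply: le_trans (ler_normB _ _) _.
    by rewrite !mulrDl; lra.
  have Cr' : 0 <= C * rho by rewrite mulr_ge0// ltW.
  elim/ord3_ind: i; rewrite !row3E; apply: fin'.
  + by rewrite -[- (sin _ * _)]mulrN; apply: trig_combination_le; rewrite ?normrN.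
  + by rewrite normrN; exact: sin_max.
  + by rewrite addrC; apply: trig_combination_le.
  + exact: cos_max.
  + lra.
  + by rewrite normr0 ler01.
Qed.

Lemma kida_data (sigma : R) : exists u0 : nat -> sphere_map R,
  exists rho : nat -> R, exists C : R -> R,
  [/\ forall m, 1 <= rho m, rho m @[m --> \oo] --> +oo,
      forall m, is_solution_from (u0 m) (fun t => sval (flow t (u0 m))),
      forall t m i s, `|dcoord (fun s => sval (flow t (u0 m)) s - shifted (sigma * t) s) 0 i s|
        <= C t / rho m &
      forall t m i s, `|dcoord (fun s => sval (flow t (u0 m)) s - shifted (sigma * t) s) 1 i s|
        <= C t * rho m].
Proof.
have [C [N0 CP]] := kida_sequence sigma.
(* The successor ensures [1 <= rho m] even if [N0] is 0. *)
pose N m := (m + N0).+1; pose rho m := Num.sqrt ((N m)%:R : R).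
have rho1 m : 1 <= rho m.
  by rewrite -[leLHS]sqrtr1 ler_wsqrtr// ler1n.
have wave m : exists w : (nat -> 'I_3 -> R -> R) * R * R,
  [/\ is_solution (rotating_wave w.1.1 w.1.2 w.2),
      forall j i (x : R), has_deriv (w.1.1 j i) x (w.1.1 j.+1 i x),
      forall i x, w.1.1 0%N i (x + 2 * pi) = w.1.1 0%N i x,
      `|w.1.2 - w.2 - sigma| <= C / rho m &
      (forall i x, `|w.1.1 0%N i x - row3 (cos x) (sin x) 0 0 i| <= C / rho m) /\
      (forall i x, `|w.1.1 1%N i x| <= C * rho m)].
  have [_ [V [om [c H]]]] := CP (N m) (leqW (leq_addl _ _)).
  by exists (V, om, c).
have [w wP] := choice wave.
have sm m t : smooth_sphere_map (rotating_wave (w m).1.1 (w m).1.2 (w m).2 t).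
  by have [[sm _ _] _ _ _ _] := wP m; exact: sm.
pose u0 m : sphere_map R := exist _ _ (sm m 0).
have flowE m t : sval (flow t (u0 m)) = rotating_wave (w m).1.1 (w m).1.2 (w m).2 t.
  by have [sV dV pV _ _] := wP m; exact: rotating_wave_flow.
exists u0, rho, (fun t => (2 + `|t|) * C + 1); split=> //.
- apply/cvgryPge => A; near=> m.
  have [A0|A0] := leP A 0; first by exact: le_trans A0 (sqrtr_ge0 _).
  rewrite -(@ler_pXn2r _ 2)// ?nnegrE ?sqrtr_ge0 ?(ltW A0)// sqr_sqrtr//.
  have : (Num.bound (A ^+ 2) <= m)%N by near: m; exact: nbhs_infty_ge.
  move=> h; apply/ltW/(lt_le_trans (archi_boundP (sqr_ge0 A))).
  by rewrite ler_nat (leq_trans h)// leqW// leq_addr.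
- move=> m; have [sV _ _ _ _] := wP m; split; last by rewrite flowE.
  by rewrite (_ : (fun t => _) = rotating_wave (w m).1.1 (w m).1.2 (w m).2)//;
    apply/funext => t; exact: flowE.
- move=> t m i s; rewrite flowE; have [_ dV _ drift [V0 V1]] := wP m.
  by have [_ smt _] := sm m t; have [h _] := wave_close dV smt (rho1 m) drift V0 V1; exact: h.
- move=> t m i s; rewrite flowE; have [_ dV _ drift [V0 V1]] := wP m.
  by have [_ smt _] := sm m t; have [_ h] := wave_close dV smt (rho1 m) drift V0 V1; exact: h.
Unshelve. all: by end_near. Qed.

Lemma sphere_smooth_periodic (u : sphere_map R) : smooth_periodic (sval u).
Proof. by case: (svalP u) => p s _. Qed.

(** The last clause is convergence as distributions, the form in which the discontinuity is read
    off; it follows directly from uniform convergence. *)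
Lemma kida_weak_cvg (sigma : R) : exists u0 : nat -> sphere_map R,
  [/\ weak_Hhalf_cvg (fun m => sval (u0 m)) (ustar 0),
      forall m, is_solution_from (u0 m) (fun t => sval (flow t (u0 m))),
      forall t : R, weak_Hhalf_cvg (fun m => sval (flow t (u0 m)))
        (fun s => ustar t (s + sigma * t)) &
      forall (t : R) phi, smooth_periodic phi ->
        l2prod (sval (flow t (u0 m))) phi @[m --> \oo]
          --> l2prod (shifted (sigma * t)) phi].
Proof.
have [u0 [rho [C [r1 rcvg sol h0 h1]]]] := kida_data sigma.
have H t : weak_Hhalf_cvg (fun m => sval (flow t (u0 m))) (shifted (sigma * t)).
  apply: (weak_cvg_criterion _ (smooth_shifted _) r1 rcvg (h0 t) (h1 t)) => m.
  exact: sphere_smooth_periodic.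
exists u0; split=> //.
- have := H 0; rewrite mulr0.
  have -> : shifted 0 = ustar 0.
    by apply/funext => s; rewrite /shifted addr0.
  have -> // : (fun m => sval (flow 0 (u0 m))) = fun m => sval (u0 m).
  by apply/funext => m; have [_ e] := sol m.
- move=> t phi sphi.
  have cphi i := @smooth_periodic_continuous _ phi i sphi.
  have cu m i := @smooth_periodic_continuous _ _ i (sphere_smooth_periodic (flow t (u0 m))).
  have cs i := @smooth_periodic_continuous _ _ i (smooth_shifted (sigma * t)).
  have [K Kphi] : exists K, forall x, `|phi x 0 ax0| + `|phi x 0 ax1| + `|phi x 0 ax2| <= K.
    have cn : continuous (fun x => `|phi x 0 ax0| + `|phi x 0 ax1| + `|phi x 0 ax2|).
      by apply: contD; [apply: contD|]; exact: cont_norm.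
    have [|K KP] := periodic_bounded cn; first by move=> x; rewrite sphi.2.
    by exists K => x; apply: le_trans (KP x); exact: ler_norm.
  have K0 : 0 <= K by apply: le_trans (Kphi 0); rewrite !addr_ge0.
  apply/cvgrPdist_le => e e0; near=> m.
  have rm : 2 * pi * (C t * K) / e <= rho m by near: m; move/cvgryPge : rcvg; exact.
  have rho0 : 0 < rho m by have := r1 m; lra.
  rewrite distrC !l2prodE -cintB; first last.
  + by have c0 := cs; repeat cstep.
  + by have c0 := cu m; repeat cstep.
  apply: (@le_trans _ _ (2 * pi * (C t / rho m * K))); last first.
    rewrite (_ : 2 * pi * _ = 2 * pi * (C t * K) / rho m); last by ring.
    by rewrite ler_pdivrMr// [leRHS]mulrC -ler_pdivrMr.
  apply: cint_bound; first by have c0 := cs; have c1 := cu m; repeat cstep.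
  move=> x; have hx i : `|sval (flow t (u0 m)) x 0 i - shifted (sigma * t) x 0 i| <= C t / rho m.
    by have := h0 t m i x; rewrite dcoordE /= !mxE.
  have Ct : 0 <= C t / rho m by apply: le_trans (hx ax0).
  set f := sval _ in hx *; set g := shifted _ in hx *.
  rewrite (_ : _ - _ = (f x 0 ax0 - g x 0 ax0) * phi x 0 ax0
    + (f x 0 ax1 - g x 0 ax1) * phi x 0 ax1
    + (f x 0 ax2 - g x 0 ax2) * phi x 0 ax2); last by ring.
  apply: (@le_trans _ _ (C t / rho m * (`|phi x 0 ax0| + `|phi x 0 ax1| + `|phi x 0 ax2|))).
    rewrite !mulrDr; apply: le_trans (ler_normD _ _) _; apply: lerD.
      apply: le_trans (ler_normD _ _) _; apply: lerD; by rewrite normrM ler_wpM2r.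
    by rewrite normrM ler_wpM2r.
  by rewrite ler_wpM2l.
Unshelve. all: by end_near. Qed.

Lemma flow_discontinuous (t : R) : t != 0 ->
  ~ continuous (fun u : weak_sphere_map R =>
                  (distribution_of (flow t u) : weak_distribution R)).
Proof.
move=> t0 cont.
have [u0 [w0 _ _ H]] := kida_weak_cvg (pi / t).
have cu : u0 m @[m --> \oo] --> (ustar_map : weak_sphere_map R).
  apply: cvg_initial; apply: cvg_ptws => l.
  by case: w0 => _ _ /(_ (sval l) (svalP l)).
have c1 := cvg_comp _ _ cu (cont ustar_map).
have c2 := cvg_comp _ _ c1 (@initial_continuous _ _ (@distribution_eval R) _).
have [p sm _] := ustar_smooth 0.
pose phi : test_map R := exist _ (ustar 0) (conj p sm).
have c3 := @ptws_cvg_eval _ _ (fun m => distribution_eval (distribution_of (flow t (u0 m))))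
  _ phi c2.
(* The two limits of the same pairings: [c3] is what continuity would give, the equator at rest, and
   [c4] is the actual limit, the equator shifted by [pi]. *)
have c4 := H t (ustar 0) (conj sm p).
have := cvg_unique (@Rhausdorff R) c3 c4.
rewrite /= divfK// flow_ustar !l2prodE => e.
have ec : cint (fun x => ustar t x 0 ax0 * ustar 0 x 0 ax0 + ustar t x 0 ax1 * ustar 0 x 0 ax1
    + ustar t x 0 ax2 * ustar 0 x 0 ax2) = 2 * pi.
  rewrite (eq_cint (g := fun=> 1)) ?cint_cst ?mulr1// => x.
  by rewrite !row3E mul0r addr0 -!expr2 cos2Dsin2.
have ec' : cint (fun x => shifted pi x 0 ax0 * ustar 0 x 0 ax0 + shifted pi x 0 ax1 * ustar 0 x 0 ax1
    + shifted pi x 0 ax2 * ustar 0 x 0 ax2) = 2 * pi * -1.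
  rewrite (eq_cint (g := fun=> -1)) ?cint_cst// => x.
  rewrite !row3E mul0r addr0 cosDpi sinDpi !mulNr -!expr2 -opprD cos2Dsin2//.
move: e; rewrite ec ec' => e.
have e' : 2 * pi = 2 * pi * -1 :> R by exact: e.
by have := @twopi_gt0 R; lra.
Qed.

End flow_of_waves.

Theorem theorem2 (R : realType) :
  (forall t : R, t != 0 ->
     ~ continuous (fun u : weak_sphere_map R =>
                     (distribution_of (flow t u) : weak_distribution R))) /\
  (is_solution (@ustar R) /\
   forall sigma0 : R, exists u0 : nat -> sphere_map R,
     [/\ weak_Hhalf_cvg (fun m => sval (u0 m)) (ustar 0),
         forall m, is_solution_from (u0 m) (fun t => sval (flow t (u0 m))) &
         forall t : R,
           weak_Hhalf_cvg (fun m => sval (flow t (u0 m)))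
                          (fun s => ustar t (s + sigma0 * t))]).
Proof.
split; first exact: flow_discontinuous.
split; first exact: ustar_solution.
move=> sigma; have [u0 [w sol H _]] := kida_weak_cvg sigma.
by exists u0.
Qed.
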